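(* Let $0<\bar\varepsilon<1$, let $k\in C^2([-1,1])$, let $K:L^\infty((0,1))\to L^2((0,1))$ be $Ku(t)=\int_0^1k(x-t)u(x)\,dx$, and let $G$ be the BV-seminorm regularizer with zero boundary conditions defined in the context. Let $u_0=\frac12\sum_{i=1}^n c_0^i\sigma_i\mathbf 1_{[a_0^i,b_0^i]}\in L^\infty((0,1))$ with $c_0^i>0$, $\sigma_i\in\{-1,1\}$, $a_0^i,b_0^i\in[\bar\varepsilon,1-\bar\varepsilon]$, $a_0^i<b_0^i$, and let $y_0=Ku_0$. Suppose that 1. $\mathrm{Im}\,K_*\cap\partial G(u_0)\ne\emptyset$; 2. for $\sigma\in\{-1,1\}$ and $a<b$ in $[\bar\varepsilon,1-\bar\varepsilon]$, one has $\frac12\sigma\int_a^b\eta_0\,dx=1$ if and only if $(\sigma,a,b)=(\sigma_i,a_0^i,b_0^i)$ for some $i\in\{1,\dots,n\}$; 3. $\eta_0\in C^1((0,1))$, $\sigma_i\eta_0'(a_0^i)>0$ and $\sigma_i\eta_0'(b_0^i)<0$ for all $i=1,\dots,n$, where $\eta_0$ is the minimal-norm dual certificate. Assume moreover that $K(\mathbf 1_{[a_0^1,b_0^1]}),\dots,K(\mathbf 1_{[a_0^n,b_0^n]})$ are linearly independent in $L^2((0,1))$. Then, for every sufficiently small $\varepsilon>0$, there exist $\alpha>0$ and $\lambda_0>0$ such that, for all $(\lambda,w)\in N_{\alpha,\lambda_0}$ with $\lambda>0$, the problem $\min_{u\in L^\infty((0,1))}\frac12\|Ku-y_0-w\|_{L^2}^2+\lambda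 G(u)$ has a unique solution $\tilde u_\lambda$, and it admits a unique representation $$\tilde u_\lambda=\frac12\sum_{i=1}^n\tilde c_\lambda^i\sigma_i\mathbf 1_{[\tilde a_\lambda^i,\tilde b_\lambda^i]},$$ where $\frac12\sigma_i\mathbf 1_{[\tilde a_\lambda^i,\tilde b_\lambda^i]}\in B_\varepsilon(\frac12\sigma_i\mathbf 1_{[a_0^i,b_0^i]})$, $\frac12\sigma_i\int_{\tilde a_\lambda^i}^{\tilde b_\lambda^i}\tilde\eta_\lambda\,dx=1$, $\tilde c_\lambda^i>0$ and $|\tilde c_\lambda^i-c_0^i|\le\varepsilon$ for all $i=1,\dots,n$.
   Context: $L^\infty((0,1))$ is regarded as the dual of $L^1((0,1))$. Let $E=\{u\in L^\infty((0,1)):u(x)=0\text{ for a.e. }x\in(0,\bar\varepsilon)\cup(1-\bar\varepsilon,1)\}$ and $G(u)=|Du|((0,1))$ if $u\in BV((0,1))\cap E$, $G(u)=+\infty$ otherwise, where $|Du|((0,1))$ is the total variation of the distributional derivative. Pre-adjoint: $K_*:L^2((0,1))\to L^1((0,1))$, $K_*y(t)=\int_0^1k(t-x)y(x)\,dx$. Subdifferentials are taken in the predual: for $G(u)<\infty$, $\partial G(u)=\{\eta\in L^1((0,1)):G(u)+\int_0^1\eta(v-u)\,dx\le G(v)\ \forall v\in L^\infty((0,1))\}$. Minimal-norm dual certificate: $\eta_0=K_*p_0$, where $p_0$ is the solution of minimal $L^2$-norm of $\sup\{(y_0,p)_{L^2}:p\in L^2((0,1)),\ K_*p\in\partial G(0)\}$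 (a solution exists under hypothesis 1). For $\lambda>0$ and noise $w\in L^2((0,1))$, $\tilde\eta_\lambda=K_*\tilde p_\lambda$ where $\tilde p_\lambda$ is the unique maximizer of $\lambda(y_0+w,p)-\frac{\lambda^2}2\|p\|_{L^2}^2$ over $\{p:K_*p\in\partial G(0)\}$. $N_{\alpha,\lambda_0}=\{(\lambda,w)\in\mathbb R_+\times L^2((0,1)):0\le\lambda\le\lambda_0,\ \|w\|_{L^2}\le\alpha\lambda\}$. $\mathcal B$ is the weak* closure in $L^\infty((0,1))$ of the set of extreme points of $\{u:G(u)\le1\}$, $d_{\mathcal B}$ is a metric on $\mathcal B$ metrizing weak* convergence, and $B_\varepsilon(v)=\{u\in\mathcal B:d_{\mathcal B}(u,v)\le\varepsilon\}$. $\mathbf 1_A$ is the indicator function of $A$. *)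

(* Defs.v *)
From HB Require Import structures.
From mathcomp Require Import all_boot all_order all_algebra.
From mathcomp Require Import all_classical all_reals all_analysis.

Set Implicit Arguments.
Unset Strict Implicit.
Unset Printing Implicit Defensive.
Import Order.TTheory GRing.Theory Num.Theory.
Import numFieldNormedType.Exports.

Local Open Scope classical_set_scope.
Local Open Scope ring_scope.

(** An element of L^p((0,1)) is represented by a function [R -> R] in
    [Lfun (mu01 R) p]; two representatives are identified when they are equal
    almost everywhere for [mu01 R], so only their values on (0,1) matter. *)

Definition mu01 (R : realType) : set (measurableTypeR R) -> \bar R :=
  mrestr (@lebesgue_measure R) (measurable_itv `]0%R, 1%R[).

HB.instance Definition _ (R : realType) := Measure.on (@mu01 R).

Lemma mu01_fin (R : realType) : fin_num_fun (@mu01 R).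
Proof.
move=> A mA; rewrite /mu01 /mrestr ge0_fin_numE ?measure_ge0//.
apply: (@le_lt_trans _ _ (@lebesgue_measure R `]0%R, 1%R[)).
  by rewrite le_measure// inE//; apply: measurableI.
by rewrite lebesgue_measure_itv/= lte_fin ltr01 oppr0 adde0 ltry.
Qed.

HB.instance Definition _ (R : realType) :=
  Measure_isFinite.Build _ _ _ (@mu01 R) (@mu01_fin R).

Definition inner2 (R : realType) (f g : R -> R) : R :=
  \int[@mu01 R]_x (f x * g x).

Definition norm2 (R : realType) (f : R -> R) : R :=
  fine 'N[@mu01 R]_2%:E[EFin \o f]%E.

(** Test functions of C^1_c((0,1)), extended by zero. *)
Definition test_fun (R : realType) (phi : R -> R) : Prop :=
  [/\ forall x, derivable phi x 1, continuous (derive1 phi),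
      compact (closure [set x | phi x != 0])
    & closure [set x | phi x != 0] `<=` `]0, 1[].

Definition distr_deriv (R : realType) (u phi : R -> R) : R :=
  - \int[@mu01 R]_x (u x * derive1 phi x).

(** [|Du|((0,1))], the total variation of [Du], i.e. its norm as a functional on
    test functions for the supremum norm; it is [+oo] when [Du] is not a finite
    measure. *)
Definition variation (R : realType) (u : R -> R) : \bar R :=
  ereal_sup [set (distr_deriv u phi)%:E |
    phi in [set phi | test_fun phi /\ forall x, `|phi x| <= 1]].

Definition BV01 (R : realType) : set (R -> R) :=
  [set u | u \in Lfun (@mu01 R) 1%E /\ (variation u < +oo)%E].

Definition Espace (R : realType) (ebar : R) : set (R -> R) :=
  [set u | u \in Lfun (@mu01 R) +oo%E /\
    u = cst 0 %[ae @mu01 R in `]0, ebar[ `|` `]1 - ebar, 1[]].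

Definition Greg (R : realType) (ebar : R) (u : R -> R) : \bar R :=
  if `[< BV01 u /\ Espace ebar u >] then variation u else +oo%E.

(** The pairing is between [eta] in L^1 and [v - u] in L^oo; when
    [Greg ebar u = +oo] the set is empty. *)
Definition subdiffG (R : realType) (ebar : R) (u : R -> R) : set (R -> R) :=
  [set eta | eta \in Lfun (@mu01 R) 1%E /\
    forall v, v \in Lfun (@mu01 R) +oo%E ->
      (Greg ebar u + (\int[@mu01 R]_x (eta x * (v x - u x)))%:E
         <= Greg ebar v)%E].

(** [K] and its pre-adjoint; the representatives vanish outside (0,1), where
    [k (x - t)] could leave the domain [-1,1] of [k]. *)
Definition Kop (R : realType) (k u : R -> R) : R -> R :=
  (fun t => \int[@mu01 R]_x (k (x - t) * u x)) \_ `]0, 1[.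

Definition Kadj (R : realType) (k y : R -> R) : R -> R :=
  (fun t => \int[@mu01 R]_x (k (t - x) * y x)) \_ `]0, 1[.

(** [k] in C^2([-1,1]): twice differentiable inside, all derivatives extending
    continuously to the closed interval. *)
Definition C2_sym (R : realType) (k : R -> R) : Prop :=
  {within `[-1, 1], continuous k} /\
  exists k1 k2 : R -> R,
    [/\ {within `[-1, 1], continuous k1}, {within `[-1, 1], continuous k2},
        forall x : R, -1 < x < 1 -> is_derive x 1 k (k1 x)
      & forall x : R, -1 < x < 1 -> is_derive x 1 k1 (k2 x)].

Definition C1_oo (R : realType) (f : R -> R) : Prop :=
  (forall x : R, 0 < x < 1 -> derivable f x 1) /\
  (forall x : R, 0 < x < 1 -> {for x, continuous (derive1 f)}).

Definition dual_feasible (R : realType) (ebar : R) (k : R -> R) :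
    set (R -> R) :=
  [set p | p \in Lfun (@mu01 R) 2%:E /\ subdiffG ebar (cst 0) (Kadj k p)].

Definition dual_solution (R : realType) (ebar : R) (k y0 : R -> R) :
    set (R -> R) :=
  [set p | dual_feasible ebar k p /\
    forall q, dual_feasible ebar k q -> inner2 y0 q <= inner2 y0 p].

Definition min_norm_dual_solution (R : realType) (ebar : R) (k y0 : R -> R) :
    set (R -> R) :=
  [set p | dual_solution ebar k y0 p /\
    forall q, dual_solution ebar k y0 q -> norm2 p <= norm2 q].

(** [xget] selects a representative of the unique class in the set; [Kadj] takes
    the same values on all representatives. *)
Definition eta_min (R : realType) (ebar : R) (k y0 : R -> R) : R -> R :=
  Kadj k (xget (cst 0) (min_norm_dual_solution ebar k y0)).

Definition reg_dual_objective (R : realType) (lambda : R) (f p : R -> R) : R :=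
  lambda * inner2 f p - lambda ^+ 2 / 2 * norm2 p ^+ 2.

Definition reg_dual_solution (R : realType) (ebar : R) (k : R -> R)
    (lambda : R) (f : R -> R) : set (R -> R) :=
  [set p | dual_feasible ebar k p /\
    forall q, dual_feasible ebar k q ->
      reg_dual_objective lambda f q <= reg_dual_objective lambda f p].

Definition eta_reg (R : realType) (ebar : R) (k : R -> R) (lambda : R)
    (f : R -> R) : R -> R :=
  Kadj k (xget (cst 0) (reg_dual_solution ebar k lambda f)).

(** With data [f = y0 + w]. *)
Definition primal_objective (R : realType) (ebar : R) (k : R -> R) (lambda : R)
    (f u : R -> R) : \bar R :=
  ((1 / 2 * norm2 (Kop k u \- f) ^+ 2)%:E + lambda%:E * Greg ebar u)%E.

Definition primal_solution (R : realType) (ebar : R) (k : R -> R) (lambda : R)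
    (f : R -> R) : set (R -> R) :=
  [set u | u \in Lfun (@mu01 R) +oo%E /\
    forall v, v \in Lfun (@mu01 R) +oo%E ->
      (primal_objective ebar k lambda f u
         <= primal_objective ebar k lambda f v)%E].

Definition noise_set (R : realType) (alpha lambda0 : R) : set (R * (R -> R)) :=
  [set lw | [/\ 0 <= lw.1 <= lambda0, lw.2 \in Lfun (@mu01 R) 2%:E
              & norm2 lw.2 <= alpha * lw.1]].

(** The weak* topology of L^oo, as the dual of L^1: the initial topology of the
    evaluations [u |-> \int eta u] for [eta] in L^1. It is put on all functions
    and does not separate almost everywhere equal ones; the closure below is
    restricted to L^oo. *)
Definition L1_pairing (R : realType) (u : R -> R) :
    {ptws LfunType (@mu01 R) (lexx 1%E) -> R} :=
  fun eta => \int[@mu01 R]_x (eta x * u x).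

Definition weak_star (R : realType) : Type := initial_topology (@L1_pairing R).

HB.instance Definition _ (R : realType) :=
  Topological.copy (weak_star R) (initial_topology (@L1_pairing R)).

Definition extreme_points (R : realType) (A : set (R -> R)) : set (R -> R) :=
  [set u | A u /\
    forall (v1 v2 : R -> R) (t : R), A v1 -> A v2 -> 0 < t < 1 ->
      u = (fun x => t * v1 x + (1 - t) * v2 x) %[ae @mu01 R] ->
      v1 = u %[ae @mu01 R] /\ v2 = u %[ae @mu01 R]].

Definition Gball (R : realType) (ebar : R) : set (R -> R) :=
  [set u | u \in Lfun (@mu01 R) +oo%E /\ (Greg ebar u <= 1)%E].

Definition Bset (R : realType) (ebar : R) : set (R -> R) :=
  [set u | u \in Lfun (@mu01 R) +oo%E /\
    closure (extreme_points (Gball ebar) : set (weak_star R)) u].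

(** [d] is a metric on (the almost everywhere classes of) [Bset ebar]. *)
Definition metric_on_B (R : realType) (ebar : R) (d : (R -> R) -> (R -> R) -> R)
    : Prop :=
  [/\ forall u v, Bset ebar u -> Bset ebar v -> 0 <= d u v,
      forall u v, Bset ebar u -> Bset ebar v ->
        (d u v = 0 <-> u = v %[ae @mu01 R]),
      forall u v, Bset ebar u -> Bset ebar v -> d u v = d v u
    & forall u v z, Bset ebar u -> Bset ebar v -> Bset ebar z ->
        d u z <= d u v + d v z].

Definition metrizes_weak_star (R : realType) (ebar : R)
    (d : (R -> R) -> (R -> R) -> R) : Prop :=
  forall (u_ : nat -> weak_star R) (u : weak_star R),
    (forall m, Bset ebar (u_ m)) -> Bset ebar u ->
    ((fun m => d (u_ m) u) @ \oo --> (0 : R) <-> u_ @ \oo --> u).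

Definition Bball (R : realType) (ebar : R) (d : (R -> R) -> (R -> R) -> R)
    (eps : R) (v : R -> R) : set (R -> R) :=
  [set u | Bset ebar u /\ d u v <= eps].

Definition atom (R : realType) (s a b : R) : R -> R :=
  fun x => 1 / 2 * (s * \1_`[a, b] x).

Definition step_comb (R : realType) (n : nat) (c sigma a b : 'I_n -> R) :
    R -> R :=
  fun x => 1 / 2 * \sum_(i < n) c i * sigma i * \1_`[a i, b i] x.

(* Main.v *)
(* Since [k] is of class C^2, [K_* p] is Lipschitz with a constant proportional to the L^2-norm of [p], and [K_* p]
   is a subgradient of G at 0 exactly when a primitive [H] of it oscillates by at most 2 on [ebar, 1 - ebar].
   Hypotheses 2 and 3 say that [1/2 s (H b - H a)], for [K_* p0], reaches its maximal value 1 only at the given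
   triples, with quadratic decay around them.

   The solution is found as the minimiser of the primal energy over step functions whose parameters lie in a small box
   around [c0, a0, b0]. By Farkas' lemma, minimality of the norm of [p0] provides multipliers; moving the parameters
   along them gives a competitor [u'] with [K u' = y0 - lambda p0 + O(lambda^2)] and an almost vanishing duality gap.
   Comparison with it shows that the residual [p = (f - K u) / lambda] of the minimiser [u] is close to [p0] in L^2.
   So the peaks of [1/2 s (H b - H a)] for [K_* p] are still strict; stationarity in the box puts them at the
   parameters of [u], with height 1, and away from the box compactness keeps the function below 1. Hence [p] is dual
   feasible and [u] and [p] satisfy the extremality relations, which makes them optimal.

   If [v] is another solution then [K v = K u] and [K_* p] is extremal for [v]. For a continuous [g], linear
   independence yields [q] such that [g] and [K_* q] have the same integral over each interval of [u]; then
   [K_* p + t (g - K_* q)] is feasible up to an error [O(t^2)], so [g - K_* q] is orthogonal to [v]. As it is also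
   orthogonal to [u], [g] has the same integral against [u] and [v]. *)
Require Import Defs.
From mathcomp Require Import all_boot all_order all_algebra.
From mathcomp Require Import all_classical all_reals all_analysis.
From mathcomp Require Import measurable_realfun ess_sup_inf ring lra.

Import Order.TTheory GRing.Theory Num.Theory.
Import numFieldNormedType.Exports.

Local Open Scope classical_set_scope.
Local Open Scope ring_scope.

(** * Integrals and square-integrable functions on (0,1) *)

(** Two features of the hypotheses shape the proof. Endpoints may lie on [ebar] or [1 - ebar], where
    they can move only inward and where the certificate need not vanish; so first-order conditions
    are variational inequalities over admissible points, and the multipliers carry sign conditions.
    Intervals may overlap or share endpoints, so the seminorm of a step function is only bounded
    above by the sum of its coefficients; equality is recovered by duality, once a feasible
    certificate has height 1 on every interval.

    Compactness is used in finite dimension only: the candidate minimises over a box of parameters,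
    and its global optimality comes from the certificate that it produces. The comparison with the
    competitor is quantitative: a duality gap of order [lambda^2] becomes, after division by
    [lambda], an error of order [lambda] in the squared distance of the residual to [p0]. The
    constants are fixed in a definite order: the window [dl], then the gap [rho] that depends on it,
    and last [alpha] and [lambda0]. *)

Lemma ae01S {R : realType} (P Q : set R) : (forall x, P x -> Q x) ->
  (\forall x \ae @mu01 R, P x) -> (\forall x \ae @mu01 R, Q x).
Proof.
move=> PQ H; have F : Filter (nbhs (almost_everywhere (@mu01 R))).
  by apply: ae_filter_ringOfSetsType.
exact: filterS H.
Qed.

Lemma ae01S2 {R : realType} (P Q S : set R) :
  (forall x, P x -> Q x -> S x) -> (\forall x \ae @mu01 R, P x) ->
  (\forall x \ae @mu01 R, Q x) -> (\forall x \ae @mu01 R, S x).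
Proof.
move=> PQS HP HQ; have F : Filter (nbhs (almost_everywhere (@mu01 R))).
  by apply: ae_filter_ringOfSetsType.
exact: filterS2 HP HQ.
Qed.

Section integration.
Context {R : realType}.
Local Notation mu := (@mu01 R).
Local Notation intg f := (mu.-integrable setT (EFin \o f)).
Implicit Types f g h p q u v : R -> R.

Lemma intg_measurable f : intg f -> measurable_fun setT f.
Proof. by move=> /measurable_int /measurable_EFinP. Qed.

Lemma intgZ c f : intg f -> intg (fun x => c * f x).
Proof. by move=> fi; have := integrableZl measurableT c fi; apply: eq_integrable. Qed.

Lemma intgD f g : intg f -> intg g -> intg (fun x => f x + g x).
Proof. by move=> fi gi; have := integrableD measurableT fi gi; apply: eq_integrable. Qed.

Lemma intgB f g : intg f -> intg g -> intg (fun x => f x - g x).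
Proof. by move=> fi gi; have := integrableB measurableT fi gi; apply: eq_integrable. Qed.

Lemma intg_le f g : measurable_fun setT f -> (forall x, `|f x| <= g x) ->
  intg g -> intg f.
Proof.
move=> mf fg gi; apply: (@le_integrable _ _ _ mu _ measurableT _ (EFin \o g)) => //.
  exact/measurable_EFinP.
by move=> x _; rewrite /= lee_fin (le_trans (fg x))// ler_norm.
Qed.

Lemma intg_cst c : intg (fun=> c).
Proof.
exact: finite_measure_integrable_cst.
Qed.

Lemma intg_bounded f M : measurable_fun setT f -> (forall x, `|f x| <= M) ->
  intg f.
Proof. by move=> mf fM; apply: (@intg_le f (fun=> M)) => //; exact: intg_cst. Qed.

Lemma intD f g : intg f -> intg g ->
  \int[mu]_x (f x + g x) = \int[mu]_x f x + \int[mu]_x g x.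
Proof. by move=> fi gi; rewrite RintegralD. Qed.

Lemma intB f g : intg f -> intg g ->
  \int[mu]_x (f x - g x) = \int[mu]_x f x - \int[mu]_x g x.
Proof. by move=> fi gi; rewrite RintegralB. Qed.

Lemma intZ c f : intg f -> \int[mu]_x (c * f x) = c * \int[mu]_x f x.
Proof. by move=> fi; rewrite RintegralZl. Qed.

Lemma int0 : \int[mu]_x (0 : R) = 0.
Proof. by rewrite Rintegral_cst// mul0r. Qed.

Lemma mu01_setT : fine (mu setT) = 1.
Proof.
rewrite /mu01 /mrestr/= setTI lebesgue_measure_itv/= lte_fin ltr01.
by rewrite -EFinD/= subr0.
Qed.

Lemma int_le f g : intg f -> intg g -> (forall x, f x <= g x) ->
  \int[mu]_x f x <= \int[mu]_x g x.
Proof. by move=> fi gi fg; apply: le_Rintegral. Qed.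

Lemma int_norm_le f M : measurable_fun setT f -> (forall x, `|f x| <= M) ->
  `|\int[mu]_x f x| <= M.
Proof.
move=> mf fM; have fi := intg_bounded _ _ mf fM.
apply: le_trans (le_normr_Rintegral _ _) _ => //.
rewrite -[leRHS]mulr1 -mu01_setT -Rintegral_cst//.
apply: le_Rintegral => //; last exact: intg_cst.
exact: integrable_norm.
Qed.

Lemma ae_int f g : measurable_fun setT f -> measurable_fun setT g ->
  f = g %[ae mu] -> \int[mu]_x f x = \int[mu]_x g x.
Proof.
move=> mf mg fg; rewrite /Rintegral; congr fine; apply: ae_eq_integral => //.
- exact/measurable_EFinP.
- exact/measurable_EFinP.
- by apply: ae01S fg => x /= + _ => ->.
Qed.

Lemma ae_intg f g : measurable_fun setT g ->
  f = g %[ae mu] -> intg f -> intg g.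
Proof.
move=> mg fg fi; have mf := intg_measurable _ fi.
apply/integrableP; split; first exact/measurable_EFinP.
move/integrableP : fi => [_]; apply: le_lt_trans.
rewrite le_eqVlt; apply/orP; left; apply/eqP; apply: ae_eq_integral => //.
- by apply: measurableT_comp => //; exact/measurable_EFinP.
- by apply: measurableT_comp => //; exact/measurable_EFinP.
- by apply: ae01S fg => x /= + _ => ->.
Qed.

Lemma int_ge0_eq0 f : intg f -> (forall x, 0 <= f x) -> \int[mu]_x f x <= 0 ->
  f = cst 0 %[ae mu].
Proof.
move=> fi f0 If.
have /eqP I0 : \int[mu]_x f x == 0 by rewrite eq_le If Rintegral_ge0.
have I0' : (\int[mu]_x `|(f x)%:E| = 0)%E.
  under eq_integral do rewrite gee0_abs ?lee_fin//.
  have /fineK <- : (\int[mu]_x (f x)%:E)%E \is a fin_num.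
    exact: integrable_fin_num.
  by congr (_%:E).
have H := ae_eq_integral_abs mu measurableT.
have mf : measurable_fun setT (EFin \o f) by exact: measurable_int fi.
have [+ _] := H _ mf; move=> H1.
have {}H1 := H1 I0'.
by apply: ae01S H1 => x /= /(_ I) [].
Qed.

End integration.

Section L2.
Context {R : realType}.
Local Notation mu := (@mu01 R).
Local Notation intg f := (mu.-integrable setT (EFin \o f)).
Local Notation L2 := (Lfun mu 2%:E).
Implicit Types f g h p q u v : R -> R.

Lemma L2P f : f \in L2 <-> measurable_fun setT f /\ intg (fun x => f x ^+ 2).
Proof.
split=> [fL|[mf fi]].
  split; last exact: Lfun2_integrable_sqr.
  by move: fL; rewrite inE => /andP[]; rewrite inE.
rewrite inE; apply/andP; split; rewrite inE//=.
rewrite /finite_norm unlock /Lnorm /=.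
rewrite poweR_lty//; move/integrableP : fi => [_].
apply: le_lt_trans; apply: ge0_le_integral => //.
- apply/measurable_EFinP.
  apply: (@measurableT_comp _ _ _ _ _ _ (fun x : R => x `^ 2)) => //.
  exact: measurableT_comp.
- by apply/measurable_EFinP/measurableT_comp => //; exact: measurable_funX.
- by move=> x _; rewrite /= lee_fin normrX powR_mulrn.
Qed.

Lemma L2_measurable f : f \in L2 -> measurable_fun setT f.
Proof. by move=> /L2P[]. Qed.

Lemma L2_intgM f g : f \in L2 -> g \in L2 -> intg (fun x => f x * g x).
Proof. by move=> fL gL; apply/Lfun1_integrable/Lfun2_mul_Lfun1. Qed.

Lemma L2_intg f : f \in L2 -> intg f.
Proof.
move=> fL; apply/Lfun1_integrable; apply: (@Lfun_subset12 _ _ _ mu) => //.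
exact: fin_num_measure.
Qed.

Lemma L2_bounded f M : measurable_fun setT f -> (forall x, `|f x| <= M) ->
  f \in L2.
Proof.
move=> mf fM; apply/L2P; split => //.
apply: (@intg_bounded _ _ (M ^+ 2)); first exact: measurable_funX.
by move=> x; rewrite normrX lerXn2r// nnegrE// (le_trans _ (fM x)).
Qed.

Lemma L2D f g : f \in L2 -> g \in L2 -> (fun x => f x + g x) \in L2.
Proof.
move=> /L2P[mf fi] /L2P[mg gi]; apply/L2P; split; first exact: measurable_funD.
apply: (@intg_le _ _ (fun x => 2 * (f x ^+ 2) + 2 * (g x ^+ 2))).
- by apply: measurable_funX; exact: measurable_funD.
- move=> x; rewrite ger0_norm ?sqr_ge0//.
  by have := sqr_ge0 (f x - g x); rewrite !expr2; lra.
- by apply: intgD; apply: intgZ.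
Qed.

Lemma L2Z c f : f \in L2 -> (fun x => c * f x) \in L2.
Proof.
move=> /L2P[mf fi]; apply/L2P; split; first exact: measurable_funM.
have := intgZ (c ^+ 2) _ fi.
by apply: eq_integrable => // x _; rewrite /= exprMn.
Qed.

Lemma L2N f : f \in L2 -> (fun x => - f x) \in L2.
Proof.
by move=> /(L2Z (-1)); congr (_ \in L2); apply/funext => x; rewrite mulN1r.
Qed.

Lemma L2B f g : f \in L2 -> g \in L2 -> (fun x => f x - g x) \in L2.
Proof. by move=> fL /L2N; exact: L2D. Qed.

Lemma L20 : (cst 0 : R -> R) \in L2.
Proof. by apply: (@L2_bounded _ 0) => // x; rewrite normr0. Qed.

Lemma L2_sum (I : Type) (r : seq I) (P : pred I) (F : I -> R -> R) :
  (forall i, P i -> F i \in L2) -> (fun x => \sum_(i <- r | P i) F i x) \in L2.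
Proof.
move=> FL; elim: r => [|i r IH].
  by under eq_fun do rewrite big_nil; exact: L20.
under eq_fun do rewrite big_cons.
by case Pi : (P i) => //; apply: L2D => //; exact: FL.
Qed.

Lemma inner2C f g : inner2 f g = inner2 g f.
Proof. by rewrite /inner2; apply: eq_Rintegral => x _; rewrite mulrC. Qed.

Lemma inner2Dl f g h : f \in L2 -> g \in L2 -> h \in L2 ->
  inner2 (fun x => f x + g x) h = inner2 f h + inner2 g h.
Proof.
move=> fL gL hL; rewrite /inner2 -intD; try exact: L2_intgM.
by apply: eq_Rintegral => x _; rewrite mulrDl.
Qed.

Lemma inner2Zl c f h : f \in L2 -> h \in L2 ->
  inner2 (fun x => c * f x) h = c * inner2 f h.
Proof.
move=> fL hL; rewrite /inner2 -intZ; last exact: L2_intgM.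
by apply: eq_Rintegral => x _; rewrite mulrA.
Qed.

Lemma inner2Nl f h : f \in L2 -> h \in L2 ->
  inner2 (fun x => - f x) h = - inner2 f h.
Proof.
move=> fL hL; rewrite -[RHS]mulN1r -inner2Zl//; congr inner2.
by apply/funext => x; rewrite mulN1r.
Qed.

Lemma inner2Bl f g h : f \in L2 -> g \in L2 -> h \in L2 ->
  inner2 (fun x => f x - g x) h = inner2 f h - inner2 g h.
Proof. by move=> fL gL hL; rewrite -inner2Nl// -inner2Dl//; exact: L2N. Qed.

Lemma inner2Dr f g h : f \in L2 -> g \in L2 -> h \in L2 ->
  inner2 h (fun x => f x + g x) = inner2 h f + inner2 h g.
Proof. by move=> fL gL hL; rewrite inner2C inner2Dl// !(inner2C h). Qed.

Lemma inner2Br f g h : f \in L2 -> g \in L2 -> h \in L2 ->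
  inner2 h (fun x => f x - g x) = inner2 h f - inner2 h g.
Proof. by move=> fL gL hL; rewrite inner2C inner2Bl// !(inner2C h). Qed.

Lemma inner2Zr c f h : f \in L2 -> h \in L2 ->
  inner2 h (fun x => c * f x) = c * inner2 h f.
Proof. by move=> fL hL; rewrite inner2C inner2Zl// !(inner2C h). Qed.

Lemma inner20l h : inner2 (fun=> 0) h = 0 :> R.
Proof. by rewrite /inner2; under eq_Rintegral do rewrite mul0r; exact: int0. Qed.

Lemma inner2_suml (I : Type) (r : seq I) (F : I -> R -> R) h :
  (forall i, F i \in L2) -> h \in L2 ->
  inner2 (fun x => \sum_(i <- r) F i x) h = \sum_(i <- r) inner2 (F i) h.
Proof.
move=> FL hL; elim: r => [|i r IH].
  by rewrite big_nil; under eq_fun do rewrite big_nil; exact: inner20l.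
rewrite big_cons -IH -inner2Dl//; last exact: L2_sum.
by congr inner2; apply/funext => x; rewrite big_cons.
Qed.

Lemma inner2_sumr (I : Type) (r : seq I) (F : I -> R -> R) h :
  (forall i, F i \in L2) -> h \in L2 ->
  inner2 h (fun x => \sum_(i <- r) F i x) = \sum_(i <- r) inner2 h (F i).
Proof.
by move=> FL hL; rewrite inner2C inner2_suml//; apply: eq_bigr => i _; exact: inner2C.
Qed.

Lemma inner2_ge0 f : 0 <= inner2 f f.
Proof. by apply: Rintegral_ge0 => x _; rewrite -expr2 sqr_ge0. Qed.

Lemma inner2_eq0 f : f \in L2 -> inner2 f f <= 0 -> f = cst 0 %[ae mu].
Proof.
move=> fL f0; have : (fun x => f x * f x) = cst 0 %[ae mu].
  apply: int_ge0_eq0 => //; first exact: L2_intgM.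
  by move=> x; rewrite -expr2 sqr_ge0.
by apply: ae01S => x /= /(_ I) /eqP; rewrite mulf_eq0 orbb => /eqP.
Qed.

Lemma norm2E f : f \in L2 -> norm2 f = Num.sqrt (inner2 f f).
Proof.
move=> /L2P[mf fi]; rewrite /norm2 unlock /Lnorm /=.
have -> : (\int[mu]_x (`|(f x)%:E| `^ 2) = (inner2 f f)%:E)%E.
  rewrite /inner2 /Rintegral fineK.
    apply: eq_integral => x _; rewrite /= powR_mulrn//.
    by rewrite -normrX ger0_norm ?sqr_ge0// expr2.
  have := integrable_fin_num measurableT fi.
  by congr (_ \is a fin_num); apply: eq_integral => x _; rewrite /= expr2.
by rewrite poweR_EFin/= powR12_sqrt// inner2_ge0.
Qed.

Lemma norm2_sqr f : f \in L2 -> norm2 f ^+ 2 = inner2 f f.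
Proof. by move=> fL; rewrite norm2E// sqr_sqrtr// inner2_ge0. Qed.

Lemma norm2_ge0 f : 0 <= norm2 f.
Proof. by rewrite fine_ge0// Lnorm_ge0. Qed.

Lemma norm20 : norm2 (cst 0 : R -> R) = 0.
Proof. by rewrite norm2E ?L20// inner20l sqrtr0. Qed.

Lemma cauchy_schwarz f g : f \in L2 -> g \in L2 ->
  `|inner2 f g| <= norm2 f * norm2 g.
Proof.
move=> fL gL.
have key t : 0 <= inner2 f f - 2 * t * inner2 f g + t ^+ 2 * inner2 g g.
  have := inner2_ge0 (fun x => f x - t * g x).
  rewrite inner2Bl ?inner2Br ?inner2Zr ?inner2Zl//; try exact: L2Z.
  - by rewrite (inner2C g f) !expr2; lra.
  - by apply: L2B => //; exact: L2Z.
have [g0|g0] := eqVneq (inner2 g g) 0.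
  have fg0 : inner2 f g = 0.
    apply/eqP; apply: contraT => fg.
    (* For [inner2 g g = 0] the quadratic is affine in [t], and this [t] gives it the value -1. *)
    have := key ((inner2 f f + 1) / (2 * inner2 f g)).
    have -> : 2 * ((inner2 f f + 1) / (2 * inner2 f g)) * inner2 f g = inner2 f f + 1.
      by field.
    by rewrite g0 mulr0 addr0; lra.
  by rewrite fg0 normr0 mulr_ge0// norm2_ge0.
have gp : 0 < inner2 g g by rewrite lt_def g0 inner2_ge0.
have sq : inner2 f g ^+ 2 <= inner2 f f * inner2 g g.
  have := key (inner2 f g / inner2 g g).
  have -> : inner2 f f - 2 * (inner2 f g / inner2 g g) * inner2 f g +
      (inner2 f g / inner2 g g) ^+ 2 * inner2 g g =
      (inner2 f f * inner2 g g - inner2 f g ^+ 2) / inner2 g g by field.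
  by rewrite pmulr_lge0 ?invr_gt0// subr_ge0.
rewrite -(ler_pXn2r (_ : 0 < 2)%N) ?nnegrE ?mulr_ge0 ?norm2_ge0//.
by rewrite exprMn !norm2_sqr// -normrX ger0_norm// sqr_ge0.
Qed.

Lemma norm2Z c f : f \in L2 -> norm2 (fun x => c * f x) = `|c| * norm2 f.
Proof.
move=> fL; apply/eqP; rewrite -(@eqrXn2 _ 2)//; rewrite ?mulr_ge0 ?norm2_ge0//.
rewrite exprMn !norm2_sqr//; last exact: L2Z.
rewrite inner2Zl ?inner2Zr//; last exact: L2Z.
by rewrite -normrX ger0_norm ?sqr_ge0// expr2 mulrA.
Qed.

Lemma norm2D f g : f \in L2 -> g \in L2 ->
  norm2 (fun x => f x + g x) <= norm2 f + norm2 g.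
Proof.
move=> fL gL; rewrite -(ler_pXn2r (_ : 0 < 2)%N) ?nnegrE ?addr_ge0 ?norm2_ge0//.
rewrite norm2_sqr ?L2D// inner2Dl ?inner2Dr ?L2D//.
rewrite sqrrD !norm2_sqr// (inner2C g f).
by have := le_trans (ler_norm _) (cauchy_schwarz _ _ fL gL); lra.
Qed.

Lemma norm2B f g : f \in L2 -> g \in L2 ->
  norm2 (fun x => f x - g x) <= norm2 f + norm2 g.
Proof.
move=> fL gL; have := norm2D _ _ fL (L2N _ gL).
suff -> : norm2 (fun x => - g x) = norm2 g by [].
by rewrite -[RHS]mul1r -[1 in RHS]normrN1 -norm2Z//; congr norm2; apply/funext => x; rewrite mulN1r.
Qed.

Lemma norm2_le_sup f M : measurable_fun setT f -> (forall x, `|f x| <= M) ->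
  norm2 f <= M.
Proof.
move=> mf fM; have M0 : 0 <= M by rewrite (le_trans _ (fM 0)).
rewrite -(ler_pXn2r (_ : 0 < 2)%N) ?nnegrE ?norm2_ge0//.
rewrite norm2_sqr; last exact: L2_bounded mf fM.
apply: le_trans (ler_norm _) _; apply: int_norm_le; first exact: measurable_funM.
by move=> x; rewrite normrM expr2 ler_pM.
Qed.

End L2.

(** * Lebesgue measure restricted to (0,1) *)

Section restriction_to_01.
Context {R : realType}.
Local Notation mu := (@mu01 R).
Local Notation leb := (@lebesgue_measure R).
Local Notation intg f := (mu.-integrable setT (EFin \o f)).
Implicit Types f g h p q u v : R -> R.

Lemma ae01_in (P : set R) : (forall x, 0 < x < 1 -> P x) -> \forall x \ae mu, P x.
Proof.
move=> P01; exists (~` `]0, 1[); split; first exact: measurableC.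
  by rewrite /mu01 /mrestr setICl measure0.
by move=> x nP /=; rewrite in_itv/= => x01; apply: nP; exact: P01.
Qed.

(* No measurability is assumed: it applies to [k (x - t) * u x], where [k] is arbitrary outside [-1,1]. *)
Import HBNNSimple.

Lemma nnint01_restrict (f : R -> \bar R) : (forall x, 0 <= f x)%E ->
  (\int[mu]_x f x = \int[mu]_x (f \_ `]0%R, 1%R[) x)%E.
Proof.
move=> f0; have f0' x : (0 <= (f \_ `]0%R, 1%R[) x)%E by apply: erestrict_ge0 => t _.
rewrite !ge0_integralTE//; apply/eqP; rewrite eq_le; apply/andP; split.
  apply: ge_ereal_sup => _ [h hf <-].
  have mD : measurable (`]0%R, 1%R[ : set (measurableTypeR R)) by [].
  (* Cutting the simple function off outside (0,1) keeps its integral, because [mu01] does not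
     charge the complement. *)
  apply: ereal_sup_ubound; exists (proj_nnsfun h mD) => /=.
    move=> x; rewrite /proj_nnsfun/= patchE mindicE; case: ifPn => xD.
      by rewrite mulr1.
    by rewrite mulr0.
  rewrite -!integralT_nnsfun; apply: ae_eq_integral => //.
  - apply/measurable_EFinP; apply: (@measurable_funM _ _ _ _ h (mindic R mD)).
      exact: (@measurable_funPT _ _ _ _ h).
    by first [exact: measurable_indic|exact: (@measurable_funPT _ _ _ _ (mindic R mD))].
  - by apply/measurable_EFinP.
  - apply: ae01_in => x x01 _ /=; rewrite /proj_nnsfun/= mindicE mem_set ?mulr1//.
apply: ge_ereal_sup => _ [h hf <-]; apply: ereal_sup_ubound; exists h => //= x.
by apply: le_trans (hf x) _; rewrite patchE; case: ifPn.
Qed.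

Lemma int01_restrict f : \int[mu]_x f x = \int[mu]_(x in `]0, 1[) f x.
Proof.
rewrite /Rintegral; congr fine.
rewrite integralE nnint01_restrict// (nnint01_restrict (fun x => _^\- x)%E)//.
rewrite [RHS]integralE; congr (_ - _)%E; rewrite [RHS]integral_mkcond;
  by apply: eq_integral => x _; rewrite !patchE.
Qed.

Lemma int01_lebesgue f : \int[mu]_x f x = \int[leb]_(x in `]0, 1[) f x.
Proof.
rewrite int01_restrict /Rintegral; congr fine; apply: eq_measure_integral => A mA A01.
have E := congr1 (fun X : set (measurableTypeR R) => leb X) (setIidl A01).
by first [exact: E|exact: (esym E)].
Qed.

Lemma int01_eq f g : (forall x, 0 < x < 1 -> f x = g x) ->
  \int[mu]_x f x = \int[mu]_x g x.
Proof.
move=> fg; rewrite !int01_restrict; apply: eq_Rintegral => x.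
by rewrite inE/= in_itv/=; exact: fg.
Qed.

Lemma mu01_ltb a b (f : R -> R) : 0 < a -> b < 1 ->
  \int[leb]_(x in `[a, b]) f x = \int[mu]_x (f x * \1_`[a, b] x).
Proof.
move=> a0 b1; rewrite int01_lebesgue.
have sub : `[a, b] `<=` (`]0, 1[ : set R).
  by move=> x /=; rewrite !in_itv/= => /andP[ax xb]; rewrite (lt_le_trans a0)//= (le_lt_trans xb).
rewrite -(setIidr sub) Rintegral_mkcondr; apply: eq_Rintegral => x _.
rewrite patchE indicE setIidr//; case: ifPn => _; first by rewrite mulr1.
by rewrite mulr0.
Qed.

Lemma intg_lebesgue f : leb.-integrable `]0, 1[ (EFin \o f) ->
  measurable_fun setT f -> intg f.
Proof.
move=> /integrableP[_ fi] mf; apply/integrableP; split.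
  exact/measurable_EFinP.
apply: le_lt_trans fi; rewrite nnint01_restrict//.
rewrite -integral_mkcond.
rewrite (@eq_measure_integral _ _ _ _ leb)// => A mA A01.
have E := congr1 (fun X : set (measurableTypeR R) => leb X) (setIidl A01).
by first [exact: E|exact: (esym E)].
Qed.

Lemma lebesgue_intg f : intg f -> leb.-integrable `]0, 1[ (EFin \o f).
Proof.
move=> fi; have /integrableP[mf fi'] : mu.-integrable `]0%R, 1%R[ (EFin \o f).
  by apply: integrableS fi.
apply/integrableP; split; first by [].
apply: le_lt_trans fi'.
rewrite (@eq_measure_integral _ _ _ _ mu)// => A mA A01.
have E := congr1 (fun X : set (measurableTypeR R) => leb X) (setIidl A01).
by first [exact: E|exact: (esym E)].
Qed.

End restriction_to_01.

(** * Essentially bounded functions *)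

Section Linfty.
Context {R : realType}.
Local Notation mu := (@mu01 R).
Local Notation intg f := (mu.-integrable setT (EFin \o f)).
Local Notation Loo := (Lfun mu +oo%E).
Implicit Types f g h p q u v : R -> R.

Lemma mu01_gt0 : (0 < mu setT)%E.
Proof.
by rewrite /mu01 /mrestr/= setTI lebesgue_measure_itv/= lte_fin ltr01 -EFinD lte_fin subr0.
Qed.

Lemma LooP f : f \in Loo <->
  measurable_fun setT f /\ exists M, \forall x \ae mu, `|f x| <= M.
Proof.
split=> [|[mf [M fM]]].
  rewrite inE => /andP[]; rewrite !inE/= => mf; rewrite /finite_norm unlock /Lnorm mu01_gt0.
  by move=> H; split => //; have [M HM] := @ess_supr_bounded _ _ _ mu (fun x => `|f x|) H; exists M.
rewrite inE; apply/andP; split; rewrite inE//=.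
rewrite /finite_norm unlock /Lnorm mu01_gt0.
apply: (@le_lt_trans _ _ M%:E); last exact: ltry.
by apply/ess_supP; apply: ae01S fM => x /=; rewrite lee_fin.
Qed.

Lemma Loo_measurable f : f \in Loo -> measurable_fun setT f.
Proof. by move=> /LooP[]. Qed.

Lemma Loo_bounded f M : measurable_fun setT f -> (forall x, `|f x| <= M) -> f \in Loo.
Proof.
by move=> mf fM; apply/LooP; split => //; exists M; apply: ae01_in => x _.
Qed.

(** The bound in L^oo holds almost everywhere only; setting the function to 0 where it fails gives a
    representative to which pointwise estimates apply. *)
Lemma Loo_repr f : f \in Loo -> exists g M,
  [/\ measurable_fun setT g, forall x, `|g x| <= M & f = g %[ae mu]].
Proof.
move=> /LooP[mf [M fM]]; exists (fun x => if `|f x| <= M then f x else 0), `|M|; split.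
- apply: measurable_fun_if => //.
  + apply: measurable_fun_ler => //; apply: measurableT_comp => //.
  + exact: measurable_funS mf.
- by move=> x; case: ifPn => [fx|_]; [rewrite (le_trans fx)// ler_norm|rewrite normr0].
- by apply: ae01S fM => x /= ->.
Qed.

Lemma Loo_L2 f : f \in Loo -> f \in Lfun mu 2%:E.
Proof.
move=> fL; have [g [M [mg gM fg]]] := Loo_repr _ fL.
have /L2P[_ gi] := L2_bounded _ _ mg gM.
apply/L2P; split; first exact: Loo_measurable.
apply: ae_intg gi; first by apply: measurable_funX; exact: Loo_measurable.
by apply: ae01S fg => x /= /(_ I) ->.
Qed.

Lemma Loo_intgM f u : intg f -> u \in Loo -> intg (fun x => f x * u x).
Proof.
move=> fi uL; have mf := intg_measurable _ fi; have mu_ := Loo_measurable _ uL.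
have [g [M [mg gM ug]]] := Loo_repr _ uL.
apply: (@ae_intg _ (fun x => f x * g x)); first exact: measurable_funM.
  by apply: ae01S ug => x /= + _ => ->.
apply: (@intg_le _ _ (fun x => M * `|f x|)); first exact: measurable_funM.
  by move=> x; rewrite normrM mulrC ler_wpM2r.
by apply: intgZ; exact: integrable_norm.
Qed.

Lemma LooD u v : u \in Loo -> v \in Loo -> (fun x => u x + v x) \in Loo.
Proof.
move=> /LooP[mu_ [M uM]] /LooP[mv [N vN]]; apply/LooP; split; first exact: measurable_funD.
by exists (M + N); apply: ae01S2 uM vN => x ux vx; rewrite (le_trans (ler_normD _ _))// lerD.
Qed.

Lemma LooZ c u : u \in Loo -> (fun x => c * u x) \in Loo.
Proof.
move=> /LooP[mu_ [M uM]]; apply/LooP; split; first exact: measurable_funM.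
by exists (`|c| * M); apply: ae01S uM => x ux; rewrite normrM ler_wpM2l.
Qed.

Lemma LooB u v : u \in Loo -> v \in Loo -> (fun x => u x - v x) \in Loo.
Proof.
move=> uL /(LooZ (-1)) vL; have := LooD _ _ uL vL.
by under eq_fun do rewrite mulN1r.
Qed.

Lemma indic_le1 (A : set R) (x : R) : `|\1_A x : R| <= 1.
Proof. by rewrite indicE; case: (_ \in _); rewrite ?normr1 ?normr0. Qed.

Lemma indic_L2 (a b : R) : (\1_`[a, b] : R -> R) \in Lfun mu 2%:E.
Proof. by apply: (@L2_bounded _ _ 1) => // x; exact: indic_le1. Qed.

Lemma indic_Loo (a b : R) : (\1_`[a, b] : R -> R) \in Loo.
Proof. by apply: (@Loo_bounded _ 1) => // x; exact: indic_le1. Qed.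

(* Continuous functions are dense in L^1, so a bounded function orthogonal to all of them is orthogonal to itself. *)
Lemma ae0_of_continuous_orthogonal z : z \in Loo ->
  (forall g, continuous g -> \int[mu]_x (g x * z x) = 0) -> z = cst 0 %[ae mu].
Proof.
move=> zL Hz; have [y [M [my yM zy]]] := Loo_repr _ zL.
have yi := intg_bounded _ _ my yM; have mz := Loo_measurable _ zL.
have M0 : 0 <= M by rewrite (le_trans _ (yM 0)).
have fin01 : (@lebesgue_measure R `]0%R, 1%R[ < +oo)%E.
  by rewrite lebesgue_measure_itv/= lte_fin ltr01 oppr0 adde0 ltry.
have [g [cg gi gcvg]] :=
  approximation_continuous_integrable (measurable_itv _) fin01 (lebesgue_intg _ yi).
have Lyy : y \in Loo by exact: Loo_bounded yM.
(* As [g n] is orthogonal to [z], hence to [y], subtracting it from one factor of [y * y] leaves the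
   integral unchanged; the other factor is at most [M]. *)
have key n : (\int[mu]_x (y x * y x) <= M * \int[mu]_x `|y x - g n x|).
  have gin : intg (g n).
    by apply: intg_lebesgue => //; exact: continuous_measurable_fun.
  have <- : \int[mu]_x ((y x - g n x) * y x) = \int[mu]_x (y x * y x).
    rewrite (_ : (fun x => _) = (fun x => y x * y x - g n x * y x)); last first.
      by apply/funext => x; rewrite mulrBl.
    rewrite intB; try exact: Loo_intgM.
    have <- : \int[mu]_x (g n x * z x) = \int[mu]_x (g n x * y x).
      apply: ae_int.
      - by apply: measurable_funM => //; exact: continuous_measurable_fun.
      - by apply: measurable_funM => //; exact: continuous_measurable_fun.
      - by apply: ae01S zy => x /= + _ => ->.
    by rewrite Hz// subr0.
  have dgi : intg (fun x => y x - g n x) by exact: intgB.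
  rewrite -intZ; last exact: integrable_norm.
  apply: int_le; first exact: Loo_intgM.
    by apply: intgZ; exact: integrable_norm.
  by move=> x; rewrite (le_trans (ler_norm _))// normrM mulrC ler_wpM2r.
have cvg0 : M * \int[mu]_x `|y x - g n x| @[n --> \oo] --> M * 0.
  apply: cvgMr.
  have -> : (fun n => \int[mu]_x `|y x - g n x|) = fine \o (fun n => \int[@lebesgue_measure R]_(z0 in `]0%R, 1%R[) `|(y z0 - g n z0)%:E|)%E.
    apply/funext => n /=.
    by rewrite int01_lebesgue.
  exact: fine_cvg gcvg.
have : y = cst 0 %[ae mu].
  apply: inner2_eq0; first exact: L2_bounded yM.
  rewrite mulr0 in cvg0; apply: (ler_cvg_to (cvg_cst _) cvg0).
  by near=> n; exact: key.
by apply: ae01S2 zy => x /= H1 H2 _; rewrite H1// H2.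
Unshelve. all: by end_near. Qed.

End Linfty.

Set Implicit Arguments.
Unset Strict Implicit.

(** * The kernel and its operators *)

Section antiderivative.
Context {R : realType}.
Local Notation leb := (@lebesgue_measure R).
Implicit Types (h f F H : R -> R).

Lemma deriv_add f h (x a b : R) : is_derive x 1 f a -> is_derive x 1 h b ->
  is_derive x 1 (fun y => f y + h y) (a + b).
Proof. exact: is_deriveD. Qed.

Lemma deriv_sub f h (x a b : R) : is_derive x 1 f a -> is_derive x 1 h b ->
  is_derive x 1 (fun y => f y - h y) (a - b).
Proof. exact: is_deriveB. Qed.

Lemma deriv_mul f h (x a b : R) : is_derive x 1 f a -> is_derive x 1 h b ->
  is_derive x 1 (fun y => f y * h y) (a * h x + f x * b).
Proof.
move=> df dh; have := is_deriveM df dh.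
by rewrite addrC (mulrC a).
Qed.

Lemma deriv_cst (c x : R) : is_derive x 1 (fun=> c) 0.
Proof. exact: is_derive_cst. Qed.

Lemma deriv_id (x : R) : is_derive x 1 (fun y => y) 1.
Proof. exact: is_derive_id. Qed.

Lemma deriv_scale c f (x a : R) : is_derive x 1 f a ->
  is_derive x 1 (fun y => c * f y) (c * a).
Proof. by move=> df; have := deriv_mul (deriv_cst c x) df; rewrite mul0r add0r. Qed.

Lemma deriv_comp f h (x a b : R) : is_derive (h x) 1 f a -> is_derive x 1 h b ->
  is_derive x 1 (fun y => f (h y)) (a * b).
Proof. exact: is_derive1_comp. Qed.

Lemma continuous_maxr f h : continuous f -> continuous h ->
  continuous (fun x : R => Num.max (f x) (h x)).
Proof.
move=> cf ch x; under eq_fun => y do rewrite maxr_absE.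
apply: cvgM; last exact: cvg_cst.
apply: cvgD; first by apply: cvgD; [exact: cf|exact: ch].
by apply: cvg_norm; apply: cvgB; [exact: cf|exact: ch].
Qed.

Lemma continuous_minr f h : continuous f -> continuous h ->
  continuous (fun x : R => Num.min (f x) (h x)).
Proof.
move=> cf ch x; under eq_fun => y do rewrite minr_absE.
apply: cvgM; last exact: cvg_cst.
apply: cvgD; first by apply: cvgD; [exact: cf|exact: ch].
by apply: cvgN; apply: cvg_norm; apply: cvgB; [exact: cf|exact: ch].
Qed.

(** The primitive is the integral over the half-line to the left of [x], which converges because [h]
    vanishes there beyond -1. *)
Lemma antiderivative_right h : continuous h -> (forall x, x <= - 1 -> h x = 0) ->
  exists H, forall x : R, is_derive x 1 H (h x).
Proof.
move=> ch h0; exists (fun x => \int[leb]_(t in `]-oo, x]) h t) => x.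
have hi u : leb.-integrable `]-oo, u] (EFin \o h).
  have mh : measurable_fun setT h by exact: continuous_measurable_fun.
  have I1 : leb.-integrable `[(-1), Num.max u 0] (EFin \o h).
    apply: continuous_compact_integrable; first exact: segment_compact.
    exact: continuous_subspaceT.
  have I2 : leb.-integrable `]-oo, u] ((EFin \o h) \_ `[(-1), Num.max u 0]).
    apply/integrable_restrict => //.
    by apply: integrableS I1 => //; exact: measurableI.
  apply: eq_integrable I2 => // y; rewrite inE/= in_itv/= => yu.
  rewrite patchE; case: ifPn => // /negP; rewrite inE/= in_itv/= le_max yu andbT.
  by move=> /negP; rewrite -ltNge => /ltW /h0 ->.
have [] := @continuous_FTC1 _ h -oo%O x (x + 1) _ (hi _) _ (ch x).
- by rewrite ltrDl.
- by first [exact: isT|exact: ltNyr|exact: (erefl true)|rewrite lt_def].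
by rewrite derive1E => D1 D2; exact: (DeriveDef D1 D2).
Qed.

(** The ramp [r] splits [h] into a part that vanishes far to the left and a part that vanishes far
    to the right; reflection brings the second one back to the first case. *)
Lemma antiderivative h : continuous h -> exists H, forall x : R, is_derive x 1 H (h x).
Proof.
move=> ch; pose r (x : R) := Num.min 1 (Num.max 0 (x + 1)).
have cr : continuous r.
  apply: continuous_minr; first by move=> x; exact: cvg_cst.
  apply: continuous_maxr; first by move=> x; exact: cvg_cst.
  by move=> x; apply: cvgD; [exact: cvg_id|exact: cvg_cst].
have r0 x : x <= -1 -> r x = 0.
  move=> x1; rewrite /r; have -> : Num.max 0 (x + 1) = 0 by apply/max_idPl; lra.
  by apply/min_idPr; lra.
have r1 x : 0 <= x -> r x = 1.
  by move=> x1; rewrite /r; apply/min_idPl; rewrite le_max; apply/orP; right; lra.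
have [||H1 dH1] := @antiderivative_right (fun x => h x * r x).
- by move=> x; apply: cvgM; [exact: ch|exact: cr].
- by move=> x x1; rewrite r0 ?mulr0.
have con f : continuous f -> continuous (fun x => f (- x)).
  move=> cf x; apply: (@continuous_comp _ _ _ (fun x : R => - x) f); last exact: cf.
  exact: opp_continuous.
have [||H2 dH2] := @antiderivative_right (fun x => h (- x) * (1 - r (- x))).
- move=> x; apply: cvgM; first exact: con.
  by apply: cvgB; [exact: cvg_cst|exact: con].
- by move=> x x1; rewrite r1 ?subrr ?mulr0//; lra.
exists (fun x => H1 x - H2 (- x)) => x.
have -> : h x = h x * r x - (-1 * (h (- - x) * (1 - r (- - x)))) by rewrite opprK; ring.
have D2 := @deriv_comp H2 (fun y => - y) x _ _ (dH2 (- x)) (is_deriveNid _ _).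
have := deriv_sub (dH1 x) D2; by rewrite [X in _ - X]mulrC.
Qed.

Lemma FTC2 h H a b : (forall x : R, is_derive x 1 H (h x)) -> continuous h -> a <= b ->
  \int[leb]_(x in `[a, b]) h x = H b - H a.
Proof.
move=> dH ch; rewrite le_eqVlt => /predU1P[<-|ab].
  by rewrite subrr set_itv1 Rintegral_set1.
rewrite /Rintegral (@continuous_FTC2 _ h H)//.
- exact: continuous_subspaceT.
- have cH x : {for x, continuous H}.
    by apply: differentiable_continuous; apply/derivable1_diffP; case: (dH x).
  split.
  + by move=> x _; case: (dH x).
  + by apply: cvg_at_right_filter; exact: cH.
  + by apply: cvg_at_left_filter; exact: cH.
- by move=> x _; rewrite derive1E; case: (dH x).
Qed.

Lemma is_derive_continuous H h : (forall x : R, is_derive x 1 H (h x)) -> continuous H.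
Proof.
move=> dH x; apply: differentiable_continuous; apply/derivable1_diffP.
by case: (dH x).
Qed.

Lemma mean_value H h a b : (forall x : R, is_derive x 1 H (h x)) -> a <= b ->
  exists2 c, a <= c <= b & H b - H a = h c * (b - a).
Proof.
move=> dH ab; have [|c] := @MVT_segment _ H h a b ab (fun x _ => dH x).
  apply: continuous_subspaceT; exact: is_derive_continuous dH.
by rewrite in_itv/=; exists c.
Qed.

End antiderivative.

Section kernel.
Context {R : realType}.
Local Notation mu := (@mu01 R).
Local Notation leb := (@lebesgue_measure R).
Local Notation intg f := (mu.-integrable setT (EFin \o f)).
Local Notation L2 := (Lfun mu 2%:E).
Local Notation Loo := (Lfun mu +oo%E).
Implicit Types f g h p q u v k : R -> R.

(** Composition with this 1-Lipschitz retraction onto [-1,1] extends the kernel to the whole line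
    without enlarging its bounds. *)
Definition clamp (x : R) : R := Num.max (-1) (Num.min 1 x).

Lemma clamp_itv x : -1 <= clamp x <= 1.
Proof.
by rewrite /clamp le_max lexx/= ge_max; apply/andP; split; [lra|rewrite ge_min lexx].
Qed.

Lemma clamp_id x : -1 <= x <= 1 -> clamp x = x.
Proof.
by move=> /andP[x1 x2]; rewrite /clamp; have -> : Num.min 1 x = x; [exact/min_idPr|exact/max_idPr].
Qed.

Lemma clamp_lip x y : `|clamp x - clamp y| <= `|x - y|.
Proof.
wlog xy : x y / x <= y.
  by move=> H; have [/H//|/ltW/H] := leP x y; rewrite distrC [leRHS]distrC.
rewrite [`|x - y|]distrC [leLHS]distrC (ger0_norm (_ : 0 <= y - x)) ?subr_ge0//.
rewrite /clamp.
have E : Num.max (-1) 1 = 1 :> R by apply/max_idPr; lra.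
case: (leP 1 y) => y1; case: (leP 1 x) => x1; rewrite ?E.
- by rewrite subrr normr0 subr_ge0.
- by case: (leP (-1) x) => x2; rewrite ger0_norm; lra.
- by exfalso; lra.
- by case: (leP (-1) x) => x2; case: (leP (-1) y) => y2; rewrite ger0_norm; lra.
Qed.

(** [L] and [B] are the maxima over [-1,1] of the moduli of the derivative and of the kernel; the
    later estimates depend on the kernel through these two numbers. *)
Lemma C2_sym_kernel k : C2_sym k -> exists kt L B,
  [/\ forall x : R, -1 <= x <= 1 -> kt x = k x, 0 <= L, 0 <= B,
      forall x y, `|kt x - kt y| <= L * `|x - y| & forall x, `|kt x| <= B].
Proof.
move=> [ck [k1 [k2 [ck1 _ dk _]]]].
have bnd f : {within `[-1, 1], continuous f} ->
    exists2 M, 0 <= M & forall x : R, -1 <= x <= 1 -> `|f x| <= M.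
  move=> cf.
  have cnf : {within `[-1, 1], continuous (fun x : R => `|f x|)}.
    by move=> x; apply: cvg_norm; exact: cf.
  have [|c _ Hc] := @EVT_max _ _ (-1) 1 _ cnf; first lra.
  by exists `|f c| => // x x1; apply: Hc; rewrite in_itv.
have [L L0 HL] := bnd _ ck1; have [B B0 HB] := bnd _ ck.
exists (k \o clamp), L, B; split => //.
- by move=> x x1; rewrite /= clamp_id.
- move=> x y; apply: (@le_trans _ _ (L * `|clamp x - clamp y|)); last first.
    by rewrite ler_wpM2l// clamp_lip.
  rewrite /=; move: (clamp x) (clamp y) (clamp_itv x) (clamp_itv y) => {}x {}y.
  wlog xy : x y / x <= y.
    move=> H hx hy; have [xy|/ltW xy] := leP x y; first exact: H.
    by rewrite distrC [X in _ <= _ * X]distrC; exact: H.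
  move=> /andP[x1 x2] /andP[y1 y2].
  have [||c] := @MVT_segment _ k k1 x y xy.
  + move=> z; rewrite in_itv/= => /andP[xz zy].
    by apply: dk; rewrite (le_lt_trans x1 xz)/= (lt_le_trans zy).
  + apply: continuous_subspaceW ck => z /=; rewrite !in_itv/= => /andP[xz zy].
    by rewrite (le_trans x1)//= (le_trans zy).
  rewrite in_itv/= => /andP[xc cy] E.
  rewrite distrC E normrM (distrC x y) ler_wpM2r// HL//.
  by rewrite (le_trans x1)//= (le_trans cy).
- by move=> x; apply: HB; exact: clamp_itv.
Qed.

End kernel.

Section kernel_operators.
Context {R : realType} (kt : R -> R) (L B : R).
Context (L0 : 0 <= L) (B0 : 0 <= B)
  (ktL : forall x y, `|kt x - kt y| <= L * `|x - y|) (ktB : forall x, `|kt x| <= B).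
Local Notation mu := (@mu01 R).
Local Notation leb := (@lebesgue_measure R).
Local Notation intg f := (mu.-integrable setT (EFin \o f)).
Local Notation L2 := (Lfun mu 2%:E).
Local Notation Loo := (Lfun mu +oo%E).
Implicit Types f g h p q u v k : R -> R.

(** The pre-adjoint for the extended kernel, without cut-off to (0,1): it is Lipschitz on the whole
    line, so it has a primitive there. *)
Definition eta_of p (x : R) := \int[mu]_t (kt (x - t) * p t).

Lemma lipschitz_cont f (C : R) : 0 <= C -> (forall x y, `|f x - f y| <= C * `|x - y|) ->
  continuous f.
Proof.
move=> C0 fC x; apply/cvgrPdist_le => e e0.
have C1 : 0 < C + 1 by lra.
near=> y; apply: (le_trans (fC _ _)).
have xy : `|x - y| <= e / (C + 1) by near: y; apply: cvgr_dist_le => //; exact: divr_gt0.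
have : `|x - y| * (C + 1) <= e by rewrite -ler_pdivlMr.
by have := normr_ge0 (x - y); lra.
Unshelve. all: by end_near. Qed.

Lemma EFin_int f : intg f -> (\int[mu]_x (f x)%:E = (\int[mu]_x f x)%:E)%E.
Proof. by move=> fi; rewrite /Rintegral fineK//; exact: integrable_fin_num. Qed.

Lemma kt_cont : continuous kt.
Proof. exact: lipschitz_cont ktL. Qed.

Lemma kt_measurable (x : R) : measurable_fun setT (fun t : R => kt (x - t)).
Proof.
apply: continuous_measurable_fun => t; apply: continuous_comp; last exact: kt_cont.
by apply: cvgB; [exact: cvg_cst|exact: cvg_id].
Qed.

Lemma kt_measurable' (t : R) : measurable_fun setT (fun x : R => kt (x - t)).
Proof.
apply: continuous_measurable_fun => x; apply: continuous_comp; last exact: kt_cont.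
by apply: cvgB; [exact: cvg_id|exact: cvg_cst].
Qed.

Lemma kt_L2 x : (fun t => kt (x - t)) \in L2.
Proof. exact: L2_bounded (kt_measurable x) (fun t => ktB _). Qed.

Lemma kt_L2' t : (fun x => kt (x - t)) \in L2.
Proof. exact: L2_bounded (kt_measurable' t) (fun x => ktB _). Qed.

Lemma eta_ofE p x : eta_of p x = inner2 (fun t => kt (x - t)) p.
Proof. by []. Qed.

Lemma eta_of_bound p x : p \in L2 -> `|eta_of p x| <= B * norm2 p.
Proof.
move=> pL; apply: (le_trans (cauchy_schwarz _ _ (kt_L2 x) pL)).
by apply: ler_wpM2r; [exact: norm2_ge0|exact: norm2_le_sup (kt_measurable x) _].
Qed.

Lemma eta_of_lip p x y : p \in L2 -> `|eta_of p x - eta_of p y| <= L * norm2 p * `|x - y|.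
Proof.
move=> pL; rewrite !eta_ofE -inner2Bl//; try exact: kt_L2.
apply: (le_trans (cauchy_schwarz _ _ _ pL)); first by apply: L2B; exact: kt_L2.
rewrite mulrAC ler_wpM2r ?norm2_ge0//; apply: norm2_le_sup.
  by apply: measurable_funB; exact: kt_measurable.
by move=> t; apply: (le_trans (ktL _ _)); rewrite opprB addrA subrK.
Qed.

Lemma eta_of_cont p : p \in L2 -> continuous (eta_of p).
Proof.
move=> pL; apply: (@lipschitz_cont _ (L * norm2 p)); first by rewrite mulr_ge0 ?norm2_ge0.
by move=> x y; exact: eta_of_lip.
Qed.

Lemma eta_ofD p q x : p \in L2 -> q \in L2 ->
  eta_of (fun t => p t + q t) x = eta_of p x + eta_of q x.
Proof. by move=> pL qL; rewrite !eta_ofE inner2Dr//; exact: kt_L2. Qed.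

Lemma eta_ofB p q x : p \in L2 -> q \in L2 ->
  eta_of (fun t => p t - q t) x = eta_of p x - eta_of q x.
Proof. by move=> pL qL; rewrite !eta_ofE inner2Br//; exact: kt_L2. Qed.

Lemma eta_ofZ c p x : p \in L2 -> eta_of (fun t => c * p t) x = c * eta_of p x.
Proof. by move=> pL; rewrite !eta_ofE inner2Zr//; exact: kt_L2. Qed.

Definition Ku u (t : R) := \int[mu]_x (kt (x - t) * u x).

Lemma KuE u t : Ku u t = inner2 (fun x => kt (x - t)) u.
Proof. by []. Qed.

Lemma Ku_bound u t : u \in L2 -> `|Ku u t| <= B * norm2 u.
Proof.
move=> pL; apply: (le_trans (cauchy_schwarz _ _ (kt_L2' t) pL)).
by apply: ler_wpM2r; [exact: norm2_ge0|exact: norm2_le_sup (kt_measurable' t) _].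
Qed.

Lemma Ku_measurable u : u \in L2 -> measurable_fun setT (Ku u).
Proof.
move=> uL; apply: continuous_measurable_fun.
apply: (@lipschitz_cont _ (L * norm2 u)); first by rewrite mulr_ge0 ?norm2_ge0.
move=> x y; rewrite !KuE -inner2Bl//; try exact: kt_L2'.
apply: (le_trans (cauchy_schwarz _ _ _ uL)); first by apply: L2B; exact: kt_L2'.
rewrite mulrAC ler_wpM2r ?norm2_ge0//; apply: norm2_le_sup.
  by apply: measurable_funB; exact: kt_measurable'.
move=> t; apply: (le_trans (ktL _ _)).
by rewrite (_ : t - x - (t - y) = - (x - y)) ?normrN//; ring.
Qed.

(** Fubini: the kernel is bounded by [B], and [p] and [u] are integrable because the measure is
    finite, so the triple product is integrable on the square. *)
Lemma inner2_Ku p u : p \in L2 -> u \in L2 ->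
  inner2 p (Ku u) = \int[mu]_x (eta_of p x * u x).
Proof.
move=> pL uL.
have mp := L2_measurable _ pL; have mu_ := L2_measurable _ uL.
pose f (z : R * R) : R := kt (z.2 - z.1) * p z.1 * u z.2.
have mf : measurable_fun setT f.
  apply: measurable_funM; last by apply: measurableT_comp => //; exact: measurable_snd.
  apply: measurable_funM; last by apply: measurableT_comp => //; exact: measurable_fst.
  apply: (@measurableT_comp _ _ _ _ _ _ kt).
    by apply: continuous_measurable_fun; exact: kt_cont.
  by apply: measurable_funB; [exact: measurable_snd|exact: measurable_fst].
have mF : measurable_fun setT (fubini_F mu (fun z : R * R => `|(f z)%:E|%E)).
  apply: measurable_fun_fubini_tonelli_F => //.
  by apply: measurableT_comp => //; exact/measurable_EFinP.
have fint : (mu \x mu)%E.-integrable setT (EFin \o f).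
  apply/integrable12ltyP; first exact/measurable_EFinP.
  have pi := L2_intg _ pL; have ui := L2_intg _ uL.
  apply: (@le_lt_trans _ _ (\int[mu]_x ((B * \int[mu]_y `|u y|) * `|p x|)%:E)%E).
    apply: ge0_le_integral => //.
    - by move=> x _; apply: integral_ge0.
    - by apply/measurable_EFinP; apply: measurable_funM => //; exact: measurableT_comp.
    - move=> x _.
      have gi : intg (fun y => B * `|p x| * `|u y|) by apply: intgZ; exact: integrable_norm.
      rewrite mulrAC -intZ; last exact: integrable_norm.
      rewrite -EFin_int//; apply: ge0_le_integral => //.
      + apply: measurableT_comp => //; apply/measurable_EFinP.
        rewrite /f /=; apply: measurable_funM => //.
        by apply: measurable_funM; [exact: kt_measurable'|exact: measurable_cst].
      + by apply/measurable_EFinP; apply: measurable_funM => //; exact: measurableT_comp.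
      + by move=> y _; rewrite lee_fin /f /= !normrM !ler_wpM2r.
  rewrite EFin_int ?ltry//; apply: intgZ; exact: integrable_norm.
have := Fubini fint.
have E1 : (fun x => \int[mu]_y (EFin \o f) (x, y))%E = (fun x => (p x * Ku u x)%:E).
  apply/funext => x; rewrite -intZ; last exact: L2_intgM (kt_L2' _) uL.
  rewrite -EFin_int; last by apply: intgZ; exact: L2_intgM (kt_L2' _) uL.
  by apply: eq_integral => y _ /=; rewrite /f/= mulrA (mulrC (p x)).
have E2 : (fun y => \int[mu]_x (EFin \o f) (x, y))%E = (fun y => (u y * eta_of p y)%:E).
  apply/funext => y; rewrite -intZ; last exact: L2_intgM (kt_L2 _) pL.
  rewrite -EFin_int; last by apply: intgZ; exact: L2_intgM (kt_L2 _) pL.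
  by apply: eq_integral => x _ /=; rewrite /f/= mulrC.
rewrite E1 E2 => /(congr1 fine) => H; rewrite /inner2 [LHS]H.
by apply: eq_Rintegral => y _; rewrite mulrC.
Qed.

End kernel_operators.

Section Kop_Kadj.
Context {R : realType} (k kt : R -> R)
  (ktk : forall x : R, -1 <= x <= 1 -> kt x = k x).
Local Notation mu := (@mu01 R).
Implicit Types f g h p q u v : R -> R.

Lemma KopE u t : 0 < t < 1 -> Kop k u t = Ku kt u t.
Proof.
move=> t01; rewrite /Kop patchE mem_set; last by rewrite /= in_itv.
by apply: int01_eq => x x01; rewrite ktk//; lra.
Qed.

Lemma KadjE p t : 0 < t < 1 -> Kadj k p t = eta_of kt p t.
Proof.
move=> t01; rewrite /Kadj patchE mem_set; last by rewrite /= in_itv.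
by apply: int01_eq => x x01; rewrite ktk//; lra.
Qed.

Lemma Kop_Ku u : Kop k u = Ku kt u \_ `]0, 1[.
Proof.
apply/funext => t; rewrite patchE; case: ifPn => [|/negbTE tn].
  by rewrite inE/= in_itv/= => /KopE.
by rewrite /Kop patchE tn.
Qed.

End Kop_Kadj.

(** * Farkas' lemma, and the total variation against bounded oscillation *)

Section farkas.
Context {R : realFieldType} {W : lmodType R}.

(* Bartl's algebraic induction; it needs neither a topology nor finite dimension. *)
Lemma farkas (m : nat) (al : 'I_m -> W -> R) (ga : W -> R) :
  (forall i c x y, al i (c *: x + y) = c * al i x + al i y) ->
  (forall c x y, ga (c *: x + y) = c * ga x + ga y) ->
  (forall x, (forall i, al i x <= 0) -> ga x <= 0) ->
  exists2 u : 'I_m -> R, (forall i, 0 <= u i) &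
    forall x, ga x = \sum_(i < m) u i * al i x.
Proof.
elim: m al ga => [|m IH] al ga lal lga H.
  have g0 : ga 0 = 0 by have := lga 1 0 0; rewrite scaler0 addr0; lra.
  have H' x : ga x <= 0 by apply: H => -[].
  exists (fun=> 0) => // x; rewrite big_ord0.
  have := lga (-1) x 0; rewrite g0 !addr0 => E.
  by have := H' (-1 *: x); have := H' x; rewrite E; lra.
have g0 : ga 0 = 0 by have := lga 1 0 0; rewrite scaler0 addr0; lra.
have a0 i : al i 0 = 0 by have := lal i 1 0 0; rewrite scaler0 addr0; lra.
have gZ c x : ga (c *: x) = c * ga x by rewrite -[in LHS](addr0 (_ *: _)) lga g0 addr0.
have aZ i c x : al i (c *: x) = c * al i x by rewrite -[in LHS](addr0 (_ *: _)) lal a0 addr0.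
pose ext (u : 'I_m -> R) (c : R) (i : 'I_m.+1) := if unlift ord0 i is Some j then u j else c.
have ext_sum u c x : \sum_(i < m.+1) ext u c i * al i x =
    c * al ord0 x + \sum_(i < m) u i * al (lift ord0 i) x.
  rewrite big_ord_recl /ext unlift_none; congr (_ + _).
  by apply: eq_bigr => i _; rewrite liftK.
(* If constraint 0 is redundant it gets the multiplier 0; otherwise some [x] satisfies all the
   others with [ga x > 0], which forces [al ord0 x > 0]. *)
have [Hm|] := pselect (forall x, (forall i : 'I_m, al (lift ord0 i) x <= 0) -> ga x <= 0).
  have [|u u0 Eu] := IH (fun i => al (lift ord0 i)) ga _ lga Hm.
    by move=> i c x y; rewrite lal.
  exists (ext u 0) => [i|x]; first by rewrite /ext; case: unlift.
  by rewrite ext_sum mul0r add0r Eu.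
move=> /existsNP[x /not_implyP[ax /negP]]; rewrite -ltNge => gx.
have a0x : 0 < al ord0 x.
  rewrite ltNge; apply/negP => a0x; have : ga x <= 0; last by rewrite leNgt gx.
  by apply: H => i; case: (unliftP ord0 i) => [j ->|->].
pose z := (al ord0 x)^-1 *: x.
have az : al ord0 z = 1 by rewrite aZ mulVf ?gt_eqF.
have gz : 0 < ga z by rewrite gZ mulr_gt0 ?invr_gt0.
have alz i : al (lift ord0 i) z <= 0 by rewrite aZ pmulr_rle0 ?invr_gt0.
(* These are the forms composed with the projection [y - al ord0 y *: z] onto the kernel of
   constraint 0. *)
have [|||u u0 Eu] := IH (fun i y => al (lift ord0 i) y - al (lift ord0 i) z * al ord0 y)
    (fun y => ga y - ga z * al ord0 y).
- by move=> i c y y'; rewrite !lal; ring.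
- by move=> c y y'; rewrite lga lal; ring.
- move=> y Hy.
  have := H ((- al ord0 y) *: z + y); rewrite lga => H'.
  have {H'} : - al ord0 y * ga z + ga y <= 0.
    apply: H' => i; rewrite lal; case: (unliftP ord0 i) => [j ->|->].
      by have := Hy j; lra.
    by rewrite az; lra.
  lra.
(* The multiplier of constraint 0 makes the identity exact at [z]; it is nonnegative because
   [ga z > 0] while the other forms are nonpositive at [z]. *)
exists (ext u (ga z - \sum_(i < m) u i * al (lift ord0 i) z)) => [i|y].
  rewrite /ext; case: unlift => [j|]; first exact: u0.
  rewrite subr_ge0 (le_trans _ (ltW gz))// sumr_le0// => j _.
  by rewrite mulr_ge0_le0.
rewrite ext_sum; have E := Eu y.
have -> : ga y = ga z * al ord0 y + (ga y - ga z * al ord0 y) by ring.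
rewrite E mulrBl -addrA; congr (_ + _).
rewrite mulr_suml -sumrN -big_split/=; apply: eq_bigr => i _; ring.
Qed.

End farkas.

(** * Cut-off functions of class C^1 *)

Section cutoff.
Context {R : realType}.
Implicit Types (x y : R).

(** Squaring makes the positive part continuously differentiable, as test functions must be. *)
Definition sqpos x : R := Num.max 0 x ^+ 2.

Definition dsqpos x : R := 2 * Num.max 0 x.

Lemma sqpos_deriv x : is_derive x 1 sqpos (dsqpos x).
Proof.
rewrite /dsqpos.
have : [\/ x < 0, 0 < x | x = 0].
  by case: (ltgtP x 0) => H; [constructor 1|constructor 2|constructor 3].
case=> x0.
- have -> : 2 * Num.max 0 x = 0 by rewrite (max_idPl (ltW x0)) mulr0.
  apply: near_eq_is_derive (deriv_cst 0 x).
  near=> y; rewrite /sqpos; have -> : Num.max 0 y = 0; last by rewrite expr0n.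
  by apply/max_idPl/ltW; near: y; exact: lt_nbhsl.
- have -> : 2 * Num.max 0 x = 1 * x + x * 1 by rewrite (max_idPr (ltW x0)); ring.
  apply: near_eq_is_derive (deriv_mul (deriv_id x) (deriv_id x)).
  near=> y; rewrite /sqpos -expr2; congr (_ ^+ 2).
  by apply/esym/max_idPr/ltW; near: y; exact: lt_nbhsr.
- have C : (fun h : R => h^-1 *: (sqpos (h *: (1 : R) + x) - sqpos x)) @ 0^' --> (0 : R).
    apply/cvgrPdist_le => e e0; near=> h.
    rewrite sub0r normrN x0 addr0 /sqpos maxxx expr0n subr0 [h *: 1]mulr1.
    rewrite [_ *: _]/(_ * _) normrM normfV.
    have hn : 0 < `|h| by rewrite normr_gt0; near: h; exact: nbhs_dnbhs_neq.
    rewrite ler_pdivrMl// normrX expr2.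
    have he : `|h| <= e by near: h; exact: dnbhs0_le.
    have mh : `|Num.max 0 h| <= `|h| by have [h0|h0] := leP 0 h; rewrite ?normr0.
    by apply: ler_pM => //; apply: le_trans he.
  have -> : 2 * Num.max 0 x = 0 by rewrite x0 maxxx mulr0.
  apply: DeriveDef; first by apply/cvg_ex; exists 0.
  exact: cvg_lim C.
Unshelve. all: by end_near. Qed.

Lemma sqpos_ge0 x : 0 <= sqpos x. Proof. exact: sqr_ge0. Qed.

Lemma sqpos0 x : x <= 0 -> sqpos x = 0.
Proof. by move=> x0; rewrite /sqpos (max_idPl x0) expr0n. Qed.

Lemma sqpos_gt0 x : 0 <= x -> sqpos x = x ^+ 2.
Proof. by move=> x0; rewrite /sqpos max_r. Qed.

Lemma sqpos_le1 x : x <= 1 -> sqpos x <= 1.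
Proof.
move=> x1; have [x0|x0] := leP x 0; first by rewrite sqpos0.
by rewrite (sqpos_gt0 (ltW x0)) expr2; nra.
Qed.

Lemma dsqpos_cont : continuous dsqpos.
Proof.
move=> x; apply: cvgM; first exact: cvg_cst.
by apply: continuous_maxr => y; [exact: cvg_cst|exact: cvg_id].
Qed.

Lemma continuousM (f g : R -> R) : continuous f -> continuous g -> continuous (fun x => f x * g x).
Proof. by move=> cf cg x; apply: cvgM; [exact: cf|exact: cg]. Qed.

Lemma continuousD (f g : R -> R) : continuous f -> continuous g -> continuous (fun x => f x + g x).
Proof. by move=> cf cg x; apply: cvgD; [exact: cf|exact: cg]. Qed.

Lemma continuousB (f g : R -> R) : continuous f -> continuous g -> continuous (fun x => f x - g x).
Proof. by move=> cf cg x; apply: cvgB; [exact: cf|exact: cg]. Qed.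

Lemma continuous_cst (c : R) : continuous (fun _ : R => c).
Proof. by move=> x; exact: cvg_cst. Qed.

Lemma continuous_id : continuous (fun x : R => x).
Proof. by move=> x; exact: cvg_id. Qed.

Lemma continuous_cmp (f g : R -> R) : continuous f -> continuous g -> continuous (fun x => f (g x)).
Proof. by move=> cf cg x; apply: (@continuous_comp _ _ _ g f); [exact: cg|exact: cf]. Qed.

Lemma continuous_bounded01 (h : R -> R) : continuous h ->
  exists2 K, 0 < K & forall x, 0 <= x <= 1 -> `|h x| <= K.
Proof.
move=> ch; have [|c _ Hc] := @EVT_max _ (fun x => `|h x|) 0 1 ler01.
  by apply: continuous_subspaceT => x; apply: cvg_norm; exact: ch.
exists (`|h c| + 1); first by have := normr_ge0 (h c); lra.
by move=> x x01; rewrite (le_trans (Hc x _)) ?in_itv//; lra.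
Qed.

(** The inner function is 1 minus the squared distance to the plateau, scaled to fall to 0 at
    distance [s]; the outer [sqpos] then cuts it off smoothly. The derivative vanishes also at the
    ends of the plateau, because [dsqpos] is 0 at 0. *)
Lemma cutoff_exists (e s : R) : 0 < s -> exists chi dchi : R -> R,
  [/\ forall x, is_derive x 1 chi (dchi x), continuous dchi,
      forall x, 0 <= chi x <= 1,
      forall x, e <= x <= 1 - e -> chi x = 1 /\ dchi x = 0 &
      forall x, chi x != 0 -> e - s <= x <= 1 - e + s].
Proof.
move=> s0; pose g (x : R) : R := 1 - (s ^+ 2)^-1 * (sqpos (x - (1 - e)) + sqpos (e - x)).
pose dg (x : R) : R := 0 - (s ^+ 2)^-1 * (dsqpos (x - (1 - e)) * (1 - 0) + dsqpos (e - x) * (0 - 1)).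
exists (fun x => sqpos (g x)), (fun x => dsqpos (g x) * dg x).
have s2 : 0 < (s ^+ 2)^-1 by rewrite invr_gt0 exprn_gt0.
have D (x : R) : is_derive x 1 g (dg x).
  have D1 := deriv_comp (f := sqpos) (h := fun y => y - (1 - e)) (sqpos_deriv (x - (1 - e)))
    (deriv_sub (deriv_id x) (deriv_cst (1 - e) x)).
  have D2 := deriv_comp (f := sqpos) (h := fun y => e - y) (sqpos_deriv (e - x))
    (deriv_sub (deriv_cst e x) (deriv_id x)).
  exact: (deriv_sub (deriv_cst 1 x) (deriv_scale (s ^+ 2)^-1 (deriv_add D1 D2))).
have cg : continuous g := is_derive_continuous D.
split.
- by move=> x; exact: (deriv_comp (f := sqpos) (h := g) (sqpos_deriv (g x)) (D x)).
- apply: continuousM; first exact: (continuous_cmp dsqpos_cont cg).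
  apply: continuousB; first exact: continuous_cst.
  apply: continuousM; first exact: continuous_cst.
  apply: continuousD; apply: continuousM; try exact: continuous_cst.
  + apply: (continuous_cmp dsqpos_cont); apply: continuousB; first exact: continuous_id.
    exact: continuous_cst.
  + apply: (continuous_cmp dsqpos_cont); apply: continuousB; last exact: continuous_id.
    exact: continuous_cst.
- move=> x; rewrite sqpos_ge0 sqpos_le1// /g lerBlDr lerDl.
  by rewrite mulr_ge0 ?addr_ge0 ?sqpos_ge0 ?ltW.
- move=> x /andP[x1 x2]; rewrite /g /dg /dsqpos.
  rewrite !(sqpos0 (x := x - _)) ?(sqpos0 (x := e - _)); try lra.
  have -> : Num.max 0 (x - (1 - e)) = 0 by apply/max_idPl; lra.
  have -> : Num.max 0 (e - x) = 0 by apply/max_idPl; lra.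
  rewrite !(addr0, mulr0, mul0r, subr0); split; last by [].
  by rewrite sqpos_gt0// expr1n.
- move=> x; apply: contraR => xn; apply/eqP/sqpos0; rewrite /g subr_le0.
  have sq y : s <= y -> s ^+ 2 <= sqpos y.
    by move=> sy; rewrite sqpos_gt0 ?lerXn2r ?nnegrE; lra.
  rewrite mulrC ler_pdivlMr ?exprn_gt0// mul1r.
  move: xn; rewrite negb_and -!ltNge => /orP[xn|xn].
    by rewrite (le_trans (sq (e - x) _)) ?lerDr ?sqpos_ge0//; lra.
  by rewrite (le_trans (sq (x - (1 - e)) _)) ?lerDl ?sqpos_ge0//; lra.
Qed.

End cutoff.

(** * The total variation as a dual norm *)

Section total_variation.
Context {R : realType}.
Local Notation mu := (@mu01 R).
Local Notation intg f := (mu.-integrable setT (EFin \o f)).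
Local Notation Loo := (Lfun mu +oo%E).
Implicit Types (u v h H f g : R -> R) (e : R).

Lemma continuous_intg h : continuous h -> intg h.
Proof.
move=> ch; apply: intg_lebesgue; last exact: continuous_measurable_fun.
have hi : (@lebesgue_measure R).-integrable `[0, 1] (EFin \o h).
  apply: continuous_compact_integrable; first exact: segment_compact.
  exact: continuous_subspaceT.
by apply: integrableS hi => // x /=; rewrite !in_itv/= => /andP[/ltW-> /ltW->].
Qed.

Lemma test_fun0 : test_fun (cst 0 : R -> R).
Proof.
have E : [set x : R | (cst 0 x : R) != 0] = set0.
  by apply/seteqP; split => // x /=; rewrite eqxx.
split.
- by move=> x; exact: derivable_cst.
- have -> : derive1 (cst 0 : R -> R) = cst 0.
    by apply/funext => x; rewrite derive1_cst.
  exact: continuous_cst.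
- by rewrite E closure0; exact: compact0.
- by rewrite E closure0.
Qed.

Lemma variation_ge0 u : (0 <= Defs.variation u)%E.
Proof.
apply: ereal_sup_ubound; exists (cst 0); first by split; [exact: test_fun0|move=> x; rewrite normr0].
rewrite /distr_deriv.
have -> : derive1 (cst 0 : R -> R) = cst 0 by apply/funext => x; rewrite derive1_cst.
by under eq_Rintegral do rewrite mulr0; rewrite int0 oppr0.
Qed.

Lemma Greg_fin e u V : Greg e u = V%:E ->
  [/\ u \in Loo, u = cst 0 %[ae mu in `]0, e[ `|` `]1 - e, 1[] & Defs.variation u = V%:E].
Proof. by rewrite /Greg; case: asboolP => // -[_ [? ?]] ?. Qed.

Lemma Greg_ge0 e u : (0 <= Greg e u)%E.
Proof. by rewrite /Greg; case: asboolP => // _; exact: variation_ge0. Qed.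

(** Testing against all C^1 functions bounded by 1, without condition on the support, can only
    enlarge the supremum; bounded variation then follows from finiteness of the bound. *)
Lemma Greg_le e u V : u \in Loo -> u = cst 0 %[ae mu in `]0, e[ `|` `]1 - e, 1[] ->
  (forall phi dphi, (forall x : R, is_derive x 1 phi (dphi x)) -> continuous dphi ->
    (forall x, `|phi x| <= 1) -> - (\int[mu]_x (u x * dphi x)) <= V) ->
  (Greg e u <= V%:E)%E.
Proof.
move=> uL u0 H.
have vV : (Defs.variation u <= V%:E)%E.
  apply: ge_ereal_sup => _ [phi [[dphi cphi _ _] phi1] <-]; rewrite lee_fin.
  apply: H cphi phi1 => x; apply: DeriveDef; first exact: dphi.
  by rewrite derive1E.
rewrite /Greg; case: asboolP => // -[]; split.
  split; first exact/Lfun1_integrable/L2_intg/Loo_L2.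
  by apply: le_lt_trans vV _; exact: ltry.
by split.
Qed.

(** The test function is a centred primitive times a cut-off. Its derivative is a multiple of [h] on
    [[e, 1 - e]], and [v] vanishes elsewhere, so the derivative of the cut-off is never seen. The
    collar of width [s] costs [K * s], which disappears as [s] tends to 0. *)
Lemma int_le_Greg e v V h H M : 0 < e < 1 -> 0 <= M -> Greg e v = V%:E ->
  (forall x : R, is_derive x 1 H (h x)) -> continuous h ->
  (forall x y, e <= x <= 1 - e -> e <= y <= 1 - e -> H x - H y <= 2 * M) ->
  \int[mu]_x (h x * v x) <= M * V.
Proof.
move=> e01 M0 /Greg_fin[vL v0 vV] dH ch osc.
have V0 : 0 <= V by rewrite -lee_fin -vV variation_ge0.
have mv := Loo_measurable _ vL; have mh := continuous_measurable_fun ch.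
have H01 := @ae01_in R (fun x => 0 < x < 1) (fun x x01 => x01).
(* For [e > 1/2] the two zero zones cover (0,1). *)
have [e12|e12] := ltP (1 - e) e.
  have -> : \int[mu]_x (h x * v x) = \int[mu]_x (0 : R).
    apply: ae_int => //; first exact: measurable_funM.
    apply: ae01S2 H01 v0 => x x01 /= vx _; rewrite vx ?mulr0//.
    by have [xe|xe] := ltP x e; [left|right]; rewrite /= in_itv/=; lra.
  by rewrite int0 mulr_ge0.
have cH := is_derive_continuous dH.
(* Centring [H] at its maximum minus [M] turns the oscillation bound [2 * M] into the sup bound
   [M]. *)
have [c Hc] : exists c, forall x, e <= x <= 1 - e -> `|H x - c| <= M.
  have [|m] := @EVT_max _ H e (1 - e) e12; first exact: continuous_subspaceT.
  rewrite in_itv/= => me Hm; exists (H m - M) => x xe.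
  have := Hm x; rewrite in_itv/= xe => /(_ isT) H1; have := osc _ _ me xe => H2.
  by rewrite ler_norml; lra.
have [K K0 hK] := continuous_bounded01 ch.
suff key s : 0 < s -> s <= e / 2 -> \int[mu]_x (h x * v x) <= (M + K * s) * V.
  apply/ler_addgt0Pr => r r0.
  pose s := Num.min (e / 2) (r / (K * (V + 1))).
  have KV : 0 < K * (V + 1) by rewrite mulr_gt0//; lra.
  have s0 : 0 < s by rewrite lt_min divr_gt0 ?divr_gt0//; lra.
  have s1 : s <= e / 2 by rewrite ge_min lexx.
  apply: (le_trans (key s s0 s1)); rewrite mulrDl lerD2l.
  have s2 : s * (K * (V + 1)) <= r by rewrite -ler_pdivlMr// ge_min lexx orbT.
  apply: le_trans s2; have := mulr_ge0 (ltW s0) (ltW K0); lra.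
move=> s0 s1; have [chi [dchi [dX cX X01 XI Xs]]] := cutoff_exists e s0.
(* On the collars the distance of [H] to [c] exceeds [M] by at most [K * s]; dividing by [N] keeps
   the test function bounded by 1. *)
pose N := M + K * s; have N0 : 0 < N by rewrite ltr_wpDl// mulr_gt0.
pose phi (x : R) : R := - N^-1 * (chi x * (H x - c)).
pose dphi (x : R) : R := - N^-1 * (dchi x * (H x - c) + chi x * (h x - 0)).
have dphiE (x : R) : is_derive x 1 phi (dphi x).
  exact: (deriv_scale (- N^-1) (deriv_mul (dX x) (deriv_sub (dH x) (deriv_cst c x)))).
have cdphi : continuous dphi.
  apply: continuousM; first exact: continuous_cst.
  apply: continuousD; apply: continuousM => //; try exact: is_derive_continuous dX.
    by apply: continuousB => //; exact: continuous_cst.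
  by apply: continuousB => //; exact: continuous_cst.
have dphiE' : derive1 phi = dphi by apply/funext => x; rewrite derive1E; case: (dphiE x).
have sub : closure [set x | phi x != 0] `<=` `[e - s, 1 - e + s].
  rewrite (closure_id (`[e - s, 1 - e + s] : set R)).1; last exact: itv_closed.
  apply: closure_subset => x /= px; rewrite in_itv/=; apply: Xs.
  by move: px; apply: contra => /eqP X0; rewrite /phi X0 mul0r mulr0.
have tphi : test_fun phi.
  split.
  - by move=> x; case: (dphiE x).
  - by rewrite dphiE'.
  - by apply: subclosed_compact sub; [exact: closed_closure|exact: segment_compact].
  - by move=> x /sub /=; rewrite !in_itv/=; lra.
have phi1 x : `|phi x| <= 1.
  have [X0|/Xs xs] := eqVneq (chi x) 0; first by rewrite /phi X0 mul0r mulr0 normr0.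
  have HN : `|H x - c| <= N.
    (* The projection of [x] onto the plateau. *)
    pose x0 := Num.max e (Num.min (1 - e) x).
    have x0e : e <= x0 <= 1 - e.
      by rewrite /x0 le_max lexx/= ge_max e12 ge_min lexx.
    have xx0 : `|x - x0| <= s.
      rewrite /x0; have [xe|xe] := leP (1 - e) x.
        by rewrite (max_idPr e12) ger0_norm; move: xe xs; clear; lra.
      by have [xe'|xe'] := leP e x; [rewrite subrr normr0|rewrite ler0_norm; move: xe' xs; clear]; lra.
    have HK : `|H x - H x0| <= K * s.
      have mv_le a b : 0 <= a -> a <= b -> b <= 1 -> `|H b - H a| <= K * (b - a).
        move=> a0 ab b1; have [m /andP[m1 m2] ->] := mean_value dH ab.
        rewrite normrM (@ger0_norm _ (b - a)) ?subr_ge0// ler_wpM2r ?subr_ge0// hK//.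
        by rewrite (le_trans a0)//= (le_trans m2).
      apply: (@le_trans _ _ (K * `|x - x0|)); last by rewrite ler_wpM2l// ltW.
      have [xx|xx] := leP x0 x.
        rewrite (@ger0_norm _ (x - x0)) ?subr_ge0//; apply: mv_le => //; lra.
      rewrite distrC (distrC x) (@ger0_norm _ (x0 - x)); last by rewrite subr_ge0 ltW.
      by apply: mv_le; lra.
    have -> : H x - c = (H x - H x0) + (H x0 - c) by ring.
    by rewrite (le_trans (ler_normD _ _))// /N addrC lerD// Hc.
  rewrite /phi !normrM normrN (@gtr0_norm _ N^-1) ?invr_gt0//.
  rewrite ler_pdivrMl// mulr1; have /andP[X0 X1] := X01 x.
  by rewrite (ger0_norm X0) (le_trans _ HN)// ler_piMl.
have : ((distr_deriv v phi)%:E <= V%:E)%E by rewrite -vV; apply: ereal_sup_ubound; exists phi.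
rewrite lee_fin /distr_deriv dphiE' => HV.
have hvi : intg (fun x => h x * v x) by apply: Loo_intgM => //; exact: continuous_intg.
have E : \int[mu]_x (v x * dphi x) = \int[mu]_x (- N^-1 * (h x * v x)).
  apply: ae_int; [by apply: measurable_funM => //; exact: continuous_measurable_fun
    |by apply: measurable_funM => //; exact: measurable_funM|].
  apply: ae01S2 H01 v0 => x x01 /= vx _.
  have [/XI[X1 X2]|xn] := boolP (e <= x <= 1 - e).
    by rewrite /dphi X1 X2; ring.
  rewrite vx ?mul0r ?mulr0//.
  move: xn; rewrite negb_and -!ltNge => /orP[xn|xn]; [left|right]; rewrite /= in_itv/=; lra.
move: HV; rewrite E intZ// mulNr opprK ler_pdivrMl//.
Qed.

End total_variation.

(** * Step functions, and rigidity of extremal functions *)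

Section step_functions.
Context {R : realType}.
Local Notation mu := (@mu01 R).
Local Notation leb := (@lebesgue_measure R).
Local Notation intg f := (mu.-integrable setT (EFin \o f)).
Local Notation Loo := (Lfun mu +oo%E).
Implicit Types (u v h H f g : R -> R) (e : R).

Lemma int_indic_deriv e H h (a b : R) : 0 < e < 1 -> e <= a <= 1 - e -> e <= b <= 1 - e -> a <= b ->
  (forall x : R, is_derive x 1 H (h x)) -> continuous h ->
  \int[mu]_x (h x * \1_`[a, b] x) = H b - H a.
Proof.
move=> e01 ae be ab dH ch; rewrite -(FTC2 dH ch ab) mu01_ltb//; lra.
Qed.

Lemma int_step (n : nat) (c s a b : 'I_n -> R) h : continuous h ->
  \int[mu]_x (h x * step_comb c s a b x) =
  \sum_(i < n) c i * (1 / 2 * s i * \int[mu]_x (h x * \1_`[a i, b i] x)).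
Proof.
move=> ch; have hi := continuous_intg ch.
have I1 i : intg (fun x => h x * \1_`[a i, b i] x) by apply: Loo_intgM => //; exact: indic_Loo.
have -> : (fun x => h x * step_comb c s a b x) =
    (fun x => \sum_(i < n) (c i * (1 / 2 * s i)) * (h x * \1_`[a i, b i] x)).
  apply/funext => x; rewrite /step_comb mulr_sumr mulr_sumr; apply: eq_bigr => i _; ring.
have key (r : seq 'I_n) : intg (fun x => \sum_(i <- r) (c i * (1 / 2 * s i)) * (h x * \1_`[a i, b i] x)) /\
    \int[mu]_x (\sum_(i <- r) (c i * (1 / 2 * s i)) * (h x * \1_`[a i, b i] x)) =
    \sum_(i <- r) (c i * (1 / 2 * s i)) * \int[mu]_x (h x * \1_`[a i, b i] x).
  elim: r => [|i r [IH1 IH2]].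
    rewrite big_nil; under eq_fun do rewrite big_nil.
    by split; [exact: intg_cst|rewrite int0].
  under eq_fun do rewrite big_cons; rewrite big_cons; split.
    by apply: intgD => //; exact: intgZ.
  by rewrite intD//; [rewrite IH2 intZ|exact: intgZ].
by rewrite (key _).2; apply: eq_bigr => i _; rewrite -!mulrA.
Qed.

Lemma step_Loo (n : nat) (c s a b : 'I_n -> R) : step_comb c s a b \in Loo.
Proof.
apply: LooZ; elim: (index_enum _) => [|i r IH].
  by under eq_fun do rewrite big_nil; apply: (@Loo_bounded _ _ 0) => // x; rewrite normr0.
under eq_fun do rewrite big_cons.
apply: LooD => //; apply: LooZ; exact: indic_Loo.
Qed.

Lemma step_outside (n : nat) (c s a b : 'I_n -> R) e :
  (forall i, e <= a i) -> (forall i, b i <= 1 - e) ->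
  step_comb c s a b = cst 0 %[ae mu in `]0, e[ `|` `]1 - e, 1[].
Proof.
move=> ea be; apply: ae01_in => x x01 /= xe; rewrite /step_comb big1 ?mulr0// => i _.
rewrite indicE memNset ?mulr0//= in_itv/= => /andP[ax xb].
move: xe (ea i) (be i); rewrite !in_itv/=; lra.
Qed.

(** Each interval contributes at most [c i], as two values of a test function differ by at most 2.
    Equality can fail, since jumps at a common endpoint may cancel. *)
Lemma Greg_step (n : nat) (c s a b : 'I_n -> R) e : 0 < e < 1 ->
  (forall i, 0 <= c i) -> (forall i, s i = 1 \/ s i = -1) ->
  (forall i, e <= a i <= 1 - e) -> (forall i, e <= b i <= 1 - e) -> (forall i, a i <= b i) ->
  (Greg e (step_comb c s a b) <= (\sum_i c i)%:E)%E.
Proof.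
move=> e01 c0 s1 ae be ab; apply: Greg_le.
- exact: step_Loo.
- by apply: step_outside => i; have := ae i; have := be i; lra.
move=> phi dphi dP cP P1.
have -> : \int[mu]_x (step_comb c s a b x * dphi x) = \int[mu]_x (dphi x * step_comb c s a b x).
  by apply: eq_Rintegral => x _; rewrite mulrC.
rewrite int_step// -sumrN; apply: ler_sum => i _.
rewrite (int_indic_deriv e01 (ae i) (be i) (ab i) dP cP).
have := P1 (a i); have := P1 (b i); rewrite !ler_norml => /andP[h1 h2] /andP[h3 h4].
have := c0 i; case: (s1 i) => -> ci; nra.
Qed.

(** The pairing of [v] with [h + t * th] is at most [1 + C t^2] times [V], while that with [h] is
    already [V]. So [t] times the pairing with [th] is of order [t^2], and both signs of [t] are
    allowed. *)
Lemma rigidity e v V H h T th (C t0 : R) : 0 < e < 1 -> Greg e v = V%:E -> 0 <= C -> 0 < t0 ->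
  (forall x : R, is_derive x 1 H (h x)) -> continuous h ->
  (forall x : R, is_derive x 1 T (th x)) -> continuous th ->
  \int[mu]_x (h x * v x) = V ->
  (forall t x y, `|t| <= t0 -> e <= x <= 1 - e -> e <= y <= 1 - e ->
     (H x - H y) + t * (T x - T y) <= 2 * (1 + C * t ^+ 2)) ->
  \int[mu]_x (th x * v x) = 0.
Proof.
move=> e01 GV C0 t00 dH ch dT ct hV osc.
have [vL v0 vV] := Greg_fin GV.
have V0 : 0 <= V by rewrite -lee_fin -vV variation_ge0.
have hi : intg (fun x => h x * v x) by apply: Loo_intgM => //; exact: continuous_intg.
have ti : intg (fun x => th x * v x) by apply: Loo_intgM => //; exact: continuous_intg.
set I := \int[mu]_x (th x * v x).
have key t : `|t| <= t0 -> t * I <= C * t ^+ 2 * V.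
  move=> tt; have := @int_le_Greg _ e v V (fun x => h x + t * th x) (fun x => H x + t * T x)
    (1 + C * t ^+ 2) e01 _ GV _ _ _.
  have -> : \int[mu]_x ((h x + t * th x) * v x) = V + t * I.
    rewrite -hV /I -intZ// -intD//; last exact: intgZ.
    by apply: eq_Rintegral => x _; ring.
  have -> : (1 + C * t ^+ 2) * V = V + C * t ^+ 2 * V by ring.
  rewrite lerD2l; apply.
  - by rewrite addr_ge0// mulr_ge0// sqr_ge0.
  - by apply: continuousD => //; apply: continuousM => //; exact: continuous_cst.
  - move=> x y xe ye; have -> : H x + t * T x - (H y + t * T y) = (H x - H y) + t * (T x - T y) by ring.
    exact: osc.
have D0 : 0 < C * V + 1 by rewrite ltr_wpDl// mulr_ge0.
have half r : `|r| = 1 -> r * I <= 0.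
  move=> r1; rewrite leNgt; apply/negP => rI.
  pose t := Num.min t0 (r * I / (2 * (C * V + 1))).
  have tp : 0 < t by rewrite lt_min t00 divr_gt0// mulr_gt0.
  have tI : t * (2 * (C * V + 1)) <= r * I by rewrite -ler_pdivlMr ?mulr_gt0// ge_min lexx orbT.
  have := key (r * t); rewrite normrM r1 mul1r gtr0_norm// ge_min lexx => /(_ isT).
  rewrite exprMn -(real_normK (num_real r)) r1 expr1n mul1r => H1.
  have H2 : t * (t * (2 * (C * V + 1))) <= t * (r * I) by rewrite ler_wpM2l// ltW.
  have H3 : 0 < t * (t * (C * V + 1)) by rewrite !mulr_gt0.
  have H4 : 0 < t * t by rewrite mulr_gt0.
  move: H1 H2 H3 H4; rewrite expr2; lra.
have H1 := half 1 (normr1 _); have H2 := half (-1) (normrN1 _).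
by apply/eqP; rewrite eq_le; apply/andP; split; lra.
Qed.

End step_functions.

(** * Convex duality *)

Section primitive.
Context {R : realType}.
Implicit Types (h : R -> R).

(** Fixed only up to a constant, so it is used through differences; the default of [xget] occurs
    only when [h] has no primitive. *)
Definition prim h : R -> R := xget (cst 0) [set H | forall x : R, is_derive x 1 H (h x)].

Lemma prim_deriv h : continuous h -> forall x : R, is_derive x 1 (prim h) (h x).
Proof. by move=> /antiderivative[H dH]; rewrite /prim; case: xgetP => [_ -> //|/(_ H)]. Qed.

Lemma deriv_unique (H1 H2 h : R -> R) (a b : R) :
  (forall x : R, is_derive x 1 H1 (h x)) -> (forall x : R, is_derive x 1 H2 (h x)) ->
  H1 b - H1 a = H2 b - H2 a.
Proof.
move=> d1 d2.
have D (x : R) : is_derive x 1 (fun y => H1 y - H2 y) 0.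
  by have := deriv_sub (d1 x) (d2 x); rewrite subrr.
suff key x y : x <= y -> H1 y - H1 x = H2 y - H2 x.
  have [ab|/ltW ba] := leP a b; first exact: key.
  by have := key _ _ ba; lra.
move=> xy; have [c _] := mean_value (h := fun=> 0) D xy.
by rewrite mul0r; lra.
Qed.

End primitive.

Section duality.
Context {R : realType} (e : R) (k kt : R -> R) (L B : R).
Context (e01 : 0 < e < 1) (ktk : forall x : R, -1 <= x <= 1 -> kt x = k x)
  (L0 : 0 <= L) (B0 : 0 <= B)
  (ktL : forall x y, `|kt x - kt y| <= L * `|x - y|) (ktB : forall x, `|kt x| <= B).
Local Notation mu := (@mu01 R).
Local Notation leb := (@lebesgue_measure R).
Local Notation intg f := (mu.-integrable setT (EFin \o f)).
Local Notation L2 := (Lfun mu 2%:E).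
Local Notation Loo := (Lfun mu +oo%E).
Local Notation eta := (eta_of kt).
Implicit Types f g h p q u v : R -> R.

Definition Hof p : R -> R := prim (eta p).

Let eta_cont p (pL : p \in L2) : continuous (eta p) := eta_of_cont L0 ktL ktB pL.

Lemma Hof_deriv p : p \in L2 -> forall x : R, is_derive x 1 (Hof p) (eta p x).
Proof. by move=> pL; apply: prim_deriv; exact: eta_cont. Qed.

Lemma HofB p q a b : p \in L2 -> q \in L2 ->
  Hof (fun x => p x - q x) b - Hof (fun x => p x - q x) a =
  (Hof p b - Hof p a) - (Hof q b - Hof q a).
Proof.
move=> pL qL.
have E (x : R) : is_derive x 1 (fun y => Hof p y - Hof q y) (eta (fun x => p x - q x) x).
  by rewrite (eta_ofB L0 ktL ktB)//; exact: (deriv_sub (Hof_deriv pL x) (Hof_deriv qL x)).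
rewrite (deriv_unique a b (Hof_deriv (L2B _ _ pL qL)) E); ring.
Qed.

Lemma HofD p q a b : p \in L2 -> q \in L2 ->
  Hof (fun x => p x + q x) b - Hof (fun x => p x + q x) a =
  (Hof p b - Hof p a) + (Hof q b - Hof q a).
Proof.
move=> pL qL.
have E (x : R) : is_derive x 1 (fun y => Hof p y + Hof q y) (eta (fun x => p x + q x) x).
  by rewrite (eta_ofD L0 ktL ktB)//; exact: (deriv_add (Hof_deriv pL x) (Hof_deriv qL x)).
rewrite (deriv_unique a b (Hof_deriv (L2D _ _ pL qL)) E); ring.
Qed.

Lemma HofZ c p a b : p \in L2 ->
  Hof (fun x => c * p x) b - Hof (fun x => c * p x) a = c * (Hof p b - Hof p a).
Proof.
move=> pL.
have E (x : R) : is_derive x 1 (fun y => c * Hof p y) (eta (fun x => c * p x) x).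
  by rewrite (eta_ofZ L0 ktL ktB)//; exact: (deriv_scale c (Hof_deriv pL x)).
rewrite (deriv_unique a b (Hof_deriv (L2Z c _ pL)) E); ring.
Qed.

Lemma Hof_lip p a b : p \in L2 -> `|Hof p b - Hof p a| <= B * norm2 p * `|b - a|.
Proof.
move=> pL.
wlog ab : a b / a <= b.
  move=> H; have [/H //|/ltW/H] := leP a b.
  by rewrite distrC [X in _ <= _ * X]distrC.
have [c _ ->] := mean_value (Hof_deriv pL) ab.
by rewrite normrM ler_wpM2r// (eta_of_bound L0 ktL ktB).
Qed.

Lemma int_leb_eta p a b : p \in L2 -> a <= b ->
  \int[leb]_(x in `[a, b]) eta p x = Hof p b - Hof p a.
Proof. by move=> pL ab; rewrite (FTC2 (Hof_deriv pL))//; exact: eta_cont. Qed.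

Lemma int_leb_Kadj p a b : p \in L2 -> 0 < a -> a <= b -> b < 1 ->
  \int[leb]_(x in `[a, b]) Kadj k p x = Hof p b - Hof p a.
Proof.
move=> pL a0 ab b1; rewrite -int_leb_eta//; apply: eq_Rintegral => x.
rewrite inE/= in_itv/= => /andP[ax xb]; rewrite (KadjE ktk)//.
by rewrite (lt_le_trans a0)//= (le_lt_trans xb).
Qed.

Lemma Kop_L2 u : u \in L2 -> Kop k u \in L2.
Proof.
move=> uL; rewrite (Kop_Ku ktk); apply: (@L2_bounded _ _ (B * norm2 u)).
  apply/(measurable_restrictT _ _).1 => //; apply: measurable_funTS.
  exact: (Ku_measurable L0 ktL ktB).
move=> t; rewrite patchE; case: ifPn => _; first exact: (Ku_bound L0 ktL ktB).
by rewrite normr0 mulr_ge0// norm2_ge0.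
Qed.

Lemma inner2_Kop p u : p \in L2 -> u \in L2 ->
  inner2 p (Kop k u) = \int[mu]_x (eta p x * u x).
Proof.
move=> pL uL; rewrite -(inner2_Ku L0 ktL ktB)//.
by apply: int01_eq => x x01; rewrite (KopE ktk).
Qed.

Lemma KopB u v t : u \in L2 -> v \in L2 ->
  Kop k (fun x => u x - v x) t = Kop k u t - Kop k v t.
Proof.
move=> uL vL; rewrite !(Kop_Ku ktk) !patchE; case: ifPn => _; last by rewrite subrr.
by rewrite !KuE inner2Br//; exact: (kt_L2' L0 ktL ktB).
Qed.

Lemma inner2_Kop_indic p a b : p \in L2 -> e <= a <= 1 - e -> e <= b <= 1 - e -> a <= b ->
  inner2 p (Kop k \1_`[a, b]) = Hof p b - Hof p a.
Proof.
move=> pL ae be ab; rewrite inner2_Kop//; last exact: indic_L2.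
exact: (int_indic_deriv e01 ae be ab (Hof_deriv pL) (eta_cont pL)).
Qed.

Lemma Kadj_L1 p : p \in L2 -> Kadj k p \in Lfun mu 1%E.
Proof.
move=> pL; apply/Lfun1_integrable; apply: (@intg_bounded _ _ (B * norm2 p)).
  have -> : Kadj k p = eta p \_ `]0, 1[.
    apply/funext => t; rewrite patchE; case: ifPn => [|/negbTE tn].
      by rewrite inE/= in_itv/= => /(KadjE ktk).
    by rewrite /Kadj patchE tn.
  apply/(measurable_restrictT _ _).1 => //; apply: measurable_funTS.
  by apply: continuous_measurable_fun; exact: eta_cont.
move=> t; rewrite /Kadj patchE; case: ifPn => [|_]; last by rewrite normr0 mulr_ge0// norm2_ge0.
rewrite inE/= in_itv/= => t01; have := KadjE ktk p t01.
rewrite /Kadj patchE mem_set; last by rewrite /= in_itv.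
by move=> ->; exact: (eta_of_bound L0 ktL ktB).
Qed.

Lemma Greg0 : Greg e (cst 0 : R -> R) = 0%E.
Proof.
apply/eqP; rewrite eq_le Greg_ge0 andbT; apply: Greg_le.
- by apply: (@Loo_bounded _ _ 0) => // x; rewrite normr0.
- exact: ae01_in.
- by move=> phi dphi _ _ _; under eq_Rintegral do rewrite mul0r; rewrite int0 oppr0.
Qed.

Lemma Greg_cases v : (exists V, Greg e v = V%:E) \/ Greg e v = +oo%E.
Proof.
by have := Greg_ge0 e v; case: (Greg e v) => [V _| |]; [left; exists V|right|].
Qed.

Definition osc2 p := forall x y, e <= x <= 1 - e -> e <= y <= 1 - e -> Hof p x - Hof p y <= 2.

Lemma osc2_int_le p v V : p \in L2 -> osc2 p -> Greg e v = V%:E ->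
  \int[mu]_x (eta p x * v x) <= V.
Proof.
move=> pL po GV; rewrite -[leRHS]mul1r.
apply: (int_le_Greg e01 _ GV (Hof_deriv pL) (eta_cont pL)) => // x y xe ye.
by rewrite mulr1; exact: po.
Qed.

(** Testing on signed indicators of intervals, of seminorm at most 2, gives the oscillation bound;
    conversely [int_le_Greg] with [M = 1] covers every function of finite seminorm. *)
Lemma dual_feasibleP p : p \in L2 -> (dual_feasible e k p <-> osc2 p).
Proof.
move=> pL.
have E v : \int[mu]_x (Kadj k p x * (v x - cst 0 x)) = \int[mu]_x (eta p x * v x).
  by apply: int01_eq => x x01; rewrite subr0 (KadjE ktk).
split=> [[_ [_ H]] x y xe ye|po].
  pose s : R := if y <= x then 1 else -1.
  pose a := Num.min x y; pose b := Num.max x y.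
  have ab : a <= b by rewrite /a /b ge_min le_max lexx.
  have ae : e <= a <= 1 - e by rewrite /a; case: (leP x y).
  have be : e <= b <= 1 - e by rewrite /b; case: (leP x y).
  (* The coefficient 2 cancels the factor 1/2 in [step_comb]; the sign [s] orients the increment
     from [y] to [x]. *)
  pose v := step_comb (fun _ : 'I_1 => 2) (fun=> s) (fun=> a) (fun=> b).
  have := H v (step_Loo _ _ _ _); rewrite Greg0 add0e E => Hv.
  have := le_trans Hv (Greg_step e01 (fun i : 'I_1 => ler0n R 2) _ (fun=> ae) (fun=> be) (fun=> ab)).
  rewrite big_ord1 lee_fin int_step; last exact: eta_cont.
  rewrite big_ord1 (int_indic_deriv e01 ae be ab (Hof_deriv pL) (eta_cont pL)).
  move=> /(_ _)/wrap[].
    by move=> _; rewrite /s; case: ifP; [left|right].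
  rewrite /s /a /b; case: (leP x y) => xy; case: (leP y x) => yx; try lra.
  by move=> _; rewrite (_ : x = y); [lra|apply/le_anti; rewrite xy yx].
split=> //; split; first exact: Kadj_L1.
move=> v vL; rewrite Greg0 add0e E.
have [[V GV]|->] := Greg_cases v; last exact: leey.
by rewrite GV lee_fin; exact: osc2_int_le GV.
Qed.

(** * Optimality of a function whose residual is a certificate *)

Section optimality.
Context (lam : R) (f u p : R -> R) (V : R).
Context (lam0 : 0 < lam) (fL : f \in L2) (uL : u \in Loo) (GV : Greg e u = V%:E)
  (pE : p = fun t => lam^-1 * (f t - Kop k u t)) (po : osc2 p)
  (etaV : \int[mu]_x (eta p x * u x) = V).

Let uL2 : u \in L2. Proof. exact: Loo_L2. Qed.

Let KuL : Kop k u \in L2. Proof. exact: Kop_L2. Qed.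

Let pL : p \in L2.
Proof. by rewrite pE; apply: L2Z; apply: L2B. Qed.

(** Completing the square around [u] is exact because the residual is [lam * p] and [u] is extremal
    for [p]. When [p] is feasible both terms of the excess are nonnegative, so one identity serves
    for optimality and for uniqueness. *)
Lemma primal_excess v Vv : v \in Loo -> Greg e v = Vv%:E ->
  primal_objective e k lam f v =
  (primal_objective e k lam f u +
   (1 / 2 * norm2 (Kop k (fun x => v x - u x)) ^+ 2 +
    lam * (Vv - \int[mu]_x (eta p x * v x)))%:E)%E.
Proof.
move=> vL Gv; rewrite /primal_objective GV Gv -!EFinM -!EFinD; congr (_%:E).
have vL2 := Loo_L2 _ vL; have dL := L2B _ _ vL2 uL2; have KdL := Kop_L2 dL.
have E1 : Kop k v \- f = fun t => Kop k (fun x => v x - u x) t - lam * p t.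
  apply/funext => t /=; rewrite KopB// pE mulrA divff ?mul1r ?gt_eqF//; ring.
have E2 : Kop k u \- f = fun t => - lam * p t.
  apply/funext => t /=; rewrite pE mulrA mulNr divff ?gt_eqF//; ring.
have E3 : \int[mu]_x (eta p x * v x) = V + inner2 p (Kop k (fun x => v x - u x)).
  rewrite inner2_Kop// -etaV -intD; last 2 first.
  - by apply: Loo_intgM => //; exact: continuous_intg (eta_cont pL).
  - by apply: Loo_intgM; [exact: continuous_intg (eta_cont pL)|exact: LooB].
  by apply: eq_Rintegral => x _; ring.
rewrite E1 E2 E3 !norm2_sqr//; try by [exact: L2Z|apply: L2B => //; exact: L2Z].
have lpL := L2Z lam _ pL.
rewrite inner2Bl ?inner2Br ?inner2Zl ?inner2Zr//; try by [apply: L2B|exact: L2Z].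
rewrite (inner2C (Kop k _) p); field.
all: by repeat first [assumption|apply: L2B|apply: L2Z].
Qed.

Lemma primal_optimal : primal_solution e k lam f u.
Proof.
split=> // v vL; have [[Vv Gv]|Gv] := Greg_cases v.
  rewrite (primal_excess vL Gv) leeDl// lee_fin addr_ge0//.
    by rewrite mulr_ge0// sqr_ge0.
  by rewrite mulr_ge0 ?(ltW lam0)// subr_ge0; exact: osc2_int_le Gv.
by rewrite /primal_objective Gv gt0_muley ?lte_fin// addey ?leey.
Qed.

(** The excess of a second solution is nonpositive, so both of its terms vanish: [v] is extremal for
    [p], and [Kop] takes the same value on [v] and [u], which is recorded through pairings with
    [eta q]. *)
Lemma primal_optimal_unique v : primal_solution e k lam f v ->
  [/\ v \in Loo, exists2 Vv, Greg e v = Vv%:E & \int[mu]_x (eta p x * v x) = Vv &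
      forall q, q \in L2 -> \int[mu]_x (eta q x * (v x - u x)) = 0].
Proof.
move=> [vL Hv]; have Huv := Hv u uL; split => //.
  have [[Vv Gv]|Gv] := Greg_cases v; last first.
    by move: Huv; rewrite /primal_objective Gv GV gt0_muley ?lte_fin// addey.
  exists Vv => //; move: Huv; rewrite (primal_excess vL Gv).
  rewrite {1 2}/primal_objective GV -!EFinM -!EFinD lee_fin gerDl => H.
  have H1 := osc2_int_le pL po Gv; have H2 := sqr_ge0 (norm2 (Kop k (fun x => v x - u x))).
  have H3 : Vv - \int[mu]_x (eta p x * v x) <= 0 by rewrite -(pmulr_rle0 _ lam0); lra.
  by apply/eqP; rewrite eq_le H1/=; lra.
have [[Vv Gv]|Gv] := Greg_cases v; last first.
  by move: Huv; rewrite /primal_objective Gv GV gt0_muley ?lte_fin// addey.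
move: Huv; rewrite (primal_excess vL Gv).
rewrite {1 2}/primal_objective GV -!EFinM -!EFinD lee_fin gerDl => H q qL.
have H1 := osc2_int_le pL po Gv.
have dL := L2B _ _ (Loo_L2 _ vL) uL2.
have H2 : norm2 (Kop k (fun x => v x - u x)) ^+ 2 <= 0.
  by have : 0 <= lam * (Vv - \int[mu]_x (eta p x * v x)); [rewrite mulr_ge0 ?(ltW lam0)// subr_ge0|lra].
have H3 : norm2 (Kop k (fun x => v x - u x)) = 0.
  by apply/eqP; rewrite -sqrf_eq0 eq_le H2 sqr_ge0.
rewrite -inner2_Kop//; apply/eqP; rewrite -normr_le0.
by apply: (le_trans (cauchy_schwarz _ _ qL (Kop_L2 dL))); rewrite H3 mulr0.
Qed.

(** The dual counterpart of [primal_excess]; the quadratic term makes the dual maximiser unique. *)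
Lemma dual_excess q : q \in L2 ->
  reg_dual_objective lam f p - reg_dual_objective lam f q =
  lam ^+ 2 / 2 * norm2 (fun x => q x - p x) ^+ 2 +
  lam * (V - \int[mu]_x (eta q x * u x)).
Proof.
move=> qL; have dL := L2B _ _ qL pL.
have E3 : inner2 q (Kop k u) = \int[mu]_x (eta q x * u x) by rewrite inner2_Kop.
have E4 : inner2 p (Kop k u) = V by rewrite inner2_Kop.
have fE : f = fun t => Kop k u t + lam * p t.
  by apply/funext => t; rewrite pE mulrA divff ?gt_eqF// mul1r addrC subrK.
have lpL := L2Z lam _ pL.
rewrite /reg_dual_objective -E3 -E4 !norm2_sqr//.
rewrite (inner2Bl _ _ _ qL pL dL) !inner2Br// fE !inner2Dl// !inner2Zl//.
rewrite !(inner2C (Kop k u)) (inner2C q p); field.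
all: by repeat first [assumption|apply: L2B|apply: L2Z].
Qed.

Lemma dual_optimal : reg_dual_solution e k lam f p.
Proof.
split=> [|q [qL qf]]; first exact/dual_feasibleP.
rewrite -subr_ge0 dual_excess// addr_ge0//.
  by rewrite mulr_ge0 ?sqr_ge0// divr_ge0 ?sqr_ge0.
rewrite mulr_ge0 ?(ltW lam0)// subr_ge0.
by apply: osc2_int_le GV => //; apply/dual_feasibleP.
Qed.

(** Whichever maximiser [xget] returns is at L^2-distance 0 from [p] by [dual_excess], and [Kadj]
    depends only on the class. *)
Lemma eta_reg_eq : eta_reg e k lam f = Kadj k p.
Proof.
rewrite /eta_reg; case: xgetP => [q _ [[qL qf] Hq]|/(_ p)]; last by move/(_ dual_optimal).
have := Hq p dual_optimal.1; rewrite -subr_le0 dual_excess// => H.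
have qo : osc2 q by apply/dual_feasibleP.
have H1 := osc2_int_le qL qo GV.
have dL := L2B _ _ qL pL.
have H2 : norm2 (fun x => q x - p x) = 0.
  have l2 : 0 < lam ^+ 2 / 2 by rewrite divr_gt0 ?exprn_gt0.
  apply/eqP; rewrite -sqrf_eq0 eq_le sqr_ge0 andbT.
  rewrite -(pmulr_rle0 _ l2); have : 0 <= lam * (V - \int[mu]_x (eta q x * u x)).
    by rewrite mulr_ge0 ?(ltW lam0)// subr_ge0.
  by lra.
apply/funext => t; rewrite /Kadj !patchE; case: ifPn => //.
rewrite inE/= in_itv/= => t01; have := KadjE ktk q t01; have := KadjE ktk p t01.
rewrite /Kadj !patchE mem_set; last by rewrite /= in_itv.
move=> -> ->; apply/eqP; rewrite -subr_eq0 -(eta_ofB L0 ktL ktB)// -normr_le0.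
by apply: (le_trans (eta_of_bound L0 ktL ktB _ dL)); rewrite H2 mulr0.
Qed.

End optimality.

End duality.

(** * Extreme points and the weak* metric *)

Section weak_star_topology.
Context {R : realType}.
Local Notation mu := (@mu01 R).
Local Notation L1T := (LfunType mu (lexx 1%E)).

Lemma pairing_continuous (h : L1T) :
  continuous ((fun u => \int[mu]_x (h x * u x)) : weak_star R -> R).
Proof.
move=> u; apply: (@continuous_comp (weak_star R) {ptws L1T -> R} R (@L1_pairing R) (fun f => f h)).
  exact: initial_continuous.
exact: proj_continuous.
Qed.

(** The initial topology pulls back the product topology on functions over L^1, where convergence is
    tested coordinate by coordinate. *)
Lemma weak_star_cvg (u_ : nat -> weak_star R) (u : weak_star R) :
  (forall h : L1T, \int[mu]_x (h x * u_ n x) @[n --> \oo] --> (\int[mu]_x (h x * u x) : R)) ->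
  u_ @ \oo --> u.
Proof.
move=> H.
have C : (@L1_pairing R \o u_) @ \oo --> (@L1_pairing R u : {ptws L1T -> R}).
  apply/cvg_sup => h; apply/cvg_image.
    by apply/seteqP; split => // r _; exists (fun=> r).
  move=> A /= /(H h) HA; exists [set g | A (g h)].
    exact: HA.
  apply/seteqP; split => [r [g Ag <-]//|r Ar].
  by exists (fun=> r).
move=> A [B [[D Dop DB] Bu BA]].
have : nbhs (@L1_pairing R u : {ptws L1T -> R}) D.
  by apply: open_nbhs_nbhs; split => //; rewrite -DB in Bu.
move=> /C [N _ HN]; exists N => // n nN; apply: BA; rewrite -DB; exact: HN.
Qed.

Lemma weak_star_cvg_pairing (u_ : nat -> weak_star R) (u : weak_star R) (h : R -> R) :
  u_ @ \oo --> u -> mu.-integrable setT (EFin \o h) ->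
  \int[mu]_x (h x * u_ n x) @[n --> \oo] --> (\int[mu]_x (h x * u x) : R).
Proof.
move=> cu /Lfun1_integrable hL.
apply: (@cvg_comp _ _ _ u_ (fun v : weak_star R => \int[mu]_x (h x * v x)) _ _ _ cu).
exact: (@pairing_continuous (Lfun_Sub (lexx 1%E) hL) u).
Qed.

Lemma weak_star_closure (A : set (weak_star R)) (u : weak_star R) (h : R -> R) :
  mu.-integrable setT (EFin \o h) -> closure A u ->
  (forall v, A v -> \int[mu]_x (h x * v x) = 0) -> \int[mu]_x (h x * u x) = 0.
Proof.
move=> /Lfun1_integrable hL Au HA; apply/eqP/negPn/negP => hu.
have op : open [set r : R | r != 0] by exact: open_neq.
have N : nbhs u [set v : weak_star R | \int[mu]_x (h x * v x) != 0].
  exact: (@pairing_continuous (Lfun_Sub (lexx 1%E) hL) u _ (open_nbhs_nbhs (conj op hu))).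
by have [v [/HA Av /=]] := Au _ N; rewrite Av eqxx.
Qed.

End weak_star_topology.

(** * Atoms as extreme points of the unit ball *)

Section atoms.
Context {R : realType} (e : R) (e01 : 0 < e < 1).
Local Notation mu := (@mu01 R).
Local Notation intg f := (mu.-integrable setT (EFin \o f)).
Local Notation Loo := (Lfun mu +oo%E).
Implicit Types (s a b : R).

Lemma atom_step s a b :
  atom s a b = step_comb (fun _ : 'I_1 => 1) (fun=> s) (fun=> a) (fun=> b).
Proof. by apply/funext => x; rewrite /atom /step_comb; congr (_ * _); rewrite big_ord1 mul1r. Qed.

Lemma atom_Loo s a b : atom s a b \in Loo.
Proof. by rewrite atom_step; exact: step_Loo. Qed.

Lemma int_atom s a b (h H : R -> R) : e <= a <= 1 - e -> e <= b <= 1 - e -> a <= b ->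
  (forall x : R, is_derive x 1 H (h x)) -> continuous h ->
  \int[mu]_x (h x * atom s a b x) = 1 / 2 * s * (H b - H a).
Proof.
move=> ae be ab dH ch; rewrite atom_step int_step// big_ord1 mul1r.
by rewrite (int_indic_deriv e01 ae be ab dH ch).
Qed.

Lemma Gball_atom s a b : s = 1 \/ s = -1 -> e <= a <= 1 - e -> e <= b <= 1 - e -> a <= b ->
  Gball e (atom s a b).
Proof.
move=> s1 ae be ab; split; first exact: atom_Loo.
rewrite atom_step; apply: (le_trans (Greg_step e01 _ _ _ _ _)) => //.
by rewrite big_ord1.
Qed.

(* A primitive of modulus at most 1 that attains the values -1 and 1 only at [a] and [b], with quadratic contact. *)
Lemma peak_function a b : a < b -> exists P dP : R -> R, exists2 ka : R, 0 < ka &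
  [/\ forall x : R, is_derive x 1 P (dP x), continuous dP, P a = -1, P b = 1 &
   forall x : R, 0 <= x <= 1 -> P x <= 1 - ka * (x - b) ^+ 2 /\ -1 + ka * (x - a) ^+ 2 <= P x].
Proof.
move=> ab; have ab0 : 0 < b - a by rewrite subr_gt0.
pose c := (b - a)^-1 * 2.
(* [y] maps [a] and [b] affinely to -1 and 1, and the peak function is [2 y / (1 + y^2)]: its
   distances to 1 and to -1 are [(1 - y)^2 / (1 + y^2)] and [(1 + y)^2 / (1 + y^2)]. *)
pose y (x : R) : R := (b - a)^-1 * (2 * x - (a + b)).
pose q (x : R) : R := 1 + y x * y x.
have q1 x : 1 <= q x by rewrite /q lerDl -expr2 sqr_ge0.
have qp x : 0 < q x by rewrite (lt_le_trans ltr01).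
have q0 x : q x != 0 by rewrite gt_eqF.
have dy (x : R) : is_derive x 1 y c.
  have := deriv_scale (b - a)^-1 (deriv_sub (deriv_scale 2 (deriv_id x)) (deriv_cst (a + b) x)).
  by rewrite subr0 mulr1.
have dq (x : R) : is_derive x 1 q (2 * (c * y x)).
  have := deriv_add (deriv_cst 1 x) (deriv_mul (dy x) (dy x)).
  by move=> H; apply: is_derive_eq H _; ring.
have dV (x : R) : is_derive x 1 (fun z => (q z)^-1) (- ((q x)^-1 * (q x)^-1 * (2 * (c * y x)))).
  have := is_deriveV (q0 x) (dq x).
  by move=> H; apply: is_derive_eq H _; rewrite -[_ *: _]/(_ * _) -exprVn expr2; ring.
have cy : continuous y := is_derive_continuous dy.
have cV : continuous (fun z => (q z)^-1) := is_derive_continuous dV.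
have [Y Y0 HY] := continuous_bounded01 cy.
pose ka := 4 * ((b - a)^-1 * (b - a)^-1) * (1 + Y * Y)^-1.
have iab : 0 < (b - a)^-1 by rewrite invr_gt0.
have YY : 0 < 1 + Y * Y by rewrite ltr_pwDl// mulr_ge0 ?(ltW Y0).
have ka0 : 0 < ka by rewrite !mulr_gt0// invr_gt0.
have ya : y a = -1 by rewrite /y; field; rewrite gt_eqF.
have yb : y b = 1 by rewrite /y; field; rewrite gt_eqF.
exists (fun x => 2 * y x * (q x)^-1), (fun x => 2 * c * (q x)^-1 +
   2 * y x * - ((q x)^-1 * (q x)^-1 * (2 * (c * y x)))), ka => //.
split.
- by move=> x; exact: (deriv_mul (deriv_scale 2 (dy x)) (dV x)).
- apply: continuousD; apply: continuousM => //; try exact: continuous_cst.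
    by apply: continuousM => //; exact: continuous_cst.
  apply: (@continuous_cmp _ (fun z : R => - z)); first exact: opp_continuous.
  apply: continuousM; first exact: continuousM.
  by apply: continuousM; first exact: continuous_cst; apply: continuousM => //; exact: continuous_cst.
- by rewrite /q ya; field.
- by rewrite /q yb; field.
- move=> x x01.
  have qY : (1 + Y * Y)^-1 <= (q x)^-1.
    rewrite lef_pV2 ?posrE// /q lerD2l.
    by have := HY x x01; rewrite ler_norml => /andP[h1 h2]; nra.
  have k1 z : ka * z ^+ 2 <= 4 * ((b - a)^-1 * z) ^+ 2 * (q x)^-1.
    have -> : ka * z ^+ 2 = 4 * ((b - a)^-1 * z) ^+ 2 * (1 + Y * Y)^-1 by rewrite /ka; ring.
    by rewrite ler_wpM2l// mulr_ge0// sqr_ge0.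
  have E1 : 1 - 2 * y x * (q x)^-1 = 4 * ((b - a)^-1 * (x - b)) ^+ 2 * (q x)^-1.
    have -> : (b - a)^-1 * (x - b) = (y x - y b) / 2 by rewrite /y; field; rewrite gt_eqF.
    by rewrite yb; rewrite /q in q0 *; field; exact: q0.
  have E2 : 1 + 2 * y x * (q x)^-1 = 4 * ((b - a)^-1 * (x - a)) ^+ 2 * (q x)^-1.
    have -> : (b - a)^-1 * (x - a) = (y x - y a) / 2 by rewrite /y; field; rewrite gt_eqF.
    by rewrite ya; rewrite /q in q0 *; field; exact: q0.
  by have := k1 (x - b); have := k1 (x - a); rewrite -E1 -E2; lra.
Qed.

Lemma continuous_dual_unique u v : u \in Loo -> v \in Loo ->
  (forall g : R -> R, continuous g -> \int[mu]_x (g x * u x) = \int[mu]_x (g x * v x)) ->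
  u = v %[ae mu].
Proof.
move=> uL vL H; have : (fun x => u x - v x) = cst 0 %[ae mu].
  apply: ae0_of_continuous_orthogonal; first exact: LooB.
  move=> g cg; have gi := continuous_intg cg.
  have -> : (fun x => g x * (u x - v x)) = (fun x => g x * u x - g x * v x).
    by apply/funext => x; rewrite mulrBr.
  by rewrite intB ?H ?subrr//; exact: Loo_intgM.
by apply: ae01S => x /= /(_ I) /eqP; rewrite subr_eq0 => /eqP.
Qed.

Lemma convex_extremal (t x y : R) : 0 < t -> t < 1 -> x <= 1 -> y <= 1 ->
  t * x + (1 - t) * y = 1 -> x = 1 /\ y = 1.
Proof.
move=> t0 t1 x1 y1 E; have z1 : 0 <= t * (1 - x) by rewrite mulr_ge0 ?subr_ge0// ltW.
have z2 : 0 <= (1 - t) * (1 - y) by rewrite mulr_ge0 ?subr_ge0// ltW.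
have /eqP : t * (1 - x) = 0 by lra.
have /eqP : (1 - t) * (1 - y) = 0 by lra.
rewrite !mulf_eq0 !subr_eq0 (gt_eqF t0) (gt_eqF t1)/=.
by move=> /eqP <- /eqP <-.
Qed.

(** The atom is exposed: the pairing with [s * dP], for the peak function [P], is at most 1 on the
    ball and equals 1 at the atom, hence also at [v1] and [v2]. Strictness of the peak and
    [rigidity] then determine any such function. *)
Lemma atom_extreme s a b : s = 1 \/ s = -1 -> e <= a <= 1 - e -> e <= b <= 1 - e -> a < b ->
  extreme_points (Gball e) (atom s a b).
Proof.
move=> s1 ae be ab; split; first exact: Gball_atom (ltW ab).
move=> v1 v2 t [v1L v1G] [v2L v2G] t01 E.
have [P [dP [ka ka0 [DP cP Pa Pb HP]]]] := peak_function ab.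
pose h x := s * dP x; pose H x := s * P x.
have dH (x : R) : is_derive x 1 H (h x) by exact: (deriv_scale s (DP x)).
have ch : continuous h by apply: continuousM => //; exact: continuous_cst.
have ss : s * s = 1 by case: s1 => ->; ring.
have Eat : \int[mu]_x (h x * atom s a b x) = 1.
  by rewrite (int_atom s ae be (ltW ab) dH ch) /H Pa Pb; case: s1 => ->; field.
have I01 (x : R) : e <= x <= 1 - e -> 0 <= x <= 1.
  by move: e01 => /andP[? ?] /andP[? ?]; apply/andP; split; lra.
have osc x y : e <= x <= 1 - e -> e <= y <= 1 - e -> H x - H y <= 2 * 1.
  move=> xe ye; have [h1 h2] := HP x (I01 x xe); have [h3 h4] := HP y (I01 y ye).
  have := mulr_ge0 (ltW ka0) (sqr_ge0 (x - a)); have := mulr_ge0 (ltW ka0) (sqr_ge0 (x - b)).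
  have := mulr_ge0 (ltW ka0) (sqr_ge0 (y - a)); have := mulr_ge0 (ltW ka0) (sqr_ge0 (y - b)).
  by rewrite /H; case: s1 => ->; lra.
have le1 v : (Greg e v <= 1)%E -> exists2 V, Greg e v = V%:E & \int[mu]_x (h x * v x) <= V <= 1.
  have [[V GV]|->//] := Greg_cases e v; rewrite GV lee_fin => V1; exists V => //; rewrite V1 andbT.
  by rewrite -[leRHS]mul1r; apply: (int_le_Greg e01 ler01 GV dH ch).
have [V1 GV1 IV1] := le1 _ v1G; have [V2 GV2 IV2] := le1 _ v2G.
have hi := continuous_intg ch.
have hv1 := Loo_intgM _ _ hi v1L; have hv2 := Loo_intgM _ _ hi v2L.
have mL1 := LooZ t _ v1L; have mL2 := LooZ (1 - t) _ v2L.
have Esum : t * \int[mu]_x (h x * v1 x) + (1 - t) * \int[mu]_x (h x * v2 x) = 1.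
  rewrite -!intZ// -intD; try exact: intgZ.
  transitivity (\int[mu]_x (h x * atom s a b x)) => //; apply: ae_int.
  - by apply: measurable_funD; apply: measurable_funM => //; exact: intg_measurable.
  - by apply: measurable_funM; [exact: intg_measurable|exact: Loo_measurable (atom_Loo _ _ _)].
  - by apply: ae01S E => x /= /(_ I) -> _; ring.
have I12 : \int[mu]_x (h x * v1 x) = 1 /\ \int[mu]_x (h x * v2 x) = 1.
  move: Esum IV1 IV2 t01; set I1 := \int[mu]_x _; set I2 := \int[mu]_x _.
  move=> Esum /andP[i1 i2] /andP[i3 i4] /andP[t0 t1].
  exact: (convex_extremal t0 t1 (le_trans i1 i2) (le_trans i3 i4) Esum).
suff fin v V : v \in Loo -> Greg e v = V%:E -> \int[mu]_x (h x * v x) = 1 -> V <= 1 ->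
    \int[mu]_x (h x * v x) <= V -> v = atom s a b %[ae mu].
  case: I12 => i1 i2; case/andP: IV1 => x1 y1; case/andP: IV2 => x2 y2.
  by split; [exact: (fin v1 V1)|exact: (fin v2 V2)].
move=> vL GV Iv V_1 IV.
have VE : \int[mu]_x (h x * v x) = V by apply/le_anti; rewrite IV Iv V_1.
apply: continuous_dual_unique => //; first exact: atom_Loo.
move=> g cg; pose G := prim g; have dG := prim_deriv cg.
(* With this multiple of [H] removed, [T] takes equal values at [a] and [b], so it perturbs the
   maximal oscillation only to second order. *)
pose be_ := s * (G b - G a) / 2.
pose th x := g x - be_ * h x; pose T x := G x - be_ * H x.
have dT (x : R) : is_derive x 1 T (th x) by exact: (deriv_sub (dG x) (deriv_scale be_ (dH x))).
have ct : continuous th.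
  by apply: continuousB => //; apply: continuousM => //; exact: continuous_cst.
have Tab : T a = T b by rewrite /T /H Pa Pb /be_; case: s1 => ->; field.
have [K K0 HK] := continuous_bounded01 ct.
have Tlip x y : 0 <= x <= 1 -> 0 <= y <= 1 -> `|T x - T y| <= K * `|x - y|.
  wlog yx : x y / y <= x.
    move=> W x01 y01; have [yx|/ltW xy] := leP y x; first exact: W.
    by rewrite distrC (distrC x); exact: W.
  move=> x01 y01; have [m /andP[m1 m2] ->] := mean_value dT yx.
  by rewrite normrM ler_wpM2r// HK//; move: x01 y01 m1 m2; clear; lra.
have key : \int[mu]_x (th x * v x) = 0.
  (* The constant comes from absorbing [r K d] into the quadratic contact:
     [r K d <= ka d^2 + K^2 r^2 / (4 ka)], once at each endpoint. *)
  apply: (@rigidity _ e v V H h T th (K ^+ 2 / (4 * ka)) 1 e01 GV _ ltr01 dH ch dT ct VE).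
    by rewrite divr_ge0 ?sqr_ge0// mulr_ge0 ?(ltW ka0).
  move=> r x y _ xe ye.
  have x01 := I01 x xe.
  have y01 := I01 y ye.
  have [h1 h2] := HP x x01; have [h3 h4] := HP y y01.
  have yg z w : 0 <= z <= 1 -> 0 <= w <= 1 -> r * (T z - T w) <= ka * (z - w) ^+ 2 + K ^+ 2 / (4 * ka) * r ^+ 2.
    move=> z01 w01; apply: (@le_trans _ _ (`|r| * (K * `|z - w|))).
      by rewrite (le_trans (ler_norm _))// normrM ler_wpM2l// Tlip.
    rewrite -(real_normK (num_real (z - w))) -(real_normK (num_real r)).
    have -> : K ^+ 2 / (4 * ka) * `|r| ^+ 2 = (K * `|r| / (2 * ka)) ^+ 2 * ka by field; rewrite gt_eqF.
    have -> : `|r| * (K * `|z - w|) = 2 * ka * (K * `|r| / (2 * ka)) * `|z - w| by field; rewrite gt_eqF.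
    have := mulr_ge0 (ltW ka0) (sqr_ge0 (`|z - w| - K * `|r| / (2 * ka))).
    by move: (K * `|r| / (2 * ka)) => w0; clear; nra.
  have a01 := I01 a ae.
  have b01 := I01 b be.
  have sq1 z : (y - z) ^+ 2 = (z - y) ^+ 2 by ring.
  have := yg x a x01 a01; have := yg x b x01 b01; have := yg a y a01 y01; have := yg b y b01 y01.
  rewrite -!(sq1 _) Tab /H; move: h1 h2 h3 h4; case: s1 => ->; clear; lra.
have gv : \int[mu]_x (g x * v x) = be_.
  have gi := Loo_intgM _ _ (continuous_intg cg) vL.
  have : \int[mu]_x (th x * v x) = \int[mu]_x (g x * v x) - be_ * \int[mu]_x (h x * v x).
    rewrite -intZ; last exact: Loo_intgM.
    rewrite -intB//; last by apply: intgZ; exact: Loo_intgM.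
    by apply: eq_Rintegral => x _; rewrite /th; ring.
  by rewrite key Iv mulr1 => /esym/eqP; rewrite subr_eq0 => /eqP.
by rewrite gv (int_atom s ae be (ltW ab) dG cg) /be_ /G; field.
Qed.

Lemma Bset_atom s a b : s = 1 \/ s = -1 -> e <= a <= 1 - e -> e <= b <= 1 - e -> a < b ->
  Bset e (atom s a b).
Proof.
move=> s1 ae be ab; split; first exact: atom_Loo.
by apply: subset_closure; exact: atom_extreme.
Qed.

(** Pairing with the indicator of an interval in a zero zone annihilates the ball, hence its weak*
    closure, but not an atom that covers that interval. *)
Lemma Bset_atom_outside s a b c d : s = 1 \/ s = -1 -> Bset e (atom s a b) -> c < d ->
  0 <= c -> d <= 1 -> a <= c -> d <= b -> d <= e \/ 1 - e <= c -> False.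
Proof.
move=> s1 [_ Bc] cd c0 d1 ac db cde.
(* The middle third stays strictly inside (0,1) and inside the open zero zone. *)
pose c' := (2 * c + d) / 3; pose d' := (c + 2 * d) / 3.
have cc : c < c' by rewrite /c'; lra.
have cd' : c' < d' by rewrite /c' /d'; lra.
have dd : d' < d by rewrite /d'; lra.
have hi : intg (\1_`[c', d'] : R -> R) := L2_intg _ (indic_L2 c' d').
have : \int[mu]_x (\1_`[c', d'] x * atom s a b x) = 0.
  apply: weak_star_closure hi Bc _ => v [[vL Gv] _].
  rewrite -int0; apply: ae_int.
  - by apply: measurable_funM => //; exact: Loo_measurable.
  - exact: measurable_cst.
  have [[V /Greg_fin[_ v0 _]]|Ev] := Greg_cases e v; last by move: Gv; rewrite Ev.
  have H01 := @ae01_in R (fun x => 0 < x < 1) (fun x x01 => x01).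
  apply: ae01S2 H01 v0 => x x01 /= vx _.
  rewrite indicE; case: (boolP (x \in _)) => [|_]; last by rewrite mul0r.
  rewrite inE/= in_itv/= => /andP[h1 h2]; rewrite vx ?mulr0//.
  by case: cde => cde; [left|right]; rewrite in_itv/=; lra.
have -> : \int[mu]_x (\1_`[c', d'] x * atom s a b x) = \int[mu]_x (1 / 2 * s * (1 * \1_`[c', d'] x)).
  apply: eq_Rintegral => x _; rewrite /atom !indicE.
  case: (boolP (x \in `[c', d']%classic)) => [|_]; last by rewrite !(mul0r, mulr0).
  rewrite inE/= in_itv/= => /andP[h1 h2]; rewrite mem_set; first by rewrite (_ : true%:R = 1 :> R)//; ring.
  by rewrite /= in_itv/=; lra.
rewrite intZ; last by move: hi; apply: eq_integrable => // x _; rewrite /= mul1r.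
rewrite -mu01_ltb; [|lra|lra].
have := FTC2 (@deriv_id R) (@continuous_cst R 1) (ltW cd').
by move=> ->; case: s1 => ->; lra.
Qed.

Lemma Bset_atom_itv s a b : s = 1 \/ s = -1 -> Bset e (atom s a b) ->
  Num.max a 0 < Num.min b 1 -> e <= a /\ b <= 1 - e.
Proof.
move=> s1 Bs; rewrite lt_min !gt_max => /andP[/andP[ab b0] /andP[a1 _]].
move: e01 => /andP[e0 e1].
split; rewrite leNgt; apply/negP => H.
  apply: (@Bset_atom_outside s a b (Num.max a 0) (Num.min b e) s1 Bs).
  - by rewrite lt_min !gt_max ab b0 H e0.
  - by rewrite le_max lexx orbT.
  - by rewrite ge_min (ltW e1) orbT.
  - by rewrite le_max lexx.
  - by rewrite ge_min lexx.
  - by left; rewrite ge_min lexx orbT.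
apply: (@Bset_atom_outside s a b (Num.max a (1 - e)) (Num.min b 1) s1 Bs).
- by rewrite lt_min !gt_max ab H a1 gtrBl.
- by rewrite le_max subr_ge0 (ltW e1) orbT.
- by rewrite ge_min lexx orbT.
- by rewrite le_max lexx.
- by rewrite ge_min lexx.
- by right; rewrite le_max lexx orbT.
Qed.

Lemma ae01_neq (r : R) : \forall x \ae mu, x <> r.
Proof.
exists [set r]; split; first exact: measurable_set1.
  rewrite /mu01 /mrestr; apply/eqP; rewrite eq_le measure_ge0 andbT.
  rewrite -(@lebesgue_measure_set1 R r); apply: le_measure; rewrite ?inE//.
  by apply: measurableI.
by move=> x /=; apply: contra_notP.
Qed.

(** Dominated convergence: the indicators converge at every point other than [a] and [b]. *)
Lemma int_atom_cvg s (a_ b_ : nat -> R) a b (h : R -> R) : `|s| = 1 -> intg h ->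
  a_ @ \oo --> a -> b_ @ \oo --> b ->
  \int[mu]_x (h x * atom s (a_ n) (b_ n) x) @[n --> \oo] --> (\int[mu]_x (h x * atom s a b x) : R).
Proof.
move=> s1 hi ca cb.
have at1 r1 r2 x : `|atom s r1 r2 x| <= 1.
  rewrite /atom normrM (normrM s) s1 mul1r; have := indic_le1 `[r1, r2]%classic x.
  by rewrite (@ger0_norm _ 2^-1); lra.
have mi r1 r2 : intg (fun x => h x * atom s r1 r2 x) by apply: Loo_intgM => //; exact: atom_Loo.
have [//| | | | |_ _ C] := @dominated_convergence _ _ _ mu setT measurableT
  (fun n x => (h x * atom s (a_ n) (b_ n) x)%:E) (fun x => (h x * atom s a b x)%:E)
  (fun x => `|h x|%:E).
- by move=> n; exact: measurable_int (mi _ _).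
- exact: measurable_int (mi _ _).
- apply: ae01S2 (ae01_neq a) (ae01_neq b) => x xa xb _.
  have near_le (u_ : nat -> R) (u : R) : x <> u -> u_ @ \oo --> u ->
      \forall n \near \oo, (u_ n <= x) = (u <= x) /\ (x <= u_ n) = (x <= u).
    move=> xu cu; have [ux|xu'|/esym//] := ltgtP u x.
      by have [N _ HN] := cvgr_lt u cu x ux; exists N => // n /HN un; rewrite /= (ltW un) leNgt un.
    by have [N _ HN] := cvgr_gt u cu x xu'; exists N => // n /HN un; rewrite /= (ltW un) leNgt un.
  apply: cvg_EFin; first by near=> n.
  apply: cvgMr; rewrite /comp /atom; apply: cvgMr; apply: cvgMr.
  apply: cvg_near_cst; near=> n; rewrite !indicE; congr (nat_of_bool _)%:R.
  have [ha _] : (a_ n <= x) = (a <= x) /\ (x <= a_ n) = (x <= a) by near: n; exact: near_le.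
  have [_ hb] : (b_ n <= x) = (b <= x) /\ (x <= b_ n) = (x <= b) by near: n; exact: near_le.
  by rewrite !mem_setE !in_itv/= ha hb.
- exact: integrable_norm hi.
- apply: ae01_in => x _ n _ /=; rewrite lee_fin normrM.
  by rewrite -[leRHS]mulr1 ler_wpM2l.
have E r1 r2 : (\int[mu]_x (h x * atom s r1 r2 x)%:E = (\int[mu]_x (h x * atom s r1 r2 x)%R)%:E)%E.
  exact: EFin_int (mi r1 r2).
by move: C; rewrite E => C; exact: (fine_cvg C).
Unshelve. all: by end_near. Qed.

End atoms.

(** * Balls of the metric around an atom *)

Section metric_on_atoms.
Context {R : realType} (e : R) (e01 : 0 < e < 1) (d : (R -> R) -> (R -> R) -> R).
Context (hd : metric_on_B e d) (hw : metrizes_weak_star e d).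
Local Notation mu := (@mu01 R).
Local Notation intg f := (mu.-integrable setT (EFin \o f)).
Context (s a0 b0 : R) (s1 : s = 1 \/ s = -1) (ae : e <= a0 <= 1 - e) (be : e <= b0 <= 1 - e)
  (ab : a0 < b0).

Let norms : `|s| = 1. Proof. by case: s1 => ->; rewrite ?normrN normr1. Qed.

Lemma cvg_near_eq (u v : nat -> R) (l l' : R) : u @ \oo --> l' -> l = l' ->
  (\forall n \near \oo, u n = v n) -> v @ \oo --> l.
Proof. by move=> cu -> H; apply: cvg_trans cu; exact: near_eq_cvg. Qed.

Lemma cvg_scale (c l : R) (u : nat -> R) : u @ \oo --> l -> (fun n => c * u n) @ \oo --> c * l.
Proof. by move=> cu; apply: cvgM => //; exact: cvg_cst. Qed.

Lemma harmonic_cvg0 (u : nat -> R) (c : R) : (forall n, `|u n - c| <= n.+1%:R^-1) -> u @ \oo --> c.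
Proof.
move=> H; apply/cvgrPdist_le => r r0.
have := cvg_harmonic (R := R); move/cvgrPdist_le => /(_ r r0); apply: filterS => n.
rewrite /harmonic /= sub0r normrN ger0_norm ?invr_ge0// => h.
by rewrite distrC (le_trans (H n)).
Qed.

(** Metrization is a property of sequences, hence the argument by contradiction: counterexamples
    with endpoints within [1/(n+1)] would converge weakly*, so their distances would tend to 0. *)
Lemma Bball_atom_near (r : R) : 0 < r -> exists2 dl : R, 0 < dl & forall a b,
  e <= a <= 1 - e -> e <= b <= 1 - e -> a < b -> `|a - a0| <= dl -> `|b - b0| <= dl ->
  Bball e d r (atom s a0 b0) (atom s a b).
Proof.
move=> r0; apply: contrapT => H.
have bad n : exists w : R * R, [/\ e <= w.1 <= 1 - e, e <= w.2 <= 1 - e, w.1 < w.2,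
    `|w.1 - a0| <= n.+1%:R^-1 /\ `|w.2 - b0| <= n.+1%:R^-1 & r < d (atom s w.1 w.2) (atom s a0 b0)].
  apply: contrapT => N; apply: H; exists n.+1%:R^-1; first by rewrite invr_gt0.
  move=> a b ae' be' ab' ha hb; split; first exact: Bset_atom.
  by rewrite leNgt; apply/negP => rd; apply: N; exists (a, b).
have [w Hw] := choice bad.
have ca : (fun n => (w n).1) @ \oo --> a0 by apply: harmonic_cvg0 => n; have [_ _ _ []] := Hw n.
have cb : (fun n => (w n).2) @ \oo --> b0 by apply: harmonic_cvg0 => n; have [_ _ _ []] := Hw n.
have B0 := Bset_atom e01 s1 ae be ab.
have Bn n : Bset e (atom s (w n).1 (w n).2) by have [? ? ? _ _] := Hw n; exact: Bset_atom.
have [_ C] := @hw (fun n => atom s (w n).1 (w n).2) (atom s a0 b0) Bn B0.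
have {}C : (fun n => d (atom s (w n).1 (w n).2) (atom s a0 b0)) @ \oo --> (0 : R).
  apply: C; apply: weak_star_cvg => h.
  have hL : (h : R -> R) \in Lfun mu 1%E by exact: LfunP.
  have hi : intg (h : R -> R) by exact: (Lfun1_integrable _ _).1 hL.
  have X := int_atom_cvg norms hi ca cb.
  exact: X.
move/cvgrPdist_lt : C => /(_ r r0)[N _ /(_ N (leqnn N))]; rewrite sub0r normrN.
have [_ _ _ _ rd] := Hw N.
by move=> /(le_lt_trans (ler_norm _)); rewrite ltNge (ltW rd).
Qed.

(** Two moments recover the endpoints: pairing with 1 gives [b - a], pairing with [2 x] gives
    [b^2 - a^2], and the quotient gives [a + b]. *)
Lemma Bball_atom_inv (dl : R) : 0 < dl -> exists2 r : R, 0 < r & forall a b,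
  Bball e d r (atom s a0 b0) (atom s a b) ->
  [/\ e <= a <= 1 - e, e <= b <= 1 - e, a < b, `|a - a0| <= dl & `|b - b0| <= dl].
Proof.
move=> dl0; apply: contrapT => H.
have e1 : 0 < e by case/andP: e01.
have bad n : exists w : R * R, [/\ Bset e (atom s w.1 w.2), d (atom s w.1 w.2) (atom s a0 b0) <= n.+1%:R^-1 &
    ~ [/\ e <= w.1 <= 1 - e, e <= w.2 <= 1 - e, w.1 < w.2, `|w.1 - a0| <= dl & `|w.2 - b0| <= dl]].
  apply: contrapT => N; apply: H; exists n.+1%:R^-1; first by rewrite invr_gt0.
  move=> a b [Ba da]; apply: contrapT => M; apply: N; exists (a, b); split => //.
have [w Hw] := choice bad.
have B0 := Bset_atom e01 s1 ae be ab.
have Bn n : Bset e (atom s (w n).1 (w n).2) by have [] := Hw n.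
have [C _] := @hw (fun n => atom s (w n).1 (w n).2) (atom s a0 b0) Bn B0.
have {}C : (fun n => atom s (w n).1 (w n).2 : weak_star R) @ \oo --> (atom s a0 b0 : weak_star R).
  apply: C; apply: harmonic_cvg0 => n; have [Bw dw _] := Hw n; rewrite subr0 ger0_norm//.
  by have [d0 _ _ _] := hd; exact: d0.
have P (h H0 : R -> R) : (forall x : R, is_derive x 1 H0 (h x)) -> continuous h ->
    \int[mu]_x (h x * atom s (w n).1 (w n).2 x) @[n --> \oo] --> (1 / 2 * s * (H0 b0 - H0 a0)).
  move=> dH ch; rewrite -(int_atom e01 s ae be (ltW ab) dH ch).
  exact: weak_star_cvg_pairing C (continuous_intg ch).
have P1 := P _ _ deriv_id (@continuous_cst R 1).
have dsq (x : R) : is_derive x 1 (fun y => y * y) (2 * x).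
  by have := deriv_mul (deriv_id x) (deriv_id x); rewrite mul1r mulr1 => D; apply: is_derive_eq D _; ring.
have P2 := P _ _ dsq (is_derive_continuous (fun x => deriv_scale 2 (deriv_id x))).
(* The limit of the pairings with 1 is nonzero, so eventually the atoms are nonzero and
   [Bset_atom_itv] applies. *)
have inI : \forall n \near \oo, [/\ e <= (w n).1 <= 1 - e, e <= (w n).2 <= 1 - e & (w n).1 < (w n).2].
  have ne' : 1 / 2 * s * (b0 - a0) != 0.
    by have ab' := ab; apply/eqP => E; case: s1 => s1'; move: E; rewrite s1'; lra.
  have N0 : \forall n \near \oo, \int[mu]_x (1 * atom s (w n).1 (w n).2 x) != 0.
    exact: (cvgr_neq0 _ P1 ne').
  apply: filterS N0 => n nz.
  have mm : Num.max (w n).1 0 < Num.min (w n).2 1.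
    rewrite ltNge; apply/negP => mm; move/negP: nz; apply; apply/eqP.
    rewrite -int0; apply: ae_int; [|exact: measurable_cst|].
      by apply: measurable_funM => //; exact: Loo_measurable (atom_Loo _ _ _).
    have H01 := @ae01_in R (fun x => 0 < x < 1) (fun x x01 => x01).
    apply: ae01S2 H01 (ae01_neq (Num.max (w n).1 0)) => x /andP[x0 x1] xr _.
    rewrite /atom indicE; case: (boolP (x \in _)) => [|_]; last by rewrite !mulr0.
    rewrite inE/= in_itv/= => /andP[h1 h2]; exfalso; apply: xr; apply/eqP.
    rewrite eq_le ge_max h1 (ltW x0) !andbT; apply: le_trans mm.
    by rewrite le_min h2 (ltW x1).
  have [h1 h2] := Bset_atom_itv e01 s1 (Bn n) mm.
  move: mm; rewrite lt_min !gt_max => /andP[/andP[h3 h4] /andP[h5 _]].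
  by split => //; apply/andP; split => //; lra.
have Q (h H0 : R -> R) : (forall x : R, is_derive x 1 H0 (h x)) -> continuous h ->
    (fun n => H0 (w n).2 - H0 (w n).1 : R) @ \oo --> (H0 b0 - H0 a0 : R).
  move=> dH ch.
  have X := cvg_scale (c := 2 * s) (P h H0 dH ch).
  apply: (cvg_near_eq X).
    by case: s1 => ->; field.
  case: inI => N _ HN; exists N => // n /HN[h1 h2 h3] /=.
  by rewrite (int_atom e01 s h1 h2 (ltW h3) dH ch); case: s1 => ->; field.
have Q1 := Q _ _ (@deriv_id R) (@continuous_cst R 1).
have Q2 := Q _ _ dsq (is_derive_continuous (fun x => deriv_scale 2 (deriv_id x))).
have ba : b0 - a0 != 0 by rewrite subr_eq0 gt_eqF.
have S : (w n).2 + (w n).1 @[n --> \oo] --> b0 + a0.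
  apply: (cvg_near_eq (cvgM Q2 (cvgV ba Q1))); first by field.
  case: inI => N _ HN; exists N => // n /HN[h1 h2 h3] /=.
  by field; rewrite subr_eq0 gt_eqF.
have Ca : (w n).1 @[n --> \oo] --> a0.
  apply: (cvg_near_eq (cvg_scale (c := 2^-1) (cvgB S Q1))); first by field.
  near=> n; transitivity (2^-1 * (((w n).2 + (w n).1) - ((w n).2 - (w n).1))); first by [].
  by field.
have Cb : (w n).2 @[n --> \oo] --> b0.
  apply: (cvg_near_eq (cvg_scale (c := 2^-1) (cvgD S Q1))); first by field.
  near=> n; transitivity (2^-1 * (((w n).2 + (w n).1) + ((w n).2 - (w n).1))); first by [].
  by field.
move/cvgrPdist_le : Ca => /(_ dl dl0) Ca; move/cvgrPdist_le : Cb => /(_ dl dl0) Cb.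
have [n [[h1 h2 h3] h4 h5]] : exists n, [/\ [/\ e <= (w n).1 <= 1 - e, e <= (w n).2 <= 1 - e & (w n).1 < (w n).2],
    `|a0 - (w n).1| <= dl & `|b0 - (w n).2| <= dl].
  case: inI Ca Cb => [N1 _ H1] [N2 _ H2] [N3 _ H3].
  exists (maxn N1 (maxn N2 N3)); split.
  - by apply: H1; rewrite /= leq_maxl.
  - by apply: H2; rewrite /= (leq_trans (leq_maxl N2 N3))// leq_maxr.
  - by apply: H3; rewrite /= (leq_trans (leq_maxr N2 N3))// leq_maxr.
have [_ _] := Hw n; apply; split => //; by rewrite distrC.
Unshelve. all: by end_near. Qed.

End metric_on_atoms.

(** * Perturbation of the minimal-norm certificate *)

Section real_lemmas.
Context {R : realType}.
Implicit Types (F f : R -> R).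

Lemma taylor_lip F f (M x y : R) : (forall z : R, is_derive z 1 F (f z)) -> 0 <= M ->
  (forall u v, `|f u - f v| <= M * `|u - v|) ->
  `|F y - F x - f x * (y - x)| <= M * (y - x) ^+ 2.
Proof.
move=> dF M0 fM; have [xy|/ltW yx] := leP x y.
  have [c /andP[xc cy] ->] := mean_value dF xy.
  rewrite -mulrBl normrM (ger0_norm (_ : 0 <= y - x)) ?subr_ge0// expr2 mulrA.
  rewrite ler_wpM2r ?subr_ge0//; apply: (le_trans (fM _ _)).
  by rewrite ger0_norm ?subr_ge0// ler_wpM2l// lerD2r.
have [c /andP[yc cx] E] := mean_value dF yx.
have -> : F y - F x - f x * (y - x) = (f x - f c) * (x - y) by rewrite mulrBl -E; ring.
rewrite normrM (ger0_norm (_ : 0 <= x - y)) ?subr_ge0//.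
have -> : (y - x) ^+ 2 = (x - y) * (x - y) by ring.
rewrite mulrA ler_wpM2r ?subr_ge0//; apply: (le_trans (fM _ _)).
by rewrite ger0_norm ?subr_ge0// ler_wpM2l// lerD2l lerN2.
Qed.

(** The mean value theorem applied to [F z - ka/2 z^2], whose derivative is nondecreasing on the
    window. *)
Lemma strong_convex F f (ka lo hi x y : R) : (forall z : R, is_derive z 1 F (f z)) ->
  (forall u v, lo <= u -> u <= v -> v <= hi -> ka * (v - u) <= f v - f u) ->
  lo <= x <= hi -> lo <= y <= hi ->
  f x * (y - x) + ka / 2 * (y - x) ^+ 2 <= F y - F x.
Proof.
move=> dF fm /andP[x1 x2] /andP[y1 y2].
have dG (z : R) : is_derive z 1 (fun z => F z - ka / 2 * (z * z)) (f z - ka * z).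
  have := deriv_sub (dF z) (deriv_scale (ka / 2) (deriv_mul (deriv_id z) (deriv_id z))).
  by move=> H; apply: is_derive_eq H _; field.
have [xy|/ltW yx] := leP x y.
  have [c /andP[xc cy] E] := mean_value dG xy.
  have := fm x c x1 xc (le_trans cy y2) => H.
  have : (f x - ka * x) * (y - x) <= (f c - ka * c) * (y - x).
    by rewrite ler_wpM2r ?subr_ge0//; lra.
  by rewrite -E expr2; lra.
have [c /andP[yc cx] E] := mean_value dG yx.
have := fm c x (le_trans y1 yc) cx x2 => H.
have : (f c - ka * c) * (x - y) <= (f x - ka * x) * (x - y).
  by rewrite ler_wpM2r ?subr_ge0//; lra.
by rewrite -E expr2; lra.
Qed.

(** A loss of order [t^2] is allowed because minimality over the box controls the peaks only up to
    such a term; it is invisible at first order. *)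
Lemma first_order F f (M K x h : R) : (forall z : R, is_derive z 1 F (f z)) -> 0 <= M -> 0 <= K ->
  (forall u v, `|f u - f v| <= M * `|u - v|) ->
  (forall t, 0 <= t <= 1 -> - K * t ^+ 2 <= F (x + t * h) - F x) ->
  0 <= f x * h.
Proof.
move=> dF M0 K0 fM H; rewrite leNgt; apply/negP => fh.
pose N := K + M * h ^+ 2 + 1.
have N0 : 0 < N by rewrite ltr_wpDl// addr_ge0// mulr_ge0// sqr_ge0.
pose t := Num.min 1 (- (f x * h) / (2 * N)).
have fh0 : 0 < - (f x * h) by rewrite oppr_gt0.
have t0 : 0 < t by rewrite lt_min ltr01 divr_gt0// mulr_gt0.
have t1 : t <= 1 by rewrite ge_min lexx.
have tN : t * (2 * N) <= - (f x * h) by rewrite -ler_pdivlMr ?mulr_gt0// ge_min lexx orbT.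
have := H t; rewrite (ltW t0) t1 => /(_ isT) H1.
have := taylor_lip x (x + t * h) dF M0 fM.
have -> : x + t * h - x = t * h by ring.
rewrite ler_norml => /andP[_ H2].
have H3 : - K * t ^+ 2 <= t * (f x * h) + M * (t * h) ^+ 2 by lra.
have H4 : t * (t * (2 * N)) <= t * - (f x * h) by rewrite ler_wpM2l// ltW.
have H5 : 0 < t * t by rewrite mulr_gt0.
have H6 : 0 <= t * t * (K + M * h ^+ 2) by rewrite mulr_ge0 ?(ltW H5)// addr_ge0// mulr_ge0// sqr_ge0.
move: H3 H4 H5 H6; rewrite /N !expr2; lra.
Qed.

(* A common positive bound for finitely many constraints that get weaker as the bound shrinks. *)
Lemma fin_pos_bound (I : finType) (P : I -> R -> Prop) :
  (forall i, exists2 d : R, 0 < d & forall d' : R, 0 < d' -> d' <= d -> P i d') ->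
  exists2 d : R, 0 < d & forall i (d' : R), 0 < d' -> d' <= d -> P i d'.
Proof.
move=> H; have ex i : exists d : R, 0 < d /\ forall d' : R, 0 < d' -> d' <= d -> P i d'.
  by have [d d0 Hd] := H i; exists d.
have [g Hg] := choice ex.
suff [d d0 Hd] : exists2 d : R, 0 < d & forall i, i \in enum I -> d <= g i.
  exists d => // i d' d'0 dd; apply: (Hg i).2 => //; apply: (le_trans dd); apply: Hd.
  by rewrite mem_enum.
elim: (enum I) => [|i r [d d0 Hd]]; first by exists 1.
exists (Num.min d (g i)); first by rewrite lt_min d0 (Hg i).1.
move=> j; rewrite inE => /predU1P[->|/Hd]; first by rewrite ge_min lexx orbT.
by rewrite ge_min => ->.
Qed.

End real_lemmas.

Lemma farkas_fin (R : realFieldType) (W : lmodType R) (I : finType) (al : I -> W -> R) (ga : W -> R) :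
  (forall i c x y, al i (c *: x + y) = c * al i x + al i y) ->
  (forall c x y, ga (c *: x + y) = c * ga x + ga y) ->
  (forall x, (forall i, al i x <= 0) -> ga x <= 0) ->
  exists2 u : I -> R, (forall i, 0 <= u i) &
    forall x, ga x = \sum_i u i * al i x.
Proof.
move=> lal lga H.
have [i|//|x Hx|u u0 Eu] := @farkas R W #|I| (fun i => al (enum_val i)) ga.
- by move=> c x y; exact: lal.
- by apply: H => i; rewrite -(enum_rankK i); exact: Hx.
exists (fun i => u (enum_rank i)) => // x.
rewrite Eu (reindex (@enum_rank I)) /=; last first.
  by apply: onW_bij; exact: enum_rank_bij.
by apply: eq_bigr => i _; rewrite enum_rankK.
Qed.

Section biorthogonal.
Context {R : realType} (W : lmodType R) (n : nat) (al : 'I_n -> W -> R).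
Context (lal : forall i c x y, al i (c *: x + y) = c * al i x + al i y)
  (free : forall be : 'I_n -> R, (forall x, \sum_i be i * al i x = 0) -> forall i, be i = 0).

(** If every vector annihilated by the forms other than [j] had nonpositive value under form [j],
    Farkas' lemma for these forms and their opposites would write form [j] as a combination of the
    others. Index [j] keeps its slot in the family with the zero form. *)
Lemma biorthogonal : exists q : 'I_n -> W, forall i j, al i (q j) = (i == j)%:R.
Proof.
suff ex j : exists q, forall i, al i q = (i == j)%:R.
  by have [q Hq] := choice ex; exists q => i j; exact: Hq.
have [x [x0 xj]] : exists x, (forall i, i != j -> al i x = 0) /\ 0 < al j x.
  apply: contrapT => H.
  have [||x Hx|u u0 Eu] := @farkas_fin R W ('I_n * bool)%type
    (fun ib x => if ib.1 == j then 0 else (-1) ^+ ib.2 * al ib.1 x) (al j).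
  - by move=> [i b] c x y /=; case: ifP => _; rewrite ?lal; ring.
  - by move=> c x y; rewrite lal.
  - rewrite leNgt; apply/negP => ax; apply: H; exists x; split => // i ij.
    have := Hx (i, true); have := Hx (i, false); rewrite /= (negbTE ij) expr0 expr1 => h1 h2.
    by apply/eqP; rewrite eq_le; apply/andP; split; lra.
  pose be i := if i == j then 1 else u (i, true) - u (i, false).
  have bej : be j = 0.
    apply: free => x; rewrite (bigD1 j)//= /be eqxx mul1r Eu.
    rewrite [X in X + _](_ : _ = \sum_(i < n) \sum_(b : bool) u (i, b) * (if i == j then 0 else (-1) ^+ b * al i x)); last first.
      by rewrite pair_bigA; apply: eq_bigr => -[i b].
    rewrite [X in X + _](bigD1 j)//= big_bool/= eqxx !mulr0 addr0 add0r -big_split/= big1// => i ij.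
    by rewrite big_bool/= (negbTE ij) expr0 expr1; ring.
  by move: bej; rewrite /be eqxx => /eqP; rewrite oner_eq0.
exists ((al j x)^-1 *: x) => i.
have aZ c y : al i (c *: y) = c * al i y.
  have a0 : al i 0 = 0 by have := lal i 1 0 0; rewrite scaler0 addr0; lra.
  by rewrite -[in LHS](addr0 (_ *: _)) lal a0 addr0.
rewrite aZ; have [->|ij] := eqVneq i j; first by rewrite mulVf ?gt_eqF.
by rewrite (x0 i ij) mulr0.
Qed.

End biorthogonal.

(** * Minimisation over boxes, and the norm by duality *)

Section optimization.
Context {R : realType}.
Implicit Types (F f r : R -> R).

Lemma box_min (I : finType) (lo hi : I -> R) (J : (I -> R) -> R) (C : R) :
  (forall i, lo i <= hi i) ->
  (forall v w, (forall i, lo i <= v i <= hi i) -> (forall i, lo i <= w i <= hi i) ->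
     `|J v - J w| <= C * \sum_i `|v i - w i|) ->
  exists2 v, (forall i, lo i <= v i <= hi i) & forall w, (forall i, lo i <= w i <= hi i) -> J v <= J w.
Proof.
move=> lohi HJ.
pose A : set (prod_topology (fun _ : I => R)) := [set f | forall i, `[lo i, hi i]%classic (f i)].
have cA : compact A by apply: (@tychonoff I (fun=> R) (fun i => `[lo i, hi i]%classic)) => i; exact: segment_compact.
have AE v : A v <-> forall i, lo i <= v i <= hi i.
  by split=> H i; have := H i; rewrite /= in_itv.
have [||v vA Hv] := @compact_EVT_min (prod_topology (fun _ : I => R)) R J A _ cA; last first.
- move: vA => /set_mem/AE vA; exists v => // w Hw; apply: Hv; apply/mem_set/AE; exact: Hw.
- apply/subspace_continuousP => v /AE vA; apply/cvgrPdist_le => ep ep0.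
  pose C' := `|C| + 1; have C'0 : 0 < C' by rewrite ltr_wpDl.
  pose D := C' * (#|I|%:R + 1); have D0 : 0 < D by rewrite mulr_gt0// ltr_wpDl.
  have H : \forall w \near nbhs (v : prod_topology (fun _ : I => R)), forall i, `|v i - w i| <= ep / D.
    apply: filter_forall => i.
    have pc : (fun w : prod_topology (fun _ : I => R) => w i : R) @ nbhs (v : prod_topology (fun _ : I => R)) --> (v i : R).
      exact: (@proj_continuous I (fun=> R) i v).
    move: pc => /cvgrPdist_le; apply.
    by rewrite divr_gt0.
  have key : [set w : prod_topology (fun _ : I => R) | forall i, `|v i - w i| <= ep / D] `<=`
      [set w : prod_topology (fun _ : I => R) | A w -> `|J v - J w| <= ep].
  move=> w Hw /AE wA.
  apply: (le_trans (HJ _ _ vA wA)).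
  have S0 : 0 <= \sum_i `|v i - w i| by apply: sumr_ge0.
  apply: (@le_trans _ _ (C' * \sum_i `|v i - w i|)).
    by rewrite ler_wpM2r//; apply: (le_trans (ler_norm C)); rewrite /C' lerDl.
  have S1 : \sum_i `|v i - w i| <= \sum_(i : I) ep / D by apply: ler_sum.
  rewrite sumr_const -mulr_natl in S1.
  have E : C' * ((#|I|%:R + 1) * (ep / D)) = ep.
    have N0 : 0 < #|I|%:R + 1 :> R by rewrite ltr_wpDl.
    by rewrite /D; move: N0; set N := _ + 1 => N0; field; rewrite !lt0r_neq0.
  rewrite -[leRHS]E ler_wpM2l ?(ltW C'0)//; apply: (le_trans S1).
  by rewrite mulrDl mul1r lerDl divr_ge0// ltW.
  exact: (@filterS _ _ (nbhs_filter (v : prod_topology (fun _ : I => R))) _ _ key H).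
- by exists (lo : prod_topology (fun _ : I => R)); apply/AE => i; rewrite lexx lohi.
Qed.

(** Testing with [r] suffices when its norm is positive. If the norm is 0 the claim is that [C] is
    nonnegative, which comes from testing with the constant 1. *)
Lemma norm2_le_dual r (C : R) : r \in Lfun (@mu01 R) 2%:E ->
  (forall q, q \in Lfun (@mu01 R) 2%:E -> inner2 q r <= C * norm2 q) -> norm2 r <= C.
Proof.
move=> rL H; have := H r rL; rewrite -norm2_sqr//.
have : 0 <= norm2 r by exact: norm2_ge0.
rewrite le_eqVlt => /predU1P[r0|r0]; last by rewrite expr2 ler_pM2r.
rewrite -r0 => _; rewrite leNgt; apply/negP => C0.
have cL : cst 1 \in Lfun (@mu01 R) 2%:E by apply: Loo_L2; apply: (@Loo_bounded _ _ 1) => // x; rewrite normr1.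
have := H _ cL; have := cauchy_schwarz _ _ cL rL; rewrite -r0 mulr0 normr_le0 => /eqP ->.
have : 0 < norm2 (cst 1 : R -> R).
  rewrite lt_neqAle norm2_ge0 andbT eq_sym -sqrf_eq0 norm2_sqr// /inner2.
  under eq_Rintegral do rewrite mulr1.
  by rewrite Rintegral_cst// mu01_setT mulr1 oner_eq0.
by move=> n0; rewrite leNgt pmulr_llt0// C0.
Qed.

End optimization.

(** * Peaks of certificates close to the minimal-norm one *)

Section certificate.
Context {R : realType} (e : R) (k kt : R -> R) (L B : R).
Context (e01 : 0 < e < 1) (ktk : forall x : R, -1 <= x <= 1 -> kt x = k x)
  (L0 : 0 <= L) (B0 : 0 <= B)
  (ktL : forall x y, `|kt x - kt y| <= L * `|x - y|) (ktB : forall x, `|kt x| <= B).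
Context (n : nat) (c0 sg a0 b0 : 'I_n -> R).
Context (hc0 : forall i, 0 < c0 i) (hsg : forall i, sg i = 1 \/ sg i = -1)
  (ha0 : forall i, e <= a0 i <= 1 - e) (hb0 : forall i, e <= b0 i <= 1 - e)
  (hab0 : forall i, a0 i < b0 i).
Local Notation mu := (@mu01 R).
Local Notation L2 := (Lfun mu 2%:E).
Local Notation Loo := (Lfun mu +oo%E).
Local Notation eta := (eta_of kt).
Local Notation H := (Hof kt).
Local Notation "'I01' x" := (e <= x <= 1 - e) (at level 8).
Implicit Types f g h p q u v : R -> R.
Implicit Types (i j : 'I_n) (a b c : 'I_n -> R).

Let eta_cont p (pL : p \in L2) : continuous (eta p) := eta_of_cont L0 ktL ktB pL.
Let dH p (pL : p \in L2) := Hof_deriv L0 ktL ktB pL.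
Let Hlip p x y (pL : p \in L2) := Hof_lip L0 ktL ktB x y pL.
Let elip p x y (pL : p \in L2) := eta_of_lip L0 ktL ktB x y pL.

Let sgn i : `|sg i| = 1. Proof. by case: (hsg i) => ->; rewrite ?normrN1 ?normr1. Qed.
Lemma I01_abs (x y : R) : I01 x -> I01 y -> `|x - y| <= 1.
Proof. by move: e01 => e01' h1 h2; rewrite ler_norml; lra. Qed.

(* [1/2 sg i] times the integral of [K_* q] over [x, y]. *)
Definition peak q i (x y : R) : R := 1 / 2 * sg i * (H q y - H q x).

Lemma seg_lip q s (x y x' y' : R) : q \in L2 -> `|s| = 1 ->
  `|1 / 2 * s * (H q y - H q x) - 1 / 2 * s * (H q y' - H q x')| <=
  B / 2 * norm2 q * (`|x - x'| + `|y - y'|).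
Proof.
move=> qL s1.
have -> : 1 / 2 * s * (H q y - H q x) - 1 / 2 * s * (H q y' - H q x') =
   s * (2^-1 * ((H q y - H q y') - (H q x - H q x'))) by field.
rewrite !normrM s1 mul1r (ger0_norm (_ : 0 <= 2^-1))//.
apply: (@le_trans _ _ (2^-1 * (`|H q y - H q y'| + `|H q x - H q x'|))).
  by rewrite ler_wpM2l// ler_normB.
by have := Hlip y' y qL; have := Hlip x' x qL; lra.
Qed.

Lemma peak_lip q i (x y x' y' : R) : q \in L2 ->
  `|peak q i x y - peak q i x' y'| <= B / 2 * norm2 q * (`|x - x'| + `|y - y'|).
Proof. by move=> qL; apply: seg_lip. Qed.

Lemma peak_bound q i (x y : R) : q \in L2 -> I01 x -> I01 y -> `|peak q i x y| <= B / 2 * norm2 q.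
Proof.
move=> qL xe ye; have := peak_lip i x y x x qL.
rewrite {2}/peak subrr mulr0 subr0 subrr normr0 add0r => h; apply: (le_trans h).
by rewrite -[leRHS]mulr1 ler_wpM2l ?I01_abs// mulr_ge0 ?norm2_ge0 ?divr_ge0.
Qed.

Lemma peakZD q q' t i (x y : R) : q \in L2 -> q' \in L2 ->
  peak (fun s => t * q s + q' s) i x y = t * peak q i x y + peak q' i x y.
Proof.
move=> qL q'L; rewrite /peak (HofD L0 ktL ktB)//; last exact: L2Z.
by rewrite (HofZ L0 ktL ktB)//; ring.
Qed.

Lemma osc2_peaks T (N : R) :
  (forall s x y, s = 1 \/ s = -1 -> I01 x -> I01 y -> x <= y -> 1 / 2 * s * (T y - T x) <= N) ->
  forall x y : R, I01 x -> I01 y -> T x - T y <= 2 * N.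
Proof.
move=> h x y xe ye; have [xy|/ltW yx] := leP x y.
  by have := h (-1) x y (or_intror erefl) xe ye xy; lra.
by have := h 1 y x (or_introl erefl) ye xe yx; lra.
Qed.

Definition Kstep c a b := Kop k (step_comb c sg a b).

Definition ordered a b := forall i, [/\ I01 (a i), I01 (b i) & a i <= b i].

Lemma Kstep_L2 c a b : Kstep c a b \in L2.
Proof. by apply: (Kop_L2 ktk L0 B0 ktL ktB); apply: Loo_L2; exact: step_Loo. Qed.

Lemma int_eta_step q c a b : q \in L2 -> ordered a b ->
  \int[mu]_x (eta q x * step_comb c sg a b x) = \sum_i c i * peak q i (a i) (b i).
Proof.
move=> qL ab; rewrite int_step; last exact: eta_cont.
apply: eq_bigr => i _; have [ai bi abi] := ab i.
by rewrite (int_indic_deriv e01 ai bi abi (dH qL) (eta_cont qL)).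
Qed.

Lemma inner2_Kstep q c a b : q \in L2 -> ordered a b ->
  inner2 q (Kstep c a b) = \sum_i c i * peak q i (a i) (b i).
Proof.
move=> qL ab; rewrite (inner2_Kop ktk L0 ktL ktB) ?int_eta_step//.
by apply: Loo_L2; exact: step_Loo.
Qed.

Lemma KstepE c a b : Kstep c a b = Kop k (step_comb c sg a b).
Proof. by []. Qed.

(* Otherwise failed unifications unfold the integrals in [Kop]. *)
Opaque Kstep.

(** Pairing with [q] turns [Kstep] into a sum of peak values, which are bounded and Lipschitz in the
    endpoints with constant [B / 2 * norm2 q]. *)
Lemma norm2_Kstep_diff c a b c' a' b' : ordered a b -> ordered a' b' ->
  norm2 (fun t => Kstep c a b t - Kstep c' a' b' t) <=
  B / 2 * \sum_i (`|c i - c' i| + `|c' i| * (`|a i - a' i| + `|b i - b' i|)).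
Proof.
move=> ab ab'; apply: norm2_le_dual; first exact: (L2B _ _ (Kstep_L2 _ _ _) (Kstep_L2 _ _ _)).
move=> q qL; rewrite inner2Br ?Kstep_L2// !inner2_Kstep// -sumrB [leRHS]mulrAC mulr_sumr.
apply: ler_sum => i _; have [ai bi abi] := ab i.
have -> : c i * peak q i (a i) (b i) - c' i * peak q i (a' i) (b' i) =
  (c i - c' i) * peak q i (a i) (b i) + c' i * (peak q i (a i) (b i) - peak q i (a' i) (b' i)) by ring.
apply: (le_trans (ler_norm _)); apply: (le_trans (ler_normD _ _)); rewrite (normrM (c i - c' i)) (normrM (c' i)) mulrDr.
apply: lerD.
  by rewrite mulrC ler_wpM2r ?peak_bound.
rewrite mulrCA ler_wpM2l//; exact: peak_lip.
Qed.

Context (p0 : R -> R) (p0L : p0 \in L2) (p0o : osc2 e kt p0).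
Context (peak0 : forall i, peak p0 i (a0 i) (b0 i) = 1).
Context (p0_min : forall q, q \in L2 -> osc2 e kt q ->
  (forall i, peak q i (a0 i) (b0 i) = 1) -> norm2 p0 <= norm2 q).
Context (ka dl1 : R) (ka0 : 0 < ka) (dl10 : 0 < dl1).
Context (mona : forall i (x y : R), `|x - a0 i| <= dl1 -> `|y - a0 i| <= dl1 -> x <= y ->
  ka * (y - x) <= sg i * (eta p0 y - eta p0 x)).
Context (monb : forall i (x y : R), `|x - b0 i| <= dl1 -> `|y - b0 i| <= dl1 -> x <= y ->
  ka * (y - x) <= - sg i * (eta p0 y - eta p0 x)).
Context (peaks : forall (s x y : R), s = 1 \/ s = -1 -> I01 x -> I01 y -> x < y ->
  1 / 2 * s * (H p0 y - H p0 x) = 1 -> exists i, [/\ s = sg i, x = a0 i & y = b0 i]).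
Context (bq : 'I_n -> R -> R) (bqL : forall j, bq j \in L2)
  (bqE : forall i j, H (bq j) (b0 i) - H (bq j) (a0 i) = (i == j)%:R).

Let ordered0 : ordered a0 b0. Proof. by move=> i; split; rewrite ?(ltW (hab0 i)). Qed.

Lemma peak_le p i (x y : R) : osc2 e kt p -> I01 x -> I01 y -> peak p i x y <= 1.
Proof.
move=> po xe ye; rewrite /peak; have := po _ _ xe ye; have := po _ _ ye xe.
by case: (hsg i) => ->; lra.
Qed.

Lemma maxr0_lip (x y : R) : `|Num.max 0 x - Num.max 0 y| <= `|x - y|.
Proof.
have := ler_norm (x - y); have := ler_norm (y - x); rewrite (distrC y) ler_norml.
by case: (leP 0 x) => ?; case: (leP 0 y) => ?; lra.
Qed.

Definition gap (dl rho : R) := forall s x y : R, s = 1 \/ s = -1 -> I01 x -> I01 y -> x <= y ->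
  (exists i, [/\ s = sg i, `|x - a0 i| <= dl & `|y - b0 i| <= dl]) \/
  1 / 2 * s * (H p0 y - H p0 x) <= 1 - rho.

(** For each sign, [rho] is the minimum over a square of [W]: the defect of the height, plus bumps
    around the given endpoint pairs, plus a penalty for reversed order. [W] is positive since height
    1 is attained, in increasing order, only at those pairs; it reduces to the defect away from
    them. *)
Lemma gap_exists (dl : R) : 0 < dl -> exists2 rho : R, 0 < rho & gap dl rho.
Proof.
move=> dl0; have [ee|ee] := leP e (1 - e); last first.
  by exists 1 => // s x y _ xe; move: xe ee; lra.
suff key s : s = 1 \/ s = -1 -> exists2 rho : R, 0 < rho & forall x y, I01 x -> I01 y -> x <= y ->
  (exists i, [/\ s = sg i, `|x - a0 i| <= dl & `|y - b0 i| <= dl]) \/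
  1 / 2 * s * (H p0 y - H p0 x) <= 1 - rho.
  have [r1 r10 h1] := key 1 (or_introl erefl); have [r2 r20 h2] := key (-1) (or_intror erefl).
  exists (Num.min r1 r2); first by rewrite lt_min r10.
  have m1 : Num.min r1 r2 <= r1 by rewrite ge_min lexx.
  have m2 : Num.min r1 r2 <= r2 by rewrite ge_min lexx orbT.
  move=> s x y [->|->] xe ye xy.
    by have [|h] := h1 x y xe ye xy; [left|right; lra].
  by have [|h] := h2 x y xe ye xy; [left|right; lra].
move=> s1; have sn : `|s| = 1 by case: s1 => ->; rewrite ?normrN1 ?normr1.
pose W (v : bool -> R) : R := 1 - 1 / 2 * s * (H p0 (v true) - H p0 (v false)) +
  \sum_(i | s == sg i) Num.max 0 (dl - (`|v false - a0 i| + `|v true - b0 i|)) +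
  Num.max 0 (v false - v true).
have [||v vI Hv] := @box_min _ bool (fun=> e) (fun=> 1 - e) W (B / 2 * norm2 p0 + n%:R + 1).
- by [].
- move=> v w _ _; rewrite big_bool /=.
  set dx := `|v false - w false|; set dy := `|v true - w true|.
  have h1 := seg_lip (v false) (v true) (w false) (w true) p0L sn.
  have h2 := maxr0_lip (v false - v true) (w false - w true).
  have h3 : `|v false - v true - (w false - w true)| <= dx + dy.
    by rewrite (_ : _ - _ = (v false - w false) - (v true - w true)); [exact: ler_normB|ring].
  have h4 : `|\sum_(i | s == sg i) Num.max 0 (dl - (`|v false - a0 i| + `|v true - b0 i|)) -
      \sum_(i | s == sg i) Num.max 0 (dl - (`|w false - a0 i| + `|w true - b0 i|))| <= n%:R * (dx + dy).
    rewrite -sumrB; apply: (le_trans (ler_norm_sum _ _ _)).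
    apply: (@le_trans _ _ (\sum_(i < n) (dx + dy))); last by rewrite sumr_const card_ord mulr_natl.
    rewrite [leRHS](bigID (fun i => s == sg i))/= -[leLHS]addr0; apply: lerD.
      apply: ler_sum => i _; apply: (le_trans (maxr0_lip _ _)).
      have g1 := ler_dist_dist (v false - a0 i) (w false - a0 i).
      have g2 := ler_dist_dist (v true - b0 i) (w true - b0 i).
      move: g1 g2; rewrite !opprB !addrA !subrK -/dx -/dy.
      by rewrite !ler_norml; lra.
    by apply: sumr_ge0 => i _; apply: addr_ge0; exact: normr_ge0.
  move: h1 h2 h4; rewrite -/dx -/dy /W.
  set P1 := 1 / 2 * s * _; set P2 := 1 / 2 * s * _; set S1 := \sum_(i | _) _; set S2 := \sum_(i | _) _.
  set M1 := Num.max 0 _; set M2 := Num.max 0 _.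
  have -> : 1 - P1 + S1 + M1 - (1 - P2 + S2 + M2) = (S1 - S2) + (M1 - M2) - (P1 - P2) by ring.
  move=> h1 h2 h4; apply: (le_trans (ler_normB _ _)).
  by have := ler_normD (S1 - S2) (M1 - M2); lra.
have W0 : 0 < W v.
  have S0 : 0 <= \sum_(i | s == sg i) Num.max 0 (dl - (`|v false - a0 i| + `|v true - b0 i|)).
    by apply: sumr_ge0 => i _; rewrite le_max lexx.
  have M0 : 0 <= Num.max 0 (v false - v true) by rewrite le_max lexx.
  have F1 : 1 / 2 * s * (H p0 (v true) - H p0 (v false)) <= 1.
    have := p0o (vI true) (vI false); have := p0o (vI false) (vI true); move: s1 => [->|->]; lra.
  have [F2|F2] := ltP (1 / 2 * s * (H p0 (v true) - H p0 (v false))) 1; first by rewrite /W; lra.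
  have FE : 1 / 2 * s * (H p0 (v true) - H p0 (v false)) = 1 by apply/le_anti; rewrite F1 F2.
  have [vlt|vgt|veq] := ltgtP (v false) (v true).
  - have [i [si ai bi]] := peaks s1 (vI false) (vI true) vlt FE.
    have : dl <= \sum_(i | s == sg i) Num.max 0 (dl - (`|v false - a0 i| + `|v true - b0 i|)).
      rewrite (bigD1 i) ?si//= ai bi !subrr !normr0 addr0 subr0 (max_idPr (ltW dl0)) lerDl.
      by apply: sumr_ge0 => j _; rewrite le_max lexx.
    by rewrite /W FE; lra.
  - have : v false - v true <= Num.max 0 (v false - v true) by rewrite le_max lexx orbT.
    by rewrite /W FE; lra.
  - by move: FE; rewrite veq subrr mulr0 => /eqP; rewrite eq_sym oner_eq0.
exists (W v) => // x y xe ye xy.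
have [[i [si]]|nex] := pselect (exists i, s = sg i /\ `|x - a0 i| + `|y - b0 i| <= dl).
  move=> h; left; exists i; split => //; apply: (le_trans _ h); first by rewrite lerDl.
  by rewrite lerDr.
right; have := Hv (fun t : bool => if t then y else x) (fun t : bool => if t as t' return I01 (if t' then y else x) then ye else xe).
rewrite {2}/W/= big1 ?addr0; last first.
  move=> i /eqP si; apply/max_idPl; rewrite subr_le0 leNgt; apply/negP => /ltW h.
  by apply: nex; exists i.
rewrite (max_idPl _) ?subr_le0// addr0; lra.
Qed.

(** Away from the given intervals the height of [p0] is at most [1 - rho], and an error [2 * rho] in
    the increments costs [rho] after the factor 1/2. A value [N] above 1 serves perturbations that
    are feasible only up to second order. *)
Lemma osc_glue dl rho F (N : R) : gap dl rho -> 1 <= N ->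
  (forall x y : R, I01 x -> I01 y -> `|(F y - F x) - (H p0 y - H p0 x)| <= 2 * rho) ->
  (forall i (x y : R), I01 x -> I01 y -> `|x - a0 i| <= dl -> `|y - b0 i| <= dl ->
     1 / 2 * sg i * (F y - F x) <= N) ->
  forall x y : R, I01 x -> I01 y -> F x - F y <= 2 * N.
Proof.
move=> gp N1 near0 nearN; apply: osc2_peaks => s x y s1 xe ye xy.
have [[i [-> xa yb]]|h] := gp s x y s1 xe ye xy; first exact: nearN.
have := near0 x y xe ye; rewrite ler_norml => /andP[h1 h2].
by move: h; case: s1 => ->; lra.
Qed.

(** The difference of the two certificates is Lipschitz with constant at most [ka / 2], so half of
    the slope survives. *)
Lemma mono_near p i (x y : R) : p \in L2 -> L * norm2 (fun t => p t - p0 t) <= ka / 2 -> x <= y ->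
  (`|x - a0 i| <= dl1 -> `|y - a0 i| <= dl1 -> ka / 2 * (y - x) <= sg i * (eta p y - eta p x)) /\
  (`|x - b0 i| <= dl1 -> `|y - b0 i| <= dl1 -> ka / 2 * (y - x) <= - sg i * (eta p y - eta p x)).
Proof.
move=> pL pp xy; have dL := L2B _ _ pL p0L.
have := elip y x dL; rewrite !(eta_ofB L0 ktL ktB)// => h.
have {h} : `|eta p y - eta p x - (eta p0 y - eta p0 x)| <= ka / 2 * (y - x).
  rewrite (_ : _ - _ = eta p y - eta p0 y - (eta p x - eta p0 x)); last by ring.
  apply: (le_trans h); rewrite ger0_norm ?subr_ge0// ler_wpM2r// subr_ge0//.
rewrite ler_norml => /andP[h1 h2].
split=> xw yw.
  by have := mona xw yw xy; move: h1 h2; case: (hsg i) => ->; lra.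
by have := monb xw yw xy; move: h1 h2; case: (hsg i) => ->; lra.
Qed.

Let window_abs (c x dl : R) : `|x - c| <= dl -> c - dl <= x <= c + dl.
Proof. by rewrite ler_norml => /andP[h1 h2]; lra. Qed.

Let abs_window (c x y dl : R) : c - dl <= x -> x <= y -> y <= c + dl -> `|x - c| <= dl /\ `|y - c| <= dl.
Proof. by move=> h1 h2 h3; rewrite !ler_norml; split; lra. Qed.

Let sdH p s : p \in L2 -> forall x : R, is_derive x 1 (fun x => s * H p x) (s * eta p x).
Proof. by move=> pL x; exact: deriv_scale (dH pL x). Qed.

Let selip p s : p \in L2 -> `|s| = 1 -> forall x y, `|s * eta p x - s * eta p y| <= L * norm2 p * `|x - y|.
Proof. by move=> pL s1 x y; rewrite -mulrBr normrM s1 mul1r; exact: elip. Qed.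

(** Near a left endpoint [sg i * H] is strongly convex, near a right endpoint [- sg i * H] is; the
    pair [(s, c)] treats both at once. *)
Lemma convex_near p i s (c x y : R) : p \in L2 -> L * norm2 (fun t => p t - p0 t) <= ka / 2 ->
  (s = sg i /\ c = a0 i) \/ (s = - sg i /\ c = b0 i) -> `|x - c| <= dl1 -> `|y - c| <= dl1 ->
  s * eta p x * (y - x) + ka / 4 * (y - x) ^+ 2 <= s * (H p y - H p x).
Proof.
move=> pL pp sc /window_abs xw /window_abs yw.
have := @strong_convex R _ _ (ka / 2) _ _ x y (sdH s pL) _ xw yw.
rewrite -mulrBr (_ : ka / 2 / 2 = ka / 4); last by field.
apply=> u v lu uv vh; rewrite -mulrBr.
have [h1 h2] := abs_window lu uv vh; have [g1 g2] := mono_near i pL pp uv.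
by case: sc => -[-> E]; move: h1 h2; rewrite E => h1 h2; [exact: g1|exact: g2].
Qed.

(** The first-order condition at [x] makes the linear term of [convex_near] nonnegative. [K = 0] is
    used when [p] is feasible, a positive [K] when only minimality over the box is known. *)
Lemma growth_near p i s (c x y K : R) : p \in L2 -> L * norm2 (fun t => p t - p0 t) <= ka / 2 ->
  (s = sg i /\ c = a0 i) \/ (s = - sg i /\ c = b0 i) -> `|x - c| <= dl1 -> `|y - c| <= dl1 -> 0 <= K ->
  (forall t, 0 <= t <= 1 -> - K * t ^+ 2 <= s * (H p (x + t * (y - x)) - H p x)) ->
  ka / 4 * (y - x) ^+ 2 <= s * (H p y - H p x).
Proof.
move=> pL pp sc xw yw K0 hK.
have s1 : `|s| = 1 by case: sc => -[-> _]; rewrite ?normrN.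
have := convex_near pL pp sc xw yw.
have := @first_order R _ _ (L * norm2 p) K x (y - x) (sdH s pL) _ K0 (selip pL s1).
have h t : 0 <= t <= 1 -> - K * t ^+ 2 <= s * H p (x + t * (y - x)) - s * H p x.
  by rewrite -mulrBr; exact: hK.
move=> /(_ _ h); rewrite mulr_ge0 ?norm2_ge0// => /(_ isT); lra.
Qed.

Lemma peak_growth p i (x y x' y' : R) : 
  ka / 4 * (x' - x) ^+ 2 <= sg i * (H p x' - H p x) ->
  ka / 4 * (y' - y) ^+ 2 <= - sg i * (H p y' - H p y) ->
  peak p i x' y' <= peak p i x y - ka / 8 * ((x' - x) ^+ 2 + (y' - y) ^+ 2).
Proof. by rewrite /peak; lra. Qed.

Lemma osc2_slope p i (x y z : R) : osc2 e kt p -> I01 x -> I01 y -> I01 z -> peak p i x y = 1 ->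
  0 <= sg i * (H p z - H p x) /\ 0 <= - sg i * (H p z - H p y).
Proof.
move=> po xe ye ze xy; split.
  by have := peak_le i po ze ye; rewrite -xy /peak; lra.
by have := peak_le i po xe ze; rewrite -xy /peak; lra.
Qed.

Let I01_convex (x y t : R) : I01 x -> I01 y -> 0 <= t <= 1 -> I01 (x + t * (y - x)).
Proof. by move=> /andP[? ?] /andP[? ?] /andP[? ?]; apply/andP; split; nra. Qed.

Lemma osc2_growth p i (x y x' y' : R) : p \in L2 -> L * norm2 (fun t => p t - p0 t) <= ka / 2 ->
  osc2 e kt p -> I01 x -> I01 y -> I01 x' -> I01 y' ->
  `|x - a0 i| <= dl1 -> `|y - b0 i| <= dl1 -> `|x' - a0 i| <= dl1 -> `|y' - b0 i| <= dl1 ->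
  peak p i x y = 1 ->
  peak p i x' y' <= 1 - ka / 8 * ((x' - x) ^+ 2 + (y' - y) ^+ 2).
Proof.
move=> pL pp po xe ye x'e y'e xw yw x'w y'w p1; rewrite -[X in _ <= X - _]p1; apply: peak_growth.
- apply: (growth_near pL pp (or_introl (conj erefl erefl)) xw x'w (lexx 0)) => t t01.
  rewrite oppr0 mul0r; exact: (osc2_slope po xe ye (I01_convex xe x'e t01) p1).1.
- apply: (growth_near pL pp (or_intror (conj erefl erefl)) yw y'w (lexx 0)) => t t01.
  rewrite oppr0 mul0r; exact: (osc2_slope po xe ye (I01_convex ye y'e t01) p1).2.
Qed.

(** Moving one endpoint cannot raise the maximal height 1. As the endpoint may lie on the boundary,
    this yields a variational inequality and not a vanishing derivative. *)
Lemma slope0 i (x : R) : I01 x ->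
  0 <= sg i * eta p0 (a0 i) * (x - a0 i) /\ 0 <= - sg i * eta p0 (b0 i) * (x - b0 i).
Proof.
move=> xe; have M0 : 0 <= L * norm2 p0 by rewrite mulr_ge0 ?norm2_ge0.
split.
  apply: (@first_order R _ _ _ 0 _ _ (sdH (sg i) p0L) M0 (lexx 0) (selip p0L (sgn i))) => t t01.
  rewrite oppr0 mul0r -mulrBr.
  exact: (osc2_slope p0o (ha0 i) (hb0 i) (I01_convex (ha0 i) xe t01) (peak0 i)).1.
have s1 : `|- sg i| = 1 by rewrite normrN.
apply: (@first_order R _ _ _ 0 _ _ (sdH (- sg i) p0L) M0 (lexx 0) (selip p0L s1)) => t t01.
rewrite oppr0 mul0r -mulrBr.
exact: (osc2_slope p0o (ha0 i) (hb0 i) (I01_convex (hb0 i) xe t01) (peak0 i)).2.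
Qed.

(** If [al] is nonzero it dominates [t * be] for small [t]; only for [al = 0] does the sign of [be]
    matter. *)
Lemma endpoint (al be c : R) : (forall x, I01 x -> 0 <= al * (x - c)) ->
  (al = 0 -> forall x, I01 x -> 0 <= be * (x - c)) ->
  exists2 t0 : R, 0 < t0 & forall t, 0 < t -> t <= t0 -> forall x, I01 x -> 0 <= (al + t * be) * (x - c).
Proof.
move=> h1 h2; have [a0E|an0] := eqVneq al 0.
  exists 1 => // t t0 _ x xe; rewrite a0E add0r -mulrA mulr_ge0 ?(ltW t0)//; exact: h2.
exists (`|al| / (`|be| + 1)); first by rewrite divr_gt0 ?normr_gt0// ltr_wpDl.
move=> t t0; rewrite ler_pdivlMr ?ltr_wpDl// => tb x xe.
have h3 := h1 x xe; rewrite mulrDl.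
have h4 : `|t * be * (x - c)| <= `|al * (x - c)|.
  rewrite !normrM ler_wpM2r// gtr0_norm//; apply: (le_trans _ tb).
  by rewrite ler_wpM2l ?(ltW t0)// lerDl.
by move: h4; rewrite (ger0_norm h3) ler_norml; lra.
Qed.

(** The conditions on [q] make [p0 + t q] feasible for small [t > 0] with unchanged heights at the
    given intervals: strong convexity controls the windows and the gap the rest. Minimality of the
    norm of [p0] then decides the sign. *)
Lemma dual_stationary q : q \in L2 -> (forall i, peak q i (a0 i) (b0 i) = 0) ->
  (forall i, sg i * eta p0 (a0 i) = 0 -> forall x, I01 x -> 0 <= sg i * eta q (a0 i) * (x - a0 i)) ->
  (forall i, - sg i * eta p0 (b0 i) = 0 -> forall x, I01 x -> 0 <= - sg i * eta q (b0 i) * (x - b0 i)) ->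
  0 <= inner2 p0 q.
Proof.
move=> qL q0 qa qb; rewrite leNgt; apply/negP => pq.
pose P i t := forall x y, I01 x -> I01 y -> `|x - a0 i| <= dl1 -> `|y - b0 i| <= dl1 ->
  peak (fun s => t * q s + p0 s) i x y <= 1.
have [i|t1 t10 Ht1] := @fin_pos_bound R _ P.
  have [ta ta0 Ha] := endpoint (fun x xe => (slope0 i xe).1) (qa i).
  have [tb tb0 Hb] := endpoint (fun x xe => (slope0 i xe).2) (qb i).
  pose tL := ka / 2 / (L * norm2 q + 1).
  have M1 : 0 < L * norm2 q + 1 by rewrite ltr_wpDl// mulr_ge0 ?norm2_ge0.
  exists (Num.min tL (Num.min ta tb)).
    by rewrite !lt_min ta0 tb0 !andbT !divr_gt0.
  move=> t t0; rewrite !le_min => /andP[tl /andP[tta ttb]] x y xe ye xw yw.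
  have pL : (fun s => t * q s + p0 s) \in L2 by apply: L2D => //; exact: L2Z.
  have pp : L * norm2 (fun s => t * q s + p0 s - p0 s) <= ka / 2.
    under eq_fun do rewrite addrK.
    rewrite norm2Z// gtr0_norm// mulrCA.
    move: tl; rewrite ler_pdivlMr//; apply: le_trans.
    by rewrite ler_wpM2l ?(ltW t0)// lerDl.
  have w0 (c : R) : `|c - c| <= dl1 by rewrite subrr normr0 ltW.
  have eE z : eta (fun s => t * q s + p0 s) z = eta p0 z + t * eta q z.
    by rewrite (eta_ofD L0 ktL ktB) ?L2Z// (eta_ofZ L0 ktL ktB)// addrC.
  have ca := convex_near pL pp (or_introl (conj erefl erefl)) (w0 (a0 i)) xw.
  have cb := convex_near pL pp (or_intror (conj erefl erefl)) (w0 (b0 i)) yw.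
  have ea := Ha t t0 tta x xe; have eb := Hb t t0 ttb y ye.
  have p1 : peak (fun s => t * q s + p0 s) i (a0 i) (b0 i) = 1 by rewrite peakZD// q0 mulr0 add0r.
  rewrite -p1 /peak; move: ca cb ea eb; rewrite !eE.
  have s1 : 0 <= ka / 4 * (x - a0 i) ^+ 2 by rewrite mulr_ge0 ?sqr_ge0// divr_ge0 ?(ltW ka0).
  have s2 : 0 <= ka / 4 * (y - b0 i) ^+ 2 by rewrite mulr_ge0 ?sqr_ge0// divr_ge0 ?(ltW ka0).
  lra.
have [rho rho0 gp] := gap_exists dl10.
pose nq := B * norm2 q + 1; have nq0 : 0 < nq by rewrite ltr_wpDl// mulr_ge0 ?norm2_ge0.
pose m := norm2 q ^+ 2 + 1; have m0 : 0 < m by rewrite ltr_wpDl ?sqr_ge0.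
(* The three bounds keep the local peaks below 1, keep the perturbation within the gap, and make [t]
   times the squared norm of [q] at most [- inner2 p0 q], too small to compensate twice the negative
   inner product. *)
pose t := Num.min t1 (Num.min (rho / nq) (- inner2 p0 q / m)).
have t0 : 0 < t by rewrite !lt_min t10 !divr_gt0// oppr_gt0.
have tt1 : t <= t1 by rewrite ge_min lexx.
have tn : t * nq <= rho by rewrite -ler_pdivlMr// !ge_min lexx orbT.
have tm : t * m <= - inner2 p0 q by rewrite -ler_pdivlMr// !ge_min lexx !orbT.
have qtL := L2Z t _ qL; have pL := L2D _ _ qtL p0L.
have po : osc2 e kt (fun s => t * q s + p0 s).
  move=> x y xe ye; rewrite -[leRHS]mulr1; apply: (osc_glue gp (lexx 1)) xe ye => {x y}.
    move=> x y xe ye; rewrite (HofD L0 ktL ktB)// (HofZ L0 ktL ktB)// addrK normrM gtr0_norm//.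
    have := Hlip x y qL => h.
    have h2 : B * norm2 q * `|y - x| <= nq.
      rewrite /nq; apply: (@le_trans _ _ (B * norm2 q)); last by rewrite lerDl.
      by rewrite -[leRHS]mulr1 ler_wpM2l ?I01_abs// mulr_ge0 ?norm2_ge0.
    have h3 : t * `|H q y - H q x| <= t * nq by rewrite ler_wpM2l ?(ltW t0)//; exact: le_trans h h2.
    by lra.
  by move=> i x y xe ye xw yw; exact: Ht1.
have := p0_min pL po; rewrite -(ler_pXn2r (n := 2))// ?nnegrE ?norm2_ge0// => /(_ _)/wrap[].
  by move=> i; rewrite peakZD// q0 mulr0 add0r.
rewrite !norm2_sqr// inner2Dl// !inner2Dr// !inner2Zl// !inner2Zr// (inner2C q p0) -(norm2_sqr q)//.
move=> h; have h1 : 0 <= t * (t * norm2 q ^+ 2 + 2 * inner2 p0 q) by lra.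
have : 0 <= t * norm2 q ^+ 2 + 2 * inner2 p0 q by rewrite -(pmulr_rge0 _ t0).
have : t * norm2 q ^+ 2 <= t * m by rewrite ler_wpM2l ?(ltW t0)// /m lerDl.
by lra.
Qed.

Lemma sum6 (F : 'I_6 -> R) : \sum_j F j =
  F (inord 0) + F (inord 1) + F (inord 2) + F (inord 3) + F (inord 4) + F (inord 5).
Proof.
rewrite !big_ord_recl big_ord0 addr0 !addrA.
by do ![congr (_ + _)]; congr F; apply: val_inj; rewrite /= inordK.
Qed.

(** The Farkas certificate of [dual_stationary]. Weakly, the identity says that [- p0] is the
    derivative of [Kstep] at the given parameters when the coefficients move with velocity [g i] and
    the endpoints with [x i / c0 i] and [y i / c0 i]. The sign conditions keep boundary endpoints
    from moving outward. *)
Lemma multipliers : exists g x y : 'I_n -> R,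
  (forall q, q \in L2 -> - inner2 p0 q = \sum_i (g i * peak q i (a0 i) (b0 i) -
     x i * (1 / 2 * sg i * eta q (a0 i)) + y i * (1 / 2 * sg i * eta q (b0 i)))) /\
  forall i, [/\ x i != 0 -> eta p0 (a0 i) = 0, x i < 0 -> e < a0 i,
    y i != 0 -> eta p0 (b0 i) = 0 & 0 < y i -> b0 i < 1 - e].
Proof.
have p12 : (1%:E <= 2%:E :> \bar R)%E by rewrite lee_fin ler1n.
pose W := LfunType mu p12.
pose za i := eta p0 (a0 i) == 0; pose zb i := eta p0 (b0 i) == 0.
pose A i (q : W) := 1 / 2 * sg i * eta q (a0 i).
pose A' i (q : W) := 1 / 2 * sg i * eta q (b0 i).
(* Two forms fix the height; for each endpoint one form prescribes the sign of the slope of [q], and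
   a second one its vanishing when the endpoint can also move outward. The factors [za] and [zb]
   switch these off where [eta p0] is nonzero. *)
pose al (ij : 'I_n * 'I_6) (q : W) : R := match val ij.2 with
  | 0 => peak q ij.1 (a0 ij.1) (b0 ij.1)
  | 1 => - peak q ij.1 (a0 ij.1) (b0 ij.1)
  | 2 => - (za ij.1)%:R * A ij.1 q
  | 3 => (za ij.1 && (e < a0 ij.1))%:R * A ij.1 q
  | 4 => - (zb ij.1)%:R * A' ij.1 q
  | _ => (zb ij.1 && (b0 ij.1 < 1 - e))%:R * A' ij.1 q end.
have WL (q : W) : (q : R -> R) \in L2 by exact: LfunP.
have etaW (c : R) (q r : W) z : eta (c *: q + r : W) z = c * eta q z + eta r z.
  have -> : ((c *: q + r : W) : R -> R) = fun t => c * q t + r t by [].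
  by rewrite (eta_ofD L0 ktL ktB) ?L2Z// (eta_ofZ L0 ktL ktB).
have peakW (c : R) (q r : W) i : peak (c *: q + r : W) i (a0 i) (b0 i) =
   c * peak q i (a0 i) (b0 i) + peak r i (a0 i) (b0 i).
  have -> : ((c *: q + r : W) : R -> R) = fun t => c * q t + r t by [].
  by rewrite peakZD.
have [[i j] c q r|c q r|q Hq|u u0 Eu] := @farkas_fin R W _ al (fun q : W => - inner2 p0 q).
- by rewrite /al /A /A'; case: j => [[|[|[|[|[|[|//]]]]]] ?] /=; rewrite ?peakW ?etaW; ring.
- have -> : ((c *: q + r : W) : R -> R) = fun t => c * q t + r t by [].
  by rewrite inner2Dr ?L2Z// inner2Zr//; ring.
- rewrite oppr_le0; apply: dual_stationary => // i.
  + have := Hq (i, inord 0); have := Hq (i, inord 1); rewrite /al /= !inordK//= => h1 h2.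
    by apply/le_anti; rewrite h2/=; lra.
  + move=> /eqP; rewrite mulf_eq0 -[sg i == 0]normr_eq0 sgn oner_eq0/= => z0 x xe.
    have := Hq (i, inord 2); have := Hq (i, inord 3); rewrite /al /= !inordK//= /za z0/= /A => h1 h2.
    have s0 : 0 <= sg i * eta q (a0 i) by lra.
    have [ax|xa] := leP (a0 i) x; first by rewrite mulr_ge0// subr_ge0.
    have ea : e < a0 i by have := ha0 i; lra.
    by move: h1; rewrite ea /= mul1r => h1; rewrite (_ : _ * eta q _ = 0) ?mul0r//; apply/le_anti; rewrite s0 andbT; lra.
  + move=> /eqP; rewrite mulf_eq0 oppr_eq0 -[sg i == 0]normr_eq0 sgn oner_eq0/= => z0 x xe.
    have := Hq (i, inord 4); have := Hq (i, inord 5); rewrite /al /= !inordK//= /zb z0/= /A' => h1 h2.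
    have s0 : 0 <= sg i * eta q (b0 i) by lra.
    have [xb|bx] := leP x (b0 i); first by rewrite mulNr mulNr -mulrN mulr_ge0// oppr_ge0 subr_le0.
    have ea : b0 i < 1 - e by have := hb0 i; lra.
    by move: h1; rewrite ea /= mul1r => h1; rewrite mulNr (_ : _ * eta q _ = 0) ?oppr0 ?mul0r//; apply/le_anti; rewrite s0 andbT; lra.
pose U i (j : nat) : R := u (i, inord j).
exists (fun i => U i 0%N - U i 1%N),
  (fun i => U i 2%N * (za i)%:R - U i 3%N * (za i && (e < a0 i))%:R),
  (fun i => U i 5%N * (zb i && (b0 i < 1 - e))%:R - U i 4%N * (zb i)%:R); split.
  move=> q qL; have := Eu (Lfun_Sub p12 qL); rewrite /= => ->.
  rewrite (eq_bigr (fun ij : 'I_n * 'I_6 => u (ij.1, ij.2) * al (ij.1, ij.2) (Lfun_Sub p12 qL))); last by move=> [].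
  rewrite -(pair_bigA _ (fun (i : 'I_n) (j : 'I_6) => u (i, j) * al (i, j) (Lfun_Sub p12 qL)))/=; apply: eq_bigr => i _.
  by rewrite sum6 /al /= !inordK//= /A /A' /U; field.
move=> i; have U0 (j : nat) : 0 <= U i j by exact: u0.
have := U0 2%N; have := U0 3%N; have := U0 4%N; have := U0 5%N => h5 h4 h3 h2.
have z0 (r s : R) : r * (nat_of_bool false)%:R - s * (nat_of_bool false)%:R = 0 by rewrite /=; ring.
split.
- by rewrite /za; case: (eta p0 (a0 i) =P 0) => [//|_] /=; rewrite z0 eqxx.
- case: (ltP e (a0 i)) => // _; rewrite andbF; case: (za i) => /=; lra.
- by rewrite /zb; case: (eta p0 (b0 i) =P 0) => [//|_] /=; rewrite z0 eqxx.
- case: (ltP (b0 i) (1 - e)) => // _; rewrite andbF; case: (zb i) => /=; lra.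
Qed.

Lemma small_step (c z dl : R) : 0 < dl -> I01 c -> (z < 0 -> e < c) -> (0 < z -> c < 1 - e) ->
  exists2 t0 : R, 0 < t0 & forall t, 0 < t -> t <= t0 -> I01 (c + t * z) /\ `|t * z| <= dl.
Proof.
move=> dl0 /andP[ec ce] zn zp.
pose m := if z < 0 then c - e else if 0 < z then 1 - e - c else 1.
have m0 : 0 < m.
  rewrite /m; case: ifPn => [/zn|_]; first by rewrite subr_gt0.
  by case: ifPn => [/zp|]//; rewrite subr_gt0.
exists (Num.min dl m / (`|z| + 1)); first by rewrite divr_gt0 ?lt_min ?dl0// ltr_wpDl.
move=> t t0; rewrite ler_pdivlMr ?ltr_wpDl// le_min => /andP[h1 h2].
have h3 : `|t * z| <= t * (`|z| + 1).
  by rewrite normrM gtr0_norm// ler_wpM2l ?(ltW t0)// lerDl.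
split; last exact: le_trans h3 h1.
have := le_trans h3 h2; rewrite /m ler_norml => /andP[g1 g2].
case: (ltgtP z 0) g1 g2 => z0 g1 g2.
- have tz : t * z < 0 by rewrite pmulr_rlt0.
  by apply/andP; split; lra.
- have tz : 0 < t * z by rewrite mulr_gt0.
  by apply/andP; split; lra.
- by rewrite z0 mulr0 addr0 ec ce.
Qed.

Lemma taylor_H q (x y : R) : q \in L2 -> `|H q y - H q x - eta q x * (y - x)| <= L * norm2 q * (y - x) ^+ 2.
Proof.
move=> qL; apply: (taylor_lip _ _ (dH qL)); first by rewrite mulr_ge0 ?norm2_ge0.
by move=> u v; exact: elip.
Qed.

(** Endpoint multipliers are divided by [c0 i] because an endpoint acts on [Kstep] with weight
    [c0 i]. Endpoints move only where [eta p0] vanishes, so the heights drop only to second order.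
    [C] does not depend on the window [dl]. *)
Lemma competitor : exists2 C : R, 0 <= C & forall dl : R, 0 < dl -> exists2 lam1 : R, 0 < lam1 &
  forall lam, 0 < lam -> lam <= lam1 -> exists c a b,
  [/\ forall i, 0 <= c i <= 2 * c0 i,
      forall i, I01 (a i) /\ `|a i - a0 i| <= dl,
      forall i, I01 (b i) /\ `|b i - b0 i| <= dl,
      (ordered a b -> norm2 (fun t => (Kstep c a b t - Kstep c0 a0 b0 t) + lam * p0 t) <= C * lam ^+ 2) &
      \sum_i c i * (1 - peak p0 i (a i) (b i)) <= C * lam ^+ 2].
Proof.
have [g [x [y [Exy Hxy]]]] := multipliers.
pose X i := x i / c0 i; pose Y i := y i / c0 i.
(* [C1] collects the Taylor remainders and the products of coefficient and endpoint increments; [C2]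
   bounds the loss of height. *)
pose C1 := \sum_i (c0 i / 2 * L * (X i ^+ 2 + Y i ^+ 2) + `|g i| * (B / 2) * (`|X i| + `|Y i|)).
pose C2 := \sum_i (c0 i * L * norm2 p0 * (X i ^+ 2 + Y i ^+ 2)).
have C10 : 0 <= C1.
  apply: sumr_ge0 => i _; apply: addr_ge0; apply: mulr_ge0.
  - by rewrite mulr_ge0// divr_ge0// ltW.
  - by rewrite addr_ge0// sqr_ge0.
  - by rewrite mulr_ge0// divr_ge0.
  - by rewrite addr_ge0.
have C20 : 0 <= C2.
  apply: sumr_ge0 => i _; apply: mulr_ge0; last by rewrite addr_ge0// sqr_ge0.
  by rewrite mulr_ge0 ?norm2_ge0// mulr_ge0// ltW.
exists (C1 + C2) => [|dl dl0]; first by rewrite addr_ge0.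
pose P i t := [/\ 0 <= c0 i + t * g i <= 2 * c0 i, I01 (a0 i + t * X i) /\ `|t * X i| <= dl &
  I01 (b0 i + t * Y i) /\ `|t * Y i| <= dl].
have [i|lam1 lam10 Hlam] := @fin_pos_bound R _ P.
  have [ca cb cc cd] := Hxy i.
  have [ta ta0 Ha] : exists2 t0 : R, 0 < t0 & forall t, 0 < t -> t <= t0 -> I01 (a0 i + t * X i) /\ `|t * X i| <= dl.
    apply: small_step => //; first by rewrite /X pmulr_llt0 ?invr_gt0.
    by move=> _; have := hab0 i; have := hb0 i; lra.
  have [tb tb0 Hb] : exists2 t0 : R, 0 < t0 & forall t, 0 < t -> t <= t0 -> I01 (b0 i + t * Y i) /\ `|t * Y i| <= dl.
    apply: small_step => //; last by rewrite /Y pmulr_lgt0 ?invr_gt0.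
    by move=> _; have := hab0 i; have := ha0 i; lra.
  exists (Num.min (c0 i / (`|g i| + 1)) (Num.min ta tb)).
    by rewrite !lt_min ta0 tb0 !andbT divr_gt0// ltr_wpDl.
  move=> t t0; rewrite !le_min ler_pdivlMr ?ltr_wpDl// => /andP[tg /andP[tta ttb]].
  split; [|exact: Ha|exact: Hb].
  have h : `|t * g i| <= c0 i.
    rewrite normrM gtr0_norm//; apply: (le_trans _ tg).
    by rewrite ler_wpM2l ?(ltW t0)// lerDl.
  by move: h; rewrite ler_norml; lra.
exists lam1 => // lam lam0 laml.
have HP i : P i lam by exact: Hlam.
pose c i := c0 i + lam * g i; pose a i := a0 i + lam * X i; pose b i := b0 i + lam * Y i.
exists c, a, b; split.
- by move=> i; have [] := HP i.
- by move=> i; have [_ [h1 h2] _] := HP i; split => //; rewrite /a addrAC subrr add0r.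
- by move=> i; have [_ _ [h1 h2]] := HP i; split => //; rewrite /b addrAC subrr add0r.
- move=> ab; apply: norm2_le_dual.
    by apply: L2D; [apply: L2B; exact: Kstep_L2|exact: L2Z].
  move=> q qL; rewrite inner2Dr//; [|by apply: L2B; exact: Kstep_L2|exact: L2Z].
  rewrite inner2Br ?Kstep_L2// inner2Zr// !inner2_Kstep// (inner2C q).
  have -> : inner2 p0 q = - - inner2 p0 q by rewrite opprK.
  rewrite (Exy q qL) mulrN mulr_sumr -!sumrB.
  apply: (@le_trans _ _ (C1 * lam ^+ 2 * norm2 q)); last first.
    by rewrite !ler_wpM2r ?norm2_ge0 ?sqr_ge0// lerDl.
  rewrite mulr_suml mulr_suml; apply: ler_sum => i _.
  set P0 := peak q i (a0 i) (b0 i).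
  set Da := H q (a i) - H q (a0 i); set Db := H q (b i) - H q (b0 i).
  have -> : peak q i (a i) (b i) = P0 + 1 / 2 * sg i * (Db - Da) by rewrite /P0 /peak /Da /Db; ring.
  have aE : a i - a0 i = lam * X i by rewrite /a addrAC subrr add0r.
  have bE : b i - b0 i = lam * Y i by rewrite /b addrAC subrr add0r.
  have ha := taylor_H (a0 i) (a i) qL; have hb := taylor_H (b0 i) (b i) qL.
  have la := Hlip (a0 i) (a i) qL; have lb := Hlip (b0 i) (b i) qL.
  move: ha hb la lb; rewrite aE bE -/Da -/Db.
  set ea := eta q (a0 i); set eb := eta q (b0 i) => ha hb la lb.
  have xE : x i = c0 i * X i by rewrite /X mulrC divfK ?gt_eqF.
  have yE : y i = c0 i * Y i by rewrite /Y mulrC divfK ?gt_eqF.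
  have -> : c i * (P0 + 1 / 2 * sg i * (Db - Da)) - c0 i * P0 -
      lam * (g i * P0 - x i * (1 / 2 * sg i * ea) + y i * (1 / 2 * sg i * eb)) =
     sg i * (c0 i / 2 * ((Db - eb * (lam * Y i)) - (Da - ea * (lam * X i))) + lam * g i / 2 * (Db - Da)).
    by rewrite xE yE /c; field.
  apply: (le_trans (ler_norm _)); rewrite normrM sgn mul1r.
  apply: (le_trans (ler_normD _ _)); rewrite mulrDl mulrDl; apply: lerD.
    rewrite normrM (gtr0_norm (_ : 0 < c0 i / 2)) ?divr_gt0// -!mulrA ler_wpM2l ?(ltW (hc0 i))// ler_wpM2l//.
    apply: (le_trans (ler_normB _ _)); apply: (le_trans (lerD hb ha)).
    by rewrite !exprMn; lra.
  rewrite !normrM (gtr0_norm lam0) (ger0_norm (_ : 0 <= 2^-1 :> R))//.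
  apply: (@le_trans _ _ (lam * `|g i| / 2 * (B * norm2 q * `|lam * X i| + B * norm2 q * `|lam * Y i|))).
    rewrite ler_wpM2l//; first by rewrite divr_ge0// mulr_ge0// ltW.
    by apply: (le_trans (ler_normB _ _)); rewrite addrC lerD.
  by rewrite !normrM (gtr0_norm lam0); lra.
- apply: (@le_trans _ _ (C2 * lam ^+ 2)); last by rewrite ler_wpM2r ?sqr_ge0// lerDr.
  rewrite mulr_suml; apply: ler_sum => i _.
  have [cb [ia wa] [ib wb]] := HP i; have [zx _ zy _] := Hxy i.
  have ha := taylor_H (a0 i) (a i) p0L; have hb := taylor_H (b0 i) (b i) p0L.
  have aE : a i - a0 i = lam * X i by rewrite /a addrAC subrr add0r.
  have bE : b i - b0 i = lam * Y i by rewrite /b addrAC subrr add0r.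
  have za : eta p0 (a0 i) * (lam * X i) = 0.
    by rewrite /X; have [->|/zx ->] := eqVneq (x i) 0; rewrite ?mul0r// mulr0 mulr0.
  have zb : eta p0 (b0 i) * (lam * Y i) = 0.
    by rewrite /Y; have [->|/zy ->] := eqVneq (y i) 0; rewrite ?mul0r// mulr0 mulr0.
  move: ha hb; rewrite aE bE za zb !subr0 => ha hb.
  rewrite -(peak0 i).
  have -> : peak p0 i (a0 i) (b0 i) - peak p0 i (a i) (b i) =
     sg i * (2^-1 * ((H p0 (a i) - H p0 (a0 i)) - (H p0 (b i) - H p0 (b0 i)))) by rewrite /peak; field.
  move/andP: cb => [cb1 cb2].
  apply: (@le_trans _ _ (2 * c0 i * (2^-1 * (L * norm2 p0 * (lam * X i) ^+ 2 + L * norm2 p0 * (lam * Y i) ^+ 2)))).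
    apply: (@le_trans _ _ (c i * (2^-1 * (L * norm2 p0 * (lam * X i) ^+ 2 + L * norm2 p0 * (lam * Y i) ^+ 2)))).
      rewrite ler_wpM2l//; apply: (le_trans (ler_norm _)); rewrite normrM sgn mul1r normrM.
      rewrite (ger0_norm (_ : 0 <= 2^-1 :> R))// ler_wpM2l//.
      by apply: (le_trans (ler_normB _ _)); exact: lerD.
    rewrite ler_wpM2r// mulr_ge0// addr_ge0// mulr_ge0 ?sqr_ge0// mulr_ge0 ?norm2_ge0//.
  by rewrite !exprMn; lra.
Qed.

(** The range of the coefficients does not shrink with [dl]: it only provides compactness, and
    closeness to [c0] is derived afterwards in [coefficient_error]. *)
Definition box (dl : R) c a b := forall i, [/\ 0 <= c i <= 2 * c0 i,
  I01 (a i) /\ `|a i - a0 i| <= dl & I01 (b i) /\ `|b i - b0 i| <= dl].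

Lemma box_ordered dl c a b : (forall i, 2 * dl < b0 i - a0 i) -> box dl c a b -> ordered a b.
Proof.
move=> hdl hb i; have [_ [ai da] [bi db]] := hb i; split => //.
by have := hdl i; move: da db; rewrite !ler_norml; lra.
Qed.

Lemma norm2_Kstep c a b : ordered a b -> (forall i, 0 <= c i <= 2 * c0 i) ->
  norm2 (Kstep c a b) <= B * \sum_i c0 i.
Proof.
move=> ab hc; apply: norm2_le_dual; first exact: Kstep_L2.
move=> q qL; rewrite inner2_Kstep// mulr_sumr mulr_suml; apply: ler_sum => i _.
have [ai bi _] := ab i; have /andP[ci1 ci2] := hc i.
have h := le_trans (ler_norm _) (peak_bound i qL ai bi).
apply: (@le_trans _ _ (c i * (B / 2 * norm2 q))); first by rewrite ler_wpM2l.
apply: (@le_trans _ _ (2 * c0 i * (B / 2 * norm2 q))); last by lra.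
by rewrite ler_wpM2r// mulr_ge0 ?norm2_ge0// divr_ge0.
Qed.

Lemma norm2_sub f g : f \in L2 -> g \in L2 -> `|norm2 f - norm2 g| <= norm2 (fun t => f t - g t).
Proof.
move=> fL gL; have dL := L2B _ _ fL gL.
have h1 := norm2D _ _ dL gL; have h2 := norm2D _ _ (L2Z (-1) _ dL) fL.
move: h1 h2; rewrite norm2Z// normrN1 mul1r.
have -> : (fun t => f t - g t + g t) = f by apply/funext => t; ring.
have -> : (fun t => -1 * (f t - g t) + f t) = g by apply/funext => t; ring.
by rewrite ler_norml; lra.
Qed.

Lemma half_close (x y : R) : 0 < y -> `|x - y| <= y / 2 -> 0 < x < 2 * y.
Proof. by rewrite ler_norml => y0 /andP[h1 h2]; apply/andP; split; lra. Qed.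

Lemma flat_zero (m K x : R) : 0 < m -> (forall t, `|t| <= m -> t * x <= K * t ^+ 2) -> x = 0.
Proof.
move=> m0 h.
suff half s : `|s| = 1 -> s * x <= 0.
  by have := half 1 (normr1 _); have := half (-1) (normrN1 _) => h1 h2; apply/le_anti; lra.
move=> s1; rewrite leNgt; apply/negP => sx.
pose t := Num.min m (s * x / (2 * (`|K| + 1))).
have K1 : 0 < `|K| + 1 by rewrite ltr_wpDl.
have t0 : 0 < t by rewrite lt_min m0 divr_gt0// mulr_gt0.
have tK : t * (2 * (`|K| + 1)) <= s * x by rewrite -ler_pdivlMr ?mulr_gt0// ge_min lexx orbT.
have := h (t * s); rewrite normrM s1 mulr1 gtr0_norm// ge_min lexx => /(_ isT).
rewrite exprMn -(real_normK (num_real s)) s1 expr1n mulr1 expr2 mulrCA -!mulrA ler_pM2l// => h1.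
have h2 : K * t <= (`|K| + 1) * t by rewrite ler_wpM2r ?(ltW t0)// (le_trans (ler_norm _))// lerDl.
by nra.
Qed.

Let win_convex (x y z t dl : R) : `|x - z| <= dl -> `|y - z| <= dl -> 0 <= t <= 1 ->
  `|x + t * (y - x) - z| <= dl.
Proof.
rewrite !ler_norml => /andP[h1 h2] /andP[h3 h4] /andP[t0 t1]; apply/andP; split; nra.
Qed.

(** * Minimisers of the energy in the box *)

Section data.
Context (dl lam : R) (w : R -> R) (dl0 : 0 < dl) (dlle : dl <= dl1)
  (dlab : forall i, 2 * dl < b0 i - a0 i) (lam0 : 0 < lam) (wL : w \in L2).

Let f : R -> R := fun t => Kstep c0 a0 b0 t + w t.

Let fL : f \in L2. Proof. by apply: L2D => //; exact: Kstep_L2. Qed.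

Definition energy c a b : R := 1 / 2 * norm2 (fun t => Kstep c a b t - f t) ^+ 2 + lam * \sum_i c i.

Definition residual c a b : R -> R := fun t => lam^-1 * (f t - Kstep c a b t).

Lemma energy_lip c a b c' a' b' : box dl c a b -> box dl c' a' b' ->
  `|energy c a b - energy c' a' b'| <=
  ((B * \sum_i c0 i + norm2 f) * (B / 2 * (1 + 2 * \sum_i c0 i)) + lam) *
  \sum_i (`|c i - c' i| + `|a i - a' i| + `|b i - b' i|).
Proof.
move=> hb hb'; have ab := box_ordered dlab hb; have ab' := box_ordered dlab hb'.
set S := \sum_i (_ + _ + _); set M := B * \sum_i c0 i + norm2 f; set S0 := \sum_i c0 i.
have S00 : 0 <= S0 by apply: sumr_ge0 => i _; exact: ltW.
have SS : 0 <= S by apply: sumr_ge0 => i _; rewrite !addr_ge0.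
pose N := norm2 (fun t => Kstep c a b t - f t); pose N' := norm2 (fun t => Kstep c' a' b' t - f t).
have NM : N <= M.
  have := norm2B _ _ (Kstep_L2 c a b) fL; have := @norm2_Kstep c a b ab (fun i => let: And3 h _ _ := hb i in h).
  by rewrite /M /N; lra.
have NM' : N' <= M.
  have := norm2B _ _ (Kstep_L2 c' a' b') fL; have := @norm2_Kstep c' a' b' ab' (fun i => let: And3 h _ _ := hb' i in h).
  by rewrite /M /N'; lra.
have N0 : 0 <= N := norm2_ge0 _; have N0' : 0 <= N' := norm2_ge0 _.
have dN : `|N - N'| <= B / 2 * (1 + 2 * S0) * S.
  apply: (le_trans (norm2_sub (L2B _ _ (Kstep_L2 _ _ _) fL) (L2B _ _ (Kstep_L2 _ _ _) fL))).
  rewrite (_ : (fun t => _) = fun t => Kstep c a b t - Kstep c' a' b' t); last by apply/funext => t; ring.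
  apply: (le_trans (norm2_Kstep_diff c c' ab ab')).
  rewrite -[leRHS]mulrA ler_wpM2l ?divr_ge0// mulr_sumr; apply: ler_sum => i _.
  have [/andP[c1 c2] _ _] := hb' i.
  have c0S : c0 i <= S0 by rewrite /S0 (bigD1 i)//= lerDl; apply: sumr_ge0 => j _; exact: ltW.
  rewrite (ger0_norm c1); set da := `|a i - _|; set db := `|b i - _|; set dc := `|c i - _|.
  have da0 : 0 <= da by exact: normr_ge0.
  have db0 : 0 <= db by exact: normr_ge0.
  have dc0 : 0 <= dc by exact: normr_ge0.
  have h1 : c' i * (da + db) <= 2 * S0 * (da + db) by rewrite ler_wpM2r ?addr_ge0//; lra.
  have h2 : 0 <= 2 * S0 * dc by rewrite mulr_ge0// mulr_ge0.
  by lra.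
have dc : `|\sum_i c i - \sum_i c' i| <= S.
  rewrite -sumrB; apply: (le_trans (ler_norm_sum _ _ _)); apply: ler_sum => i _.
  by rewrite -addrA lerDl addr_ge0.
have -> : energy c a b - energy c' a' b' =
    2^-1 * ((N - N') * (N + N')) + lam * (\sum_i c i - \sum_i c' i).
  by rewrite /energy -/N -/N'; field.
apply: (le_trans (ler_normD _ _)); rewrite [leRHS]mulrDl; apply: lerD; last first.
  by rewrite normrM (gtr0_norm lam0) ler_wpM2l// ltW.
rewrite normrM (ger0_norm (_ : 0 <= 2^-1 :> R))// normrM (ger0_norm (addr_ge0 N0 N0')).
apply: (@le_trans _ _ (2^-1 * (`|N - N'| * (M + M)))).
  by rewrite ler_wpM2l// ler_wpM2l//; lra.
apply: (@le_trans _ _ (`|N - N'| * M)); first by lra.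
rewrite mulrC -mulrA ler_wpM2l//; apply: (le_trans N0 NM).
Qed.

Lemma minimizer : exists c a b, box dl c a b /\
  forall c' a' b', box dl c' a' b' -> energy c a b <= energy c' a' b'.
Proof.
(* All parameters form one family: [None] indexes the coefficient, [Some false] the left and
   [Some true] the right endpoint. *)
pose cc (v : 'I_n * option bool -> R) i := v (i, None).
pose aa (v : 'I_n * option bool -> R) i := v (i, Some false).
pose bb (v : 'I_n * option bool -> R) i := v (i, Some true).
pose lo (ij : 'I_n * option bool) := match ij.2 with
  None => 0 | Some false => Num.max e (a0 ij.1 - dl) | Some true => Num.max e (b0 ij.1 - dl) end.
pose hi (ij : 'I_n * option bool) := match ij.2 with
  None => 2 * c0 ij.1 | Some false => Num.min (1 - e) (a0 ij.1 + dl)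
  | Some true => Num.min (1 - e) (b0 ij.1 + dl) end.
have wE (c x : R) : (Num.max e (c - dl) <= x <= Num.min (1 - e) (c + dl)) <-> (I01 x /\ `|x - c| <= dl).
  rewrite ge_max le_min ler_norml; split.
    by move=> /andP[/andP[h1 h2] /andP[h3 h4]]; rewrite h1 h3; split=> //; lra.
  by move=> [/andP[h1 h2] /andP[h3 h4]]; rewrite h1 h2/=; lra.
have boxE (v : 'I_n * option bool -> R) : (forall ij, lo ij <= v ij <= hi ij) <-> box dl (cc v) (aa v) (bb v).
  split=> [h i|h [i [[]|]]].
  - split; [exact: (h (i, None))|exact/wE/(h (i, Some false))|exact/wE/(h (i, Some true))].
  - by have [_ _ h3] := h i; exact/wE.
  - by have [_ h2 _] := h i; exact/wE.
  - by have [h1 _ _] := h i.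
have [|v v' hv hv'|v hv Hv] := @box_min _ _ lo hi (fun v : 'I_n * option bool -> R => energy (cc v) (aa v) (bb v))
  ((B * \sum_i c0 i + norm2 f) * (B / 2 * (1 + 2 * \sum_i c0 i)) + lam).
- move=> ij; apply: (@le_trans _ _ (match ij.2 with None => c0 ij.1 | Some false => a0 ij.1 | Some true => b0 ij.1 end)).
    rewrite /lo; case: ij.2 => [[]|]; last exact: ltW.
      by rewrite ge_max; have := hb0 ij.1; have := dl0; lra.
    by rewrite ge_max; have := ha0 ij.1; have := dl0; lra.
  rewrite /hi; case: ij.2 => [[]|]; last by have := hc0 ij.1; lra.
    by rewrite le_min; have := hb0 ij.1; have := dl0; lra.
  by rewrite le_min; have := ha0 ij.1; have := dl0; lra.
- apply: (le_trans (energy_lip ((boxE v).1 hv) ((boxE v').1 hv'))).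
  rewrite le_eqVlt; apply/orP; left; apply/eqP; congr (_ * _).
  rewrite [RHS](eq_bigr (fun ij : 'I_n * option bool => `|v (ij.1, ij.2) - v' (ij.1, ij.2)|)); last by move=> [].
  rewrite -(pair_bigA _ (fun (i : 'I_n) (j : option bool) => `|v (i, j) - v' (i, j)|))/=.
  apply: eq_bigr => i _; rewrite (bigD1 None)//= (bigD1 (Some false))//= (bigD1 (Some true))//=.
  by rewrite big1 ?addr0 ?addrA// => -[[]|].
exists (cc v), (aa v), (bb v); split; first exact/boxE.
move=> c a b hb.
pose v' (ij : 'I_n * option bool) := match ij.2 with
  None => c ij.1 | Some false => a ij.1 | Some true => b ij.1 end.
by apply: (Hv v'); apply/boxE.
Qed.

Context c a b (hb : box dl c a b)
  (hmin : forall c' a' b', box dl c' a' b' -> energy c a b <= energy c' a' b').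

Let ab : ordered a b := box_ordered dlab hb.

Local Notation p := (residual c a b).

Lemma residual_L2 c' a' b' : residual c' a' b' \in L2.
Proof. by apply: L2Z; apply: L2B => //; exact: Kstep_L2. Qed.

Lemma TfE c' a' b' : (fun t => Kstep c' a' b' t - f t) = fun t => - lam * residual c' a' b' t.
Proof. by apply/funext => t; rewrite /residual mulrA mulNr divff ?gt_eqF//; ring. Qed.

Lemma energyE c' a' b' : energy c' a' b' = lam ^+ 2 / 2 * norm2 (residual c' a' b') ^+ 2 + lam * \sum_i c' i.
Proof.
rewrite /energy TfE norm2Z; last exact: residual_L2.
by rewrite normrN (gtr0_norm lam0); field.
Qed.

Lemma Kstep_residual c' a' b' t : Kstep c' a' b' t = f t - lam * residual c' a' b' t.
Proof. by rewrite /residual mulrA divff ?gt_eqF// mul1r opprB addrC subrK. Qed.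

Lemma residualE c' a' b' : residual c' a' b' = fun t => lam^-1 * (f t - Kop k (step_comb c' sg a' b') t).
Proof. by rewrite -KstepE. Qed.

Opaque residual.

Lemma inner2_residual q c' a' b' : q \in L2 -> ordered a' b' ->
  lam * inner2 q (residual c' a' b') = inner2 q f - \sum_i c' i * peak q i (a' i) (b' i).
Proof.
move=> qL ab'; rewrite -inner2_Kstep// -inner2Br ?Kstep_L2// -inner2Zr//; last exact: residual_L2.
by congr inner2; apply/funext => t; rewrite Kstep_residual; ring.
Qed.

(* Naming the residual keeps unification from comparing two residuals structurally. *)
Lemma residual_abstract c' a' b' : ordered a' b' -> exists r,
  [/\ residual c' a' b' = r, forall s, Kstep c' a' b' s = f s - lam * r s, r \in L2 &
      forall q, q \in L2 -> lam * inner2 q r = inner2 q f - \sum_i c' i * peak q i (a' i) (b' i)].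
Proof.
exists (residual c' a' b'); split => //; [exact: Kstep_residual|exact: residual_L2|].
by move=> q qL; exact: inner2_residual.
Qed.

(** Up to a constant the energy equals [lam^2 / 2] times the squared distance of the residual to
    [p0], plus [lam] times the duality gap. The gap is nonnegative at the minimiser and at most
    [C lam^2] at the competitor, so comparing energies and dividing by [lam^2 / 2] gives the
    bound. *)
Lemma residual_close C al c' a' b' : box dl c' a' b' -> norm2 w <= al * lam -> 0 <= C ->
  norm2 (fun t => (Kstep c' a' b' t - Kstep c0 a0 b0 t) + lam * p0 t) <= C * lam ^+ 2 ->
  \sum_i c' i * (1 - peak p0 i (a' i) (b' i)) <= C * lam ^+ 2 ->
  norm2 (fun t => p t - p0 t) ^+ 2 <= (al + C * lam) ^+ 2 + 2 * (C * lam).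
Proof.
move=> hb' wal C0 h1 h2; have ab' := box_ordered dlab hb'.
have [r [rE rT pL rI]] := residual_abstract c ab.
have [p' [p'E p'T p'L p'I]] := residual_abstract c' ab'.
rewrite rE.
have n' : norm2 (fun t => p' t - p0 t) <= al + C * lam.
  have -> : (fun t => p' t - p0 t) = fun t => lam^-1 * (w t - ((Kstep c' a' b' t - Kstep c0 a0 b0 t) + lam * p0 t)).
    apply/funext => t; rewrite p'T /f.
    by field; rewrite gt_eqF.
  have rL : (fun t => (Kstep c' a' b' t - Kstep c0 a0 b0 t) + lam * p0 t) \in L2.
    by apply: L2D; [apply: L2B; exact: Kstep_L2|exact: L2Z].
  rewrite norm2Z; last exact: L2B.
  rewrite gtr0_norm ?invr_gt0// mulrC ler_pdivrMr//.
  have := norm2B _ _ wL rL; have -> : (al + C * lam) * lam = al * lam + C * lam ^+ 2 by ring.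
  by lra.
have n0 : 0 <= norm2 (fun t => p' t - p0 t) by exact: norm2_ge0.
have n2 : norm2 (fun t => p' t - p0 t) ^+ 2 <= (al + C * lam) ^+ 2.
  by rewrite ler_pXn2r// nnegrE// (le_trans n0 n').
have E := hmin hb'; rewrite !energyE rE p'E in E.
have D0 : 0 <= \sum_i c i - \sum_i c i * peak p0 i (a i) (b i).
  rewrite -sumrB; apply: sumr_ge0 => i _; have [/andP[ci _] [ai _] [bi _]] := hb i.
  have := peak_le i p0o ai bi => h.
  by rewrite -[X in X - _]mulr1 -mulrBr mulr_ge0// subr_ge0.
have D' : \sum_i c' i * (1 - peak p0 i (a' i) (b' i)) = \sum_i c' i - \sum_i c' i * peak p0 i (a' i) (b' i).
  by rewrite -sumrB; apply: eq_bigr => i _; ring.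
rewrite D' in h2.
have I1 := rI _ p0L; have I2 := p'I _ p0L.
have X q : q \in L2 -> norm2 (fun t => q t - p0 t) ^+ 2 = norm2 q ^+ 2 - 2 * inner2 p0 q + norm2 p0 ^+ 2.
  move=> qL; have dL := L2B _ _ qL p0L.
  by rewrite !norm2_sqr// inner2Bl// !inner2Br// (inner2C q p0); ring.
rewrite X// in n2; rewrite X//.
move: E D0 h2 I1 I2 n2.
set S := \sum_i c i; set S' := \sum_i c' i; set Kc := \sum_i c i * _; set Kc' := \sum_i c' i * _.
set A := inner2 p0 r; set A' := inner2 p0 p'; set F := inner2 p0 f.
set Np := norm2 r ^+ 2; set Np' := norm2 p' ^+ 2; set N0 := norm2 p0 ^+ 2; set Q := (al + _) ^+ 2.
move=> E D0 h2 I1 I2 n2.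
have E1 : lam * (lam * Np / 2 + S) <= lam * (lam * Np' / 2 + S') by lra.
rewrite ler_pM2l// in E1.
have : lam * ((Np - 2 * A) - (Np' - 2 * A') - 2 * (C * lam)) <= 0 by move: h2; rewrite expr2; lra.
by rewrite pmulr_rle0//; lra.
Qed.

(** Changing the parameters of interval [j] alone changes the energy by [- lam] times the left side
    plus half the squared change of [Kstep], which is quadratic in the variation; minimality makes
    the total nonnegative. *)
Lemma vary j (t x y : R) : 0 <= c j + t <= 2 * c0 j ->
  I01 x -> `|x - a0 j| <= dl -> I01 y -> `|y - b0 j| <= dl ->
  (c j + t) * (peak p j x y - 1) - c j * (peak p j (a j) (b j) - 1) <=
  (2 * lam)^-1 * (B / 2 * (`|t| + c j * (`|x - a j| + `|y - b j|))) ^+ 2.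
Proof.
move=> ct xe xw ye yw.
pose c' i := if i == j then c j + t else c i.
pose a' i := if i == j then x else a i.
pose b' i := if i == j then y else b i.
have hb' : box dl c' a' b'.
  by move=> i; rewrite /c' /a' /b'; case: eqVneq => [->|_] //; exact: hb.
have ab' := box_ordered dlab hb'.
have [/andP[cj _] _ _] := hb j.
have nd : norm2 (fun s => Kstep c' a' b' s - Kstep c a b s) <= B / 2 * (`|t| + c j * (`|x - a j| + `|y - b j|)).
  apply: (le_trans (norm2_Kstep_diff c' c ab' ab)).
  rewrite (bigD1 j)//= big1 ?addr0; last first.
    by move=> i /negbTE ij; rewrite /c' /a' /b' ij !subrr normr0 addr0 mulr0 addr0.
  by rewrite /c' /a' /b' eqxx (ger0_norm cj) [c j + t]addrC addrK.
have nd2 : norm2 (fun s => Kstep c' a' b' s - Kstep c a b s) ^+ 2 <= (B / 2 * (`|t| + c j * (`|x - a j| + `|y - b j|))) ^+ 2.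
  by rewrite ler_pXn2r// nnegrE ?norm2_ge0// (le_trans (norm2_ge0 _) nd).
have [r [rE rT rL rI]] := residual_abstract c ab.
have [r' [rE' rT' rL' rI']] := residual_abstract c' ab'.
have E := hmin hb'; rewrite !energyE rE rE' in E.
rewrite rE.
have TdE : (fun s => Kstep c' a' b' s - Kstep c a b s) = fun s => lam * (r s - r' s).
  by apply/funext => s; rewrite rT rT'; ring.
have dL := L2B _ _ rL rL'.
move: nd2; rewrite TdE norm2Z// (gtr0_norm lam0) exprMn.
have -> : norm2 (fun s => r s - r' s) ^+ 2 = norm2 r' ^+ 2 - 2 * inner2 r r' + norm2 r ^+ 2.
  by rewrite !norm2_sqr// inner2Bl// !inner2Br// (inner2C r' r); ring.
have I1 := rI r rL; have I2 := rI' r rL.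
have pp : inner2 r r = norm2 r ^+ 2 by rewrite norm2_sqr.
have dS : \sum_i c' i - \sum_i c i = t.
  rewrite -sumrB (bigD1 j)//= big1 ?addr0 /c' ?eqxx; first by ring.
  by move=> i /negbTE ->; rewrite subrr.
have dK : \sum_i c' i * peak r i (a' i) (b' i) - \sum_i c i * peak r i (a i) (b i) =
   (c j + t) * peak r j x y - c j * peak r j (a j) (b j).
  rewrite -sumrB (bigD1 j)//= big1 ?addr0 /c' /a' /b' ?eqxx//.
  by move=> i /negbTE ->; rewrite subrr.
move: I1 I2 dS dK E; rewrite pp.
set S := \sum_i c i; set S' := \sum_i c' i; set Kc := \sum_i c i * _; set Kc' := \sum_i c' i * _.
set A := inner2 r r'; set F := inner2 r f; set Np := norm2 r ^+ 2; set Np' := norm2 r' ^+ 2.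
set Q := (_ * _) ^+ 2; set P1 := peak r j x y; set P2 := peak r j (a j) (b j).
move=> I1 I2 dS dK E nd2.
rewrite [leRHS]mulrC ler_pdivlMr ?mulr_gt0//.
have h : lam * (2 * ((c j + t) * (P1 - 1) - c j * (P2 - 1))) <= Q.
  have -> : (c j + t) * (P1 - 1) - c j * (P2 - 1) = (Kc' - Kc) - (S' - S) by rewrite dS dK; ring.
  have -> : Kc' = F - lam * A by move: I2; lra.
  have -> : Kc = F - lam * Np by move: I1; lra.
  by move: nd2 E; rewrite expr2; lra.
by move: h; lra.
Qed.

(** Each coefficient is interior to its range, so varying it both ways forces height 1. Varying one
    endpoint at a time gives a first-order inequality with quadratic loss, which strong convexity
    upgrades to a maximum over the whole window. *)
Lemma stationary : (forall i, 0 < c i < 2 * c0 i) -> L * norm2 (fun t => p t - p0 t) <= ka / 2 ->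
  forall i, peak p i (a i) (b i) = 1 /\ forall x y : R, I01 x -> I01 y ->
    `|x - a0 i| <= dl -> `|y - b0 i| <= dl -> peak p i x y <= 1.
Proof.
have [r [rE _ rL _]] := residual_abstract c ab; have V := vary; rewrite rE in V *.
move=> ci rr i; have /andP[ci0 ci1] := ci i; have [_ [ai wa] [bi wb]] := hb i.
have p1 : peak r i (a i) (b i) = 1.
  apply/eqP; rewrite -subr_eq0; apply/eqP.
  pose m := Num.min (c i) (2 * c0 i - c i).
  have m0 : 0 < m by rewrite lt_min ci0 subr_gt0.
  apply: (@flat_zero m ((2 * lam)^-1 * (B / 2) ^+ 2)) => // t; rewrite ler_norml => /andP[t1 t2].
  have mc : m <= c i by rewrite ge_min lexx.
  have mc' : m <= 2 * c0 i - c i by rewrite ge_min lexx orbT.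
  have ct : 0 <= c i + t <= 2 * c0 i.
    by move: mc mc' t1 t2; move=> *; apply/andP; split; lra.
  have := V i t _ _ ct ai wa bi wb; rewrite !subrr !normr0 addr0 mulr0 addr0 exprMn real_normK ?num_real//.
  by rewrite mulrA; lra.
split=> // x y xe ye xw yw.
have s0 z : 0 <= ka / 8 * z ^+ 2 by rewrite mulr_ge0 ?sqr_ge0// divr_ge0// ltW.
have ct0 : 0 <= c i + 0 <= 2 * c0 i by rewrite addr0 !ltW.
(* Recasts the outcome of [vary] as the quadratic loss expected by [growth_near], after division by
   [c i / 2]. *)
have slack z z' t : 0 <= t <= 1 -> c i * (z / 2) <= (2 * lam)^-1 * (B / 2 * (c i * `|t * z'|)) ^+ 2 ->
    - (2 / c i * ((2 * lam)^-1 * (B / 2 * (c i * `|z'|)) ^+ 2)) * t ^+ 2 <= - z.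
  move=> /andP[t0 _]; rewrite normrM (ger0_norm t0) => h.
  rewrite mulNr lerN2 -(ler_pM2l (_ : 0 < c i / 2)) ?divr_gt0//.
  have -> : c i / 2 * z = c i * (z / 2) by field.
  apply: (le_trans h); rewrite le_eqVlt; apply/orP; left; apply/eqP.
  by field; rewrite !gt_eqF.
have K0 (z' : R) : 0 <= 2 / c i * ((2 * lam)^-1 * (B / 2 * (c i * `|z'|)) ^+ 2).
  by rewrite mulr_ge0 ?divr_ge0 ?(ltW ci0)// mulr_ge0 ?sqr_ge0// invr_ge0 mulr_ge0// ltW.
have ga : ka / 4 * (x - a i) ^+ 2 <= sg i * (H r x - H r (a i)).
  apply: (growth_near rL rr (or_introl (conj erefl erefl)) _ _ (K0 (x - a i))).
  - exact: le_trans wa dlle.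
  - exact: le_trans xw dlle.
  move=> t t01; rewrite -[leRHS]opprK; apply: (slack _ _ _ t01).
  have := V i 0 _ _ ct0 (I01_convex ai xe t01) (win_convex wa xw t01) bi wb.
  rewrite normr0 addr0 add0r p1 subrr mulr0 subr0 subrr normr0 addr0 [a i + _]addrC addrK.
  apply: le_trans; rewrite ler_wpM2l ?(ltW ci0)//.
  by move: p1; rewrite /peak [t * _ + a i]addrC; lra.
have gb : ka / 4 * (y - b i) ^+ 2 <= - sg i * (H r y - H r (b i)).
  apply: (growth_near rL rr (or_intror (conj erefl erefl)) _ _ (K0 (y - b i))).
  - exact: le_trans wb dlle.
  - exact: le_trans yw dlle.
  move=> t t01; rewrite -[leRHS]opprK; apply: (slack _ _ _ t01).
  have := V i 0 _ _ ct0 ai wa (I01_convex bi ye t01) (win_convex wb yw t01).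
  rewrite normr0 addr0 add0r p1 subrr mulr0 subr0 subrr normr0 add0r [b i + _]addrC addrK.
  apply: le_trans; rewrite ler_wpM2l ?(ltW ci0)//.
  by move: p1; rewrite /peak [t * _ + b i]addrC; lra.
have := peak_growth ga gb; rewrite p1; have := s0 (x - a i); have := s0 (y - b i); lra.
Qed.

Lemma residual_osc2 rho : gap dl rho -> (forall i, 0 < c i < 2 * c0 i) ->
  L * norm2 (fun t => p t - p0 t) <= ka / 2 -> B * norm2 (fun t => p t - p0 t) <= 2 * rho ->
  osc2 e kt p.
Proof.
move=> gp ci pp pr x y xe ye; have S := stationary ci pp; have pL := residual_L2 c a b.
rewrite -[leRHS]mulr1; apply: (osc_glue gp (lexx 1)) xe ye => {x y}.
  move=> x y xe ye; rewrite -(HofB L0 ktL ktB)//; apply: (le_trans (Hlip _ _ (L2B _ _ pL p0L))).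
  apply: (le_trans _ pr); rewrite -[leRHS]mulr1 ler_wpM2l ?I01_abs// mulr_ge0 ?norm2_ge0//.
by move=> i x y xe ye xw yw; exact: (S i).2.
Qed.

(* Pairing with the biorthogonal system isolates each coefficient. *)
Lemma coefficient_error j : `|c j - c0 j| <=
  2 * norm2 (bq j) * (norm2 w + lam * norm2 p) + 4 * B * norm2 (bq j) * (\sum_i c0 i) * dl.
Proof.
have [r [rE rT rL _]] := residual_abstract c ab; rewrite rE.
have qL := bqL j; set q := bq j in qL *.
have dE : inner2 q (fun t => Kstep c a b t - Kstep c0 a0 b0 t) =
   1 / 2 * sg j * (c j - c0 j) + \sum_i c i * (peak q i (a i) (b i) - peak q i (a0 i) (b0 i)).
  rewrite inner2Br ?Kstep_L2// !inner2_Kstep//.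
  have -> : 1 / 2 * sg j * (c j - c0 j) = \sum_i (c i - c0 i) * peak q i (a0 i) (b0 i).
    rewrite (bigD1 j)//= big1 ?addr0; last by move=> i /negbTE ij; rewrite /peak bqE ij !mulr0.
    by rewrite /peak bqE eqxx mulr1n mulr1; ring.
  by rewrite -big_split/= -sumrB; apply: eq_bigr => i _; ring.
have dT : (fun t => Kstep c a b t - Kstep c0 a0 b0 t) = fun t => w t - lam * r t.
  by apply/funext => t; rewrite rT /f; ring.
have lrL := L2Z lam _ rL.
have h1 : `|inner2 q (fun t => Kstep c a b t - Kstep c0 a0 b0 t)| <= norm2 q * (norm2 w + lam * norm2 r).
  rewrite dT; apply: (le_trans (cauchy_schwarz _ _ qL (L2B _ _ wL lrL))).
  rewrite ler_wpM2l ?norm2_ge0//; apply: (le_trans (norm2B _ _ wL lrL)).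
  by rewrite norm2Z// gtr0_norm.
have h2 : `|\sum_i c i * (peak q i (a i) (b i) - peak q i (a0 i) (b0 i))| <= 2 * B * norm2 q * (\sum_i c0 i) * dl.
  apply: (le_trans (ler_norm_sum _ _ _)); rewrite mulr_sumr mulr_suml; apply: ler_sum => i _.
  have [/andP[ci0 ci1] [_ wa] [_ wb]] := hb i.
  rewrite normrM (ger0_norm ci0).
  apply: (@le_trans _ _ (2 * c0 i * (B / 2 * norm2 q * (dl + dl)))); last by lra.
  apply: ler_pM => //; apply: (le_trans (peak_lip _ _ _ _ _ qL)).
  by rewrite ler_wpM2l ?lerD// mulr_ge0 ?norm2_ge0// divr_ge0.
have -> : `|c j - c0 j| = 2 * `|1 / 2 * sg j * (c j - c0 j)|.
  by rewrite !normrM sgn normr1 (ger0_norm (_ : 0 <= 2^-1 :> R))//; field.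
have -> : 1 / 2 * sg j * (c j - c0 j) = inner2 q (fun t => Kstep c a b t - Kstep c0 a0 b0 t) -
   \sum_i c i * (peak q i (a i) (b i) - peak q i (a0 i) (b0 i)) by rewrite dE; ring.
have := ler_normB (inner2 q (fun t => Kstep c a b t - Kstep c0 a0 b0 t))
  (\sum_i c i * (peak q i (a i) (b i) - peak q i (a0 i) (b0 i))).
by move: h1 h2; set N1 := `|_|; set N2 := `|\sum_i _|; lra.
Qed.

End data.
Lemma stability (ep r : R) : 0 < ep -> 0 < r -> exists2 dl0 : R, 0 < dl0 &
  forall dl, 0 < dl -> dl <= dl0 -> exists al lam0 : R, [/\ 0 < al, 0 < lam0 &
  forall lam w, 0 < lam -> lam <= lam0 -> w \in L2 -> norm2 w <= al * lam -> exists c a b,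
  [/\ forall i, 0 < c i /\ `|c i - c0 i| <= ep, box dl c a b,
      norm2 (fun t => residual lam w c a b t - p0 t) <= r,
      osc2 e kt (residual lam w c a b) &
      forall i, peak (residual lam w c a b) i (a i) (b i) = 1]].
Proof.
move=> ep0 r0.
have [i|m m0 Hm] := @fin_pos_bound R 'I_n (fun i d => d <= c0 i / 2).
  by exists (c0 i / 2); rewrite ?divr_gt0.
have [i|g g0 Hg] := @fin_pos_bound R 'I_n (fun i d => 2 * d < b0 i - a0 i).
  exists ((b0 i - a0 i) / 4); first by rewrite divr_gt0// subr_gt0.
  by move=> d' d'0 h; have := hab0 i; lra.
(* [m] is at most half of every [c0 i], which keeps the coefficients strictly inside their range, as
   [stationary] requires. *)
pose ep1 := Num.min ep m; have ep10 : 0 < ep1 by rewrite lt_min ep0.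
pose Q := \sum_j norm2 (bq j); pose S0 := \sum_i c0 i.
have Q0 : 0 <= Q by apply: sumr_ge0 => i _; exact: norm2_ge0.
have S00 : 0 <= S0 by apply: sumr_ge0 => i _; exact: ltW.
have Qj j : norm2 (bq j) <= Q.
  by rewrite /Q (bigD1 j)//= lerDl; apply: sumr_ge0 => i _; exact: norm2_ge0.
(* [D * dl] bounds the part of [coefficient_error] due to the endpoints; it gets half of [ep1], and
   [lam * M] below gets the other half. *)
pose D := 4 * B * Q * S0; have D0 : 0 <= D by rewrite /D !mulr_ge0.
have D1 : 0 < D + 1 by rewrite ltr_wpDl.
exists (Num.min (Num.min g dl1) (ep1 / 2 / (D + 1))).
  by rewrite !lt_min g0 dl10 !divr_gt0.
move=> dl dl0; rewrite !le_min => /andP[/andP[dlg dlle]]; rewrite ler_pdivlMr// => dlD.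
have dlab i : 2 * dl < b0 i - a0 i by exact: Hg.
have [rho rho0 gp] := gap_exists dl0.
have [C C0 HC] := competitor; have [lam1 lam10 Hlam1] := HC dl dl0.
have B1 : 0 < B + 1 by rewrite ltr_wpDl. have L1 : 0 < L + 1 by rewrite ltr_wpDl.
(* The three bounds give the required closeness, keep the perturbation within the gap, and preserve
   half of the slope. *)
pose r1 := Num.min r (Num.min (2 * rho / (B + 1)) (ka / 2 / (L + 1))).
have r10 : 0 < r1 by rewrite !lt_min r0 !divr_gt0// mulr_gt0.
have r1r : r1 <= r by rewrite ge_min lexx.
have r1B : r1 * (B + 1) <= 2 * rho by rewrite -ler_pdivlMr// !ge_min lexx orbT.
have r1L : r1 * (L + 1) <= ka / 2 by rewrite -ler_pdivlMr// !ge_min lexx !orbT.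
(* With [C lam] at most [r1 / 4] and [r1^2 / 8], the bound of [residual_close] is at most
   [(3/4)^2 + 1/4 < 1] times [r1^2]. *)
pose al := r1 / 2; have al0 : 0 < al by rewrite divr_gt0.
have C1 : 0 < C + 1 by rewrite ltr_wpDl.
pose M := 2 * Q * (al + norm2 p0 + r1).
have M0 : 0 <= M by rewrite /M mulr_ge0 ?addr_ge0 ?norm2_ge0 ?(ltW al0) ?(ltW r10)// mulr_ge0.
have M1 : 0 < M + 1 by rewrite ltr_wpDl.
exists al, (Num.min (Num.min lam1 (ep1 / 2 / (M + 1))) (Num.min (r1 / 4 / (C + 1)) (r1 ^+ 2 / 8 / (C + 1)))).
split => //; first by rewrite !lt_min lam10 !divr_gt0// exprn_gt0.
move=> lam w lam0; rewrite !le_min => /andP[/andP[laml lamM] /andP[lamr lamr2]] wL wal.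
move: lamM lamr lamr2; rewrite !ler_pdivlMr// => lamM lamr lamr2.
have Clam : C * lam <= lam * (C + 1) by rewrite mulrDr mulr1 mulrC lerDl ltW.
have [c' [a' [b' [hc' ha' hb' res gapc]]]] := Hlam1 lam lam0 laml.
have box' : box dl c' a' b' by move=> i; split.
have [c [a [b [hb hmin]]]] := minimizer dl0 dlab lam0 wL.
exists c, a, b; set p := residual lam w c a b.
have pL : p \in L2 by exact: residual_L2.
have pr2 := residual_close dlab lam0 wL hb hmin box' wal C0 (res (box_ordered dlab box')) gapc.
have pr : norm2 (fun t => p t - p0 t) <= r1.
  rewrite -(ler_pXn2r (n := 2))// ?nnegrE ?norm2_ge0 ?(ltW r10)//; apply: (le_trans pr2).
  have c1 : C * lam <= r1 / 4 by rewrite ler_pdivlMr// (le_trans _ lamr)// ler_pM2r.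
  have c2 : C * lam <= r1 ^+ 2 / 8 by rewrite ler_pdivlMr// (le_trans _ lamr2)// ler_pM2r.
  have c0' : 0 <= C * lam by rewrite mulr_ge0// ltW.
  have h : (al + C * lam) ^+ 2 <= (al + r1 / 4) ^+ 2.
    by rewrite ler_pXn2r ?lerD2l// ?nnegrE ?addr_ge0 ?divr_ge0 ?(ltW r10) ?(ltW al0).
  by move: h c2; rewrite /al; nra.
have pp : L * norm2 (fun t => p t - p0 t) <= ka / 2.
  apply: (le_trans _ r1L); rewrite mulrC; apply: ler_pM => //; first exact: norm2_ge0.
  by rewrite lerDl.
have pB : B * norm2 (fun t => p t - p0 t) <= 2 * rho.
  apply: (le_trans _ r1B); rewrite mulrC; apply: ler_pM => //; first exact: norm2_ge0.
  by rewrite lerDl.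
have pn : norm2 p <= norm2 p0 + r1.
  have := norm2D _ _ (L2B _ _ pL p0L) p0L.
  have -> : (fun t => p t - p0 t + p0 t) = p by apply/funext => t; ring.
  by move=> h; apply: (le_trans h); rewrite addrC lerD2l.
have err j : `|c j - c0 j| <= ep1.
  apply: (le_trans (coefficient_error dlab lam0 wL hb j)).
  have h1 : 2 * norm2 (bq j) * (norm2 w + lam * norm2 p) <= 2 * Q * (al * lam + lam * (norm2 p0 + r1)).
    apply: ler_pM; rewrite ?mulr_ge0 ?addr_ge0 ?norm2_ge0 ?mulr_ge0 ?norm2_ge0 ?(ltW lam0)//.
      by rewrite ler_wpM2l.
    by rewrite lerD// ler_wpM2l// ltW.
  have h2 : 4 * B * norm2 (bq j) * S0 * dl <= D * dl.
    by rewrite ler_wpM2r ?(ltW dl0)// /D ler_wpM2r// ler_wpM2l// mulr_ge0.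
  have h3 : 2 * Q * (al * lam + lam * (norm2 p0 + r1)) = lam * M by rewrite /M; ring.
  by move: lamM dlD h1 h2 lam0 dl0; rewrite h3 -/S0; lra.
have ci i : 0 < c i < 2 * c0 i.
  apply: half_close => //; apply: (le_trans (err i)); apply: le_trans (Hm i m m0 (lexx m)).
  by rewrite ge_min lexx orbT.
split=> //.
- move=> i; have /andP[-> _] := ci i; split => //; apply: (le_trans (err i)).
  by rewrite ge_min lexx.
- exact: le_trans pr r1r.
- exact: (residual_osc2 dlle dlab lam0 wL hb hmin gp ci pp pB).
- by move=> i; have [] := stationary dlle dlab lam0 wL hb hmin ci pp i.
Qed.

(** * Uniqueness of the solution and of its representation *)

Section solution.
Context (dl : R) c a b (ab : ordered a b)
  (aw : forall i, `|a i - a0 i| <= dl) (bw : forall i, `|b i - b0 i| <= dl)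
  (dlQ : 2 * dl * B * \sum_j norm2 (bq j) <= 2^-1).

(* At the perturbed endpoints the system [bq] is biorthogonal up to a diagonally dominant error. *)
Lemma perturbed_free (be : 'I_n -> R) :
  (forall q, q \in L2 -> \sum_i be i * (H q (b i) - H q (a i)) = 0) -> forall i, be i = 0.
Proof.
move=> h; pose S := \sum_i `|be i|.
have bound m : `|be m| <= S * (2 * dl * B * norm2 (bq m)).
  have := h _ (bqL m).
  have -> : \sum_i be i * (H (bq m) (b i) - H (bq m) (a i)) = be m +
      \sum_i be i * ((H (bq m) (b i) - H (bq m) (a i)) - (H (bq m) (b0 i) - H (bq m) (a0 i))).
    have -> : be m = \sum_i be i * (H (bq m) (b0 i) - H (bq m) (a0 i)).
      rewrite (bigD1 m)//= big1 ?addr0 ?bqE ?eqxx ?mulr1// => i /negbTE im.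
      by rewrite bqE im mulr0.
    by rewrite -big_split/=; apply: eq_bigr => i _; ring.
  move=> /eqP; rewrite addr_eq0 => /eqP ->; rewrite normrN.
  apply: (le_trans (ler_norm_sum _ _ _)); rewrite mulr_suml; apply: ler_sum => i _.
  rewrite normrM ler_wpM2l//.
  have h1 := Hlip (a0 i) (a i) (bqL m); have h2 := Hlip (b0 i) (b i) (bqL m).
  have Bn : 0 <= B * norm2 (bq m) by rewrite mulr_ge0 ?norm2_ge0.
  have h3 : B * norm2 (bq m) * `|a i - a0 i| <= B * norm2 (bq m) * dl by rewrite ler_wpM2l.
  have h4 : B * norm2 (bq m) * `|b i - b0 i| <= B * norm2 (bq m) * dl by rewrite ler_wpM2l.
  rewrite (_ : _ - _ = (H (bq m) (b i) - H (bq m) (b0 i)) - (H (bq m) (a i) - H (bq m) (a0 i))); last by ring.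
  by apply: (le_trans (ler_normB _ _)); lra.
have S0 : 0 <= S by apply: sumr_ge0.
have : S <= S * (2 * dl * B * \sum_j norm2 (bq j)).
  by rewrite {1}/S !mulr_sumr; apply: ler_sum => m _; exact: bound.
move=> h1; have h2 : S * (2 * dl * B * \sum_j norm2 (bq j)) <= S * 2^-1 by rewrite ler_wpM2l.
have SE : S <= 0 by lra.
move=> i; apply/eqP; rewrite -normr_le0; apply: (le_trans _ SE).
by rewrite /S (bigD1 i)//= lerDl; apply: sumr_ge0.
Qed.

(** Independence of the increment functionals at the perturbed endpoints yields a biorthogonal
    system there, and prescribed increments are combinations of it. *)
Lemma interpolation (ta : 'I_n -> R) : exists2 q, q \in L2 & forall i, H q (b i) - H q (a i) = ta i.
Proof.
have p12 : (1%:E <= 2%:E :> \bar R)%E by rewrite lee_fin ler1n.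
pose W := LfunType mu p12.
have WL (q : W) : (q : R -> R) \in L2 by exact: LfunP.
pose al i (q : W) : R := H q (b i) - H q (a i).
have lal i (z : R) (x y : W) : al i (z *: x + y) = z * al i x + al i y.
  rewrite /al; have -> : ((z *: x + y : W) : R -> R) = fun t => z * x t + y t by [].
  by rewrite (HofD L0 ktL ktB) ?L2Z// (HofZ L0 ktL ktB).
have [|qq Hqq] := @biorthogonal R W n al lal.
  move=> be h; apply: perturbed_free => q qL; exact: (h (Lfun_Sub p12 qL)).
have al0 i : al i 0 = 0 by have := lal i 1 0 0; rewrite scaler0 addr0; lra.
exists (\sum_j ta j *: qq j : W) => [|i]; first exact: WL.
change (al i (\sum_j ta j *: qq j : W) = ta i).
have -> : al i (\sum_j ta j *: qq j) = \sum_j ta j * al i (qq j).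
  elim: (index_enum _) => [|j r IH]; first by rewrite !big_nil.
  by rewrite !big_cons lal IH.
rewrite (bigD1 i)//= big1 ?addr0 ?Hqq ?eqxx ?mulr1// => j ji.
by rewrite Hqq eq_sym (negbTE ji) mulr0.
Qed.

Context (dlle : dl <= dl1) p (pL : p \in L2) (po : osc2 e kt p)
  (pp : L * norm2 (fun t => p t - p0 t) <= ka / 2) (pab : forall i, peak p i (a i) (b i) = 1).

(** Both endpoint pairs have height 1 in the same window, so quadratic decay makes them coincide;
    [perturbed_free] then separates the coefficients. *)
Lemma unique_representation c' a' b' : ordered a' b' ->
  (forall i, `|a' i - a0 i| <= dl1) -> (forall i, `|b' i - b0 i| <= dl1) ->
  (forall i, peak p i (a' i) (b' i) = 1) ->
  step_comb c sg a b = step_comb c' sg a' b' %[ae mu] ->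
  [/\ c' =1 c, a' =1 a & b' =1 b].
Proof.
move=> ab' aw' bw' p' uu.
have E i : a' i = a i /\ b' i = b i.
  have [ai bi _] := ab i; have [ai' bi' _] := ab' i.
  have := osc2_growth pL pp po ai bi ai' bi' (le_trans (aw i) dlle) (le_trans (bw i) dlle) (aw' i) (bw' i) (pab i).
  rewrite p' => h.
  have h0 : ka / 8 * ((a' i - a i) ^+ 2 + (b' i - b i) ^+ 2) <= 0 by lra.
  have k8 : 0 < ka / 8 by rewrite divr_gt0.
  move: h0; rewrite pmulr_rle0// => h0.
  have s1 := sqr_ge0 (a' i - a i); have s2 := sqr_ge0 (b' i - b i).
  have z1 : (a' i - a i) ^+ 2 = 0 by apply/le_anti; rewrite s1 andbT; lra.
  have z2 : (b' i - b i) ^+ 2 = 0 by apply/le_anti; rewrite s2 andbT; lra.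
  by split; apply/eqP; rewrite -subr_eq0 -sqrf_eq0 ?z1 ?z2.
have aE : a' = a by apply/funext => i; exact: (E i).1.
have bE : b' = b by apply/funext => i; exact: (E i).2.
split; [|by move=> i; rewrite aE|by move=> i; rewrite bE].
move=> i; apply/eqP; rewrite -subr_eq0; apply/eqP.
have sg0 : 1 / 2 * sg i != 0 by rewrite mulf_neq0// -normr_eq0 sgn oner_eq0.
apply: (mulIf sg0); rewrite mul0r; move: i {sg0}; apply: perturbed_free => q qL.
have uL := step_Loo c sg a b; have uL' := step_Loo c' sg a' b'.
have := int_eta_step c qL ab; have := int_eta_step c' qL ab'.
have -> : \int[mu]_x (eta q x * step_comb c' sg a' b' x) = \int[mu]_x (eta q x * step_comb c sg a b x).
  have mi u : u \in Loo -> measurable_fun setT (fun x => eta q x * u x).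
    by move=> /(Loo_intgM _ _ (continuous_intg (eta_cont qL)))/intg_measurable.
  apply: ae_int; [exact: mi|exact: mi|].
  by apply: ae01S uu => x h I; rewrite h.
rewrite aE bE => -> /eqP; rewrite -subr_eq0 => /eqP h; rewrite -[RHS]h -sumrB.
by apply: eq_bigr => i _; rewrite /peak; ring.
Qed.

(** Subtracting [eta q] from [g] equalises the primitive [Th] at the endpoints of each interval. It
    then disturbs a peak only in proportion to the distance from the endpoints, which the quadratic
    decay absorbs, and [rigidity] applies. *)
Lemma unique_solution rho v V : gap dl1 rho -> 0 < rho ->
  B * norm2 (fun t => p t - p0 t) <= rho -> v \in Loo -> Greg e v = V%:E ->
  \int[mu]_x (eta p x * v x) = V ->
  (forall q, q \in L2 -> \int[mu]_x (eta q x * (v x - step_comb c sg a b x)) = 0) ->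
  v = step_comb c sg a b %[ae mu].
Proof.
move=> gp rho0 pr vL Gv pv qv; have uL := step_Loo c sg a b.
apply: continuous_dual_unique => // g cg.
have [G dG] := antiderivative cg.
have [q qL qE] := interpolation (fun i => G (b i) - G (a i)).
pose th (x : R) : R := g x - eta q x; pose Th (x : R) : R := G x - H q x.
have dT (x : R) : is_derive x 1 Th (th x) by exact: (deriv_sub (dG x) (dH qL x)).
have ct : continuous th by apply: continuousB => //; exact: eta_cont.
have Tab i : Th (b i) = Th (a i) by have := qE i; rewrite /Th; lra.
have [M M0 HM] := continuous_bounded01 ct.
have Tl (x y : R) : I01 x -> I01 y -> `|Th y - Th x| <= M * `|y - x|.
  have Tl' (x' y' : R) : x' <= y' -> I01 x' -> I01 y' -> `|Th y' - Th x'| <= M * `|y' - x'|.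
    move=> xy xe ye; have [z /andP[z1 z2] ->] := mean_value dT xy.
    by rewrite normrM ler_wpM2r// HM//; move: e01 xe ye => e01' xe ye; lra.
  have [xy|/ltW yx] := leP x y; first exact: Tl'.
  by move=> xe ye; rewrite distrC [`|y - x|]distrC; exact: Tl'.
have ce := continuous_intg (eta_cont qL); have cth := continuous_intg ct.
have iq u : u \in Loo -> \int[mu]_x (g x * u x) = \int[mu]_x (th x * u x) + \int[mu]_x (eta q x * u x).
  move=> uL'; rewrite -intD; [|exact: Loo_intgM|exact: Loo_intgM].
  by apply: eq_Rintegral => x _; rewrite /th; ring.
rewrite !iq//; congr (_ + _); last first.
  apply/eqP; rewrite -subr_eq0 -intB; [|exact: Loo_intgM|exact: Loo_intgM].
  by rewrite -[X in _ == X](qv q qL); apply/eqP; apply: eq_Rintegral => x _; ring.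
have -> : \int[mu]_x (th x * step_comb c sg a b x) = 0.
  rewrite int_step// big1// => i _; have [ai bi abi] := ab i.
  by rewrite (int_indic_deriv e01 ai bi abi dT ct) Tab subrr !mulr0.
(* Absorbing [t M Z / 2] into [ka Z^2 / 8] costs [M^2 t^2 / (2 ka)] at each of the two endpoints.
   The range [rho / M] of [t] spends half of the gap [2 * rho], the other half going to [p - p0]. *)
have ka' : 0 <= M ^+ 2 / ka by rewrite divr_ge0 ?sqr_ge0// ltW.
apply: (rigidity e01 Gv ka' (divr_gt0 rho0 M0) (dH pL) (eta_cont pL) dT ct pv).
move=> t x y; rewrite ler_pdivlMr// => tM xe ye.
have -> : H p x - H p y + t * (Th x - Th y) = (H p x + t * Th x) - (H p y + t * Th y) by ring.
have N1 : 1 <= 1 + M ^+ 2 / ka * t ^+ 2 by rewrite lerDl mulr_ge0// sqr_ge0.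
apply: (osc_glue (F := fun x => H p x + t * Th x) gp N1) xe ye => {x y}.
  move=> x y xe ye.
  have -> : H p y + t * Th y - (H p x + t * Th x) - (H p0 y - H p0 x) =
     (H (fun s => p s - p0 s) y - H (fun s => p s - p0 s) x) + t * (Th y - Th x).
    by rewrite (HofB L0 ktL ktB)//; ring.
  apply: (le_trans (ler_normD _ _)); rewrite (_ : 2 * rho = rho + rho); last by ring.
  apply: lerD.
    apply: (le_trans (Hlip _ _ (L2B _ _ pL p0L))); apply: (le_trans _ pr).
    by rewrite -[leRHS]mulr1 ler_wpM2l ?I01_abs// mulr_ge0 ?norm2_ge0.
  rewrite normrM; apply: (le_trans _ tM); rewrite ler_wpM2l//.
  apply: (le_trans (Tl x y xe ye)).
  by rewrite -[leRHS]mulr1 ler_wpM2l ?I01_abs// ltW.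
move=> i x y xe ye xw yw; have [ai bi _] := ab i.
have g1 := osc2_growth pL pp po ai bi xe ye (le_trans (aw i) dlle) (le_trans (bw i) dlle) xw yw (pab i).
have -> : 1 / 2 * sg i * (H p y + t * Th y - (H p x + t * Th x)) =
   peak p i x y + t * sg i / 2 * ((Th y - Th (b i)) - (Th x - Th (a i))).
  by rewrite Tab /peak; field.
have t1 := Tl _ _ bi ye; have t2 := Tl _ _ ai xe.
set X := `|x - a i| in t2 *; set Y := `|y - b i| in t1 *.
have XX : (x - a i) ^+ 2 = X ^+ 2 by rewrite real_normK ?num_real.
have YY : (y - b i) ^+ 2 = Y ^+ 2 by rewrite real_normK ?num_real.
rewrite XX YY in g1.
have h : t * sg i / 2 * ((Th y - Th (b i)) - (Th x - Th (a i))) <= `|t| / 2 * (M * X + M * Y).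
  apply: (le_trans (ler_norm _)); rewrite !normrM sgn mulr1 (ger0_norm (_ : 0 <= 2^-1 :> R))//.
  rewrite ler_wpM2l// ?divr_ge0//; apply: (le_trans (ler_normB _ _)); rewrite addrC; exact: lerD.
have sq (Z : R) : `|t| / 2 * (M * Z) <= ka / 8 * Z ^+ 2 + M ^+ 2 / ka * t ^+ 2 / 2.
  rewrite -subr_ge0.
  have -> : ka / 8 * Z ^+ 2 + M ^+ 2 / ka * t ^+ 2 / 2 - `|t| / 2 * (M * Z) =
      ka / 8 * (Z - 2 * `|t| * M / ka) ^+ 2.
    by rewrite -(real_normK (num_real t)); field; rewrite gt_eqF.
  by rewrite mulr_ge0 ?sqr_ge0// divr_ge0// ltW.
by have := sq X; have := sq Y; move: h g1; lra.
Qed.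

End solution.

Lemma recovery (d : (R -> R) -> (R -> R) -> R) (hd : metric_on_B e d) (hw : metrizes_weak_star e d) :
  exists2 eps0 : R, 0 < eps0 & forall eps : R, 0 < eps < eps0 ->
    exists al lam0 : R, [/\ 0 < al, 0 < lam0 & forall (lam : R) w, w \in L2 -> norm2 w <= al * lam ->
      0 < lam -> lam <= lam0 ->
      let f := Kstep c0 a0 b0 \+ w in
      exists u : R -> R, [/\ primal_solution e k lam f u,
        forall v, primal_solution e k lam f v -> v = u %[ae mu] &
        let is_repr c a b :=
          u = step_comb c sg a b %[ae mu] /\
          forall i, [/\ Bball e d eps (atom (sg i) (a0 i) (b0 i)) (atom (sg i) (a i) (b i)),
            1 / 2 * sg i * (\int[@lebesgue_measure R]_(x in `[a i, b i]) eta_reg e k lam f x) = 1,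
            0 < c i & `|c i - c0 i| <= eps] in
        exists c a b, is_repr c a b /\
          forall c' a' b', is_repr c' a' b' -> [/\ c' =1 c, a' =1 a & b' =1 b]]].
Proof.
(* This decides how small [eps] must be: any representation in balls of radius below [eps0] has its
   endpoints in the window where [unique_representation] holds. *)
pose Pinv i (r : R) := forall x y, Bball e d r (atom (sg i) (a0 i) (b0 i)) (atom (sg i) x y) ->
  [/\ I01 x, I01 y, x < y, `|x - a0 i| <= dl1 & `|y - b0 i| <= dl1].
have [i|eps0 eps00 Heps] := @fin_pos_bound R _ Pinv.
  have [r r0 Hr] := Bball_atom_inv e01 hd hw (hsg i) (ha0 i) (hb0 i) (hab0 i) dl10.
  exists r => // r' r'0 rr x y [Bx dx]; apply: Hr; split => //; exact: le_trans rr.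
exists eps0 => // eps /andP[ep0 epl].
have [i|dn dn0 Hdn] := @fin_pos_bound R 'I_n (fun i dl => forall x y, I01 x -> I01 y -> x < y ->
    `|x - a0 i| <= dl -> `|y - b0 i| <= dl ->
    Bball e d eps (atom (sg i) (a0 i) (b0 i)) (atom (sg i) x y)).
  have [dl dl0 Hdl] := Bball_atom_near e01 hw (hsg i) (ha0 i) (hb0 i) (hab0 i) ep0.
  by exists dl => // dl' dl'0 dd x y xe ye xy xw yw; apply: Hdl => //; exact: le_trans dd.
have [i|g g0 Hg] := @fin_pos_bound R 'I_n (fun i d => 2 * d < b0 i - a0 i).
  exists ((b0 i - a0 i) / 4); first by rewrite divr_gt0// subr_gt0.
  by move=> d' d'0 h; have := hab0 i; lra.
have [rho rho0 gp] := gap_exists dl10.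
have B1 : 0 < B + 1 by rewrite ltr_wpDl. have L1 : 0 < L + 1 by rewrite ltr_wpDl.
pose r := Num.min (rho / (B + 1)) (ka / 2 / (L + 1)).
have r0 : 0 < r by rewrite lt_min !divr_gt0.
have rB : r * (B + 1) <= rho by rewrite -ler_pdivlMr// ge_min lexx.
have rL : r * (L + 1) <= ka / 2 by rewrite -ler_pdivlMr// ge_min lexx orbT.
have [ds ds0 Hds] := stability ep0 r0.
pose Q := \sum_j norm2 (bq j).
have Q0 : 0 <= Q by apply: sumr_ge0 => i _; exact: norm2_ge0.
have BQ1 : 0 < B * Q + 1 by rewrite ltr_wpDl// mulr_ge0.
(* The bounds serve stability, membership in the metric balls, preservation of the order of
   endpoints, the window of the slopes, and diagonal dominance for [perturbed_free]. *)
pose dl := Num.min (Num.min ds dn) (Num.min (Num.min g dl1) (4^-1 / (B * Q + 1))).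
have dl0 : 0 < dl by rewrite !lt_min ds0 dn0 g0 dl10 divr_gt0.
have dls : dl <= ds by rewrite !ge_min lexx.
have dln : dl <= dn by rewrite !ge_min lexx !orbT.
have dlg : dl <= g by rewrite !ge_min lexx !orbT.
have dlle : dl <= dl1 by rewrite !ge_min lexx !orbT.
have dlQ : 2 * dl * B * Q <= 2^-1.
  have h : dl * (B * Q + 1) <= 4^-1 by rewrite -ler_pdivlMr// !ge_min lexx !orbT.
  by move: h dl0; lra.
have dlab i : 2 * dl < b0 i - a0 i by exact: Hg.
have [al [lam0 [al0 lam00 Hst]]] := Hds dl dl0 dls.
exists al, lam0; split => // lam w wL wal lamp laml f.
have [c [a [b [hc hb pr po p1]]]] := Hst lam w lamp laml wL wal.
have ab := box_ordered dlab hb.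
have aw i : `|a i - a0 i| <= dl by have [_ []] := hb i.
have bw i : `|b i - b0 i| <= dl by have [_ _ []] := hb i.
have ablt i : a i < b i.
  by have := dlab i; have := aw i; have := bw i; rewrite !ler_norml; lra.
have pE : residual lam w c a b = fun t => lam^-1 * (f t - Kop k (step_comb c sg a b) t) by rewrite residualE.
have fL : f \in L2 by apply: L2D => //; exact: Kstep_L2.
have pL : residual lam w c a b \in L2 by exact: residual_L2.
set p := residual lam w c a b in pr po p1 pE pL *.
have uL := step_Loo c sg a b.
have etaV : \int[mu]_x (eta p x * step_comb c sg a b x) = \sum_i c i.
  by rewrite int_eta_step//; apply: eq_bigr => i _; rewrite p1 mulr1.
(* The reverse inequality comes from the certificate: pairing with it gives the sum of the
   coefficients and is bounded by the seminorm. *)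
have GV : Greg e (step_comb c sg a b) = (\sum_i c i)%:E.
  have c0' i : 0 <= c i by apply: ltW; have [] := hc i.
  have le := @Greg_step R n c sg a b e e01 c0' hsg (fun i => let: And3 h _ _ := ab i in h)
    (fun i => let: And3 _ h _ := ab i in h) (fun i => let: And3 _ _ h := ab i in h).
  have [[V GV]|GV] := Greg_cases e (step_comb c sg a b); last by rewrite GV in le.
  rewrite GV lee_fin in le; rewrite GV; congr (_%:E); apply/le_anti; rewrite le/=.
  by rewrite -etaV; exact: (osc2_int_le e01 L0 ktL ktB pL po GV).
have opt := primal_optimal e01 ktk L0 B0 ktL ktB lamp fL uL GV pE po etaV.
have etaE := eta_reg_eq e01 ktk L0 B0 ktL ktB lamp fL uL GV pE po etaV.
have pB : B * norm2 (fun t => p t - p0 t) <= rho.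
  apply: (le_trans _ rB); rewrite mulrC; apply: ler_pM => //; first exact: norm2_ge0.
  by rewrite lerDl.
have pp : L * norm2 (fun t => p t - p0 t) <= ka / 2.
  apply: (le_trans _ rL); rewrite mulrC; apply: ler_pM => //; first exact: norm2_ge0.
  by rewrite lerDl.
have intE i (x y : R) : I01 x -> I01 y -> x <= y ->
    1 / 2 * sg i * (\int[@lebesgue_measure R]_(x in `[x, y]) eta_reg e k lam f x) = peak p i x y.
  move=> xe ye xy; rewrite etaE (int_leb_Kadj ktk L0 ktL ktB)//.
    by have := e01; move: xe; lra.
  by have := e01; move: ye; lra.
exists (step_comb c sg a b); split => //.
  move=> v sv; have [vL [V Gv pv] qv] :=
    primal_optimal_unique e01 ktk L0 B0 ktL ktB lamp fL uL GV pE po etaV sv.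
  exact: (unique_solution ab aw bw dlQ dlle pL po pp p1 gp rho0 pB vL Gv pv qv).
move=> is_repr; exists c, a, b; split.
  split; first exact: ae_eq_refl.
  move=> i; have [ai bi abi] := ab i; have [ci0 ci1] := hc i; split => //.
    by apply: (Hdn i dl dl0 dln).
  by rewrite intE// p1.
move=> c' a' b' [uu H'].
have E i := Heps i eps ep0 (ltW epl) _ _ (let: And4 h _ _ _ := H' i in h).
apply: (unique_representation ab aw bw dlQ dlle pL po pp p1) uu.
- by move=> i; have [? ? /ltW] := E i.
- by move=> i; have [] := E i.
- by move=> i; have [] := E i.
- by move=> i; have [xe ye /ltW xy _ _] := E i; have [_ <- _ _] := H' i; rewrite intE.
Qed.

End certificate.

(** By continuity [s] times the derivative stays above half of its value at [c]. One number [d'] is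
    both window and slope, so that the property survives shrinking and a common value can be taken
    over all endpoints. *)
Lemma slope_near {R : realType} (f : R -> R) (c s : R) : 0 < c < 1 ->
  (forall x : R, 0 < x < 1 -> derivable f x 1) -> {for c, continuous (derive1 f)} ->
  0 < s * derive1 f c ->
  exists2 d : R, 0 < d & forall d', 0 < d' -> d' <= d -> forall x y : R,
    `|x - c| <= d' -> `|y - c| <= d' -> x <= y -> 0 < x /\ y < 1 /\ d' * (y - x) <= s * (f y - f x).
Proof.
move=> /andP[c0 c1] df cf fc.
pose ka := s * derive1 f c / 2; have ka0 : 0 < ka by rewrite divr_gt0.
have s0 : 0 < `|s| by rewrite normr_gt0; apply: contraTneq fc => ->; rewrite mul0r ltxx.
have /cvgrPdist_le/(_ (ka / `|s|)) := cf; rewrite divr_gt0// => /(_ isT).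
move=> /nbhs_ballP[r /= r0 Hr].
pose m := Num.min (Num.min c (1 - c)) (Num.min r ka).
have m0 : 0 < m by rewrite !lt_min c0 subr_gt0 c1 r0.
exists (m / 2); first by rewrite divr_gt0.
move=> d d0 dm x y xw yw xy.
have mc : m <= c by rewrite !ge_min lexx.
have mc' : m <= 1 - c by rewrite !ge_min lexx !orbT.
have mr : m <= r by rewrite !ge_min lexx !orbT.
have mk : m <= ka by rewrite !ge_min lexx !orbT.
move: xw yw; rewrite !ler_norml => /andP[x1 x2] /andP[y1 y2].
have x0 : 0 < x by lra.
have yl : y < 1 by lra.
split => //; split => //.
have D (z : R) : x <= z <= y -> is_derive z 1 f (derive1 f z).
  by move=> /andP[z1 z2]; rewrite derive1E; apply: derivableP; apply: df; lra.
have [||z] := @MVT_segment R f (derive1 f) x y xy.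
- by move=> z; rewrite in_itv/= => /andP[/ltW z1 /ltW z2]; apply: D; rewrite z1.
- by apply: derivable_within_continuous => z; rewrite in_itv/= => /D [].
rewrite in_itv/= => /andP[z1 z2] ->; rewrite mulrA ler_wpM2r ?subr_ge0//.
have : `|derive1 f c - derive1 f z| <= ka / `|s|.
  by apply: Hr; rewrite /ball/= ltr_norml; lra.
rewrite ler_pdivlMr// -normrM mulrC mulrBr ler_norml => /andP[h1 h2].
by move: h2; rewrite /ka; move: dm mk; rewrite /ka; lra.
Qed.

(** * From the hypotheses to the data of the certificate *)

Section certificate_data.
Context {R : realType} (e : R) (k kt : R -> R) (L B : R).
Context (e01 : 0 < e < 1) (ktk : forall x : R, -1 <= x <= 1 -> kt x = k x)
  (L0 : 0 <= L) (B0 : 0 <= B)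
  (ktL : forall x y, `|kt x - kt y| <= L * `|x - y|) (ktB : forall x, `|kt x| <= B).
Context (n : nat) (c0 sg a0 b0 : 'I_n -> R).
Context (hc0 : forall i, 0 < c0 i) (hsg : forall i, sg i = 1 \/ sg i = -1)
  (ha0 : forall i, e <= a0 i <= 1 - e) (hb0 : forall i, e <= b0 i <= 1 - e)
  (hab0 : forall i, a0 i < b0 i).
Local Notation mu := (@mu01 R).
Local Notation L2 := (Lfun mu 2%:E).
Local Notation H := (Hof kt).

Lemma biorthogonal_system :
  (forall be : 'I_n -> R, (fun t => \sum_(i < n) be i * Kop k \1_`[a0 i, b0 i] t) = cst 0 %[ae mu] ->
     forall i, be i = 0) ->
  exists bq : 'I_n -> R -> R, (forall j, bq j \in L2) /\
    forall i j, H (bq j) (b0 i) - H (bq j) (a0 i) = (i == j)%:R.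
Proof.
move=> free.
have p12 : (1%:E <= 2%:E :> \bar R)%E by rewrite lee_fin ler1n.
pose W := LfunType mu p12.
have WL (q : W) : (q : R -> R) \in L2 by exact: LfunP.
pose al i (q : W) : R := H q (b0 i) - H q (a0 i).
have [i z x y|be h|qq Hqq] := @biorthogonal R W n al.
- rewrite /al; have -> : ((z *: x + y : W) : R -> R) = fun t => z * x t + y t by [].
  by rewrite (HofD L0 ktL ktB) ?L2Z// (HofZ L0 ktL ktB).
- have KL i : (fun t => be i * Kop k \1_`[a0 i, b0 i] t) \in L2.
    by apply: L2Z; apply: (Kop_L2 ktk L0 B0 ktL ktB); exact: indic_L2.
  apply: free; apply: inner2_eq0; first exact: L2_sum.
  set g := (X in inner2 X _); have gL : g \in L2 by exact: L2_sum.
  rewrite inner2_sumr// (_ : \sum_i _ = 0)//.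
  rewrite -[RHS](h (Lfun_Sub p12 gL)); apply: eq_bigr => i _.
  rewrite inner2Zr//; last by apply: (Kop_L2 ktk L0 B0 ktL ktB); exact: indic_L2.
  by rewrite (inner2_Kop_indic e01 ktk L0 ktL ktB gL (ha0 i) (hb0 i) (ltW (hab0 i))).
by exists (fun j => (fun q : W => (q : R -> R)) (qq j)); split => [j|i j]; [exact: WL|exact: Hqq].
Qed.

Let y0 := Kop k (step_comb c0 sg a0 b0).
Let p0 := xget (cst 0) (min_norm_dual_solution e k y0).

Lemma inner2_datum q : q \in L2 -> inner2 y0 q = \sum_i c0 i * peak kt sg q i (a0 i) (b0 i).
Proof.
move=> qL; rewrite inner2C /y0 -KstepE (inner2_Kstep e01 ktk L0 ktL ktB)// => i.
by split; rewrite ?(ltW (hab0 i)).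
Qed.

(** If the set were empty, [xget] would return 0, whose integrals vanish, so [n = 0]. But then the
    dual objective is identically 0 and the zero function is itself a solution of minimal norm. *)
Lemma min_norm_dual_solutionP :
  (forall i, \int[@lebesgue_measure R]_(x in `[a0 i, b0 i]) Kadj k p0 x != 0) ->
  min_norm_dual_solution e k y0 p0.
Proof.
rewrite /p0; case: xgetP => [p -> //|none h].
have zL : (cst 0 : R -> R) \in L2 by exact: L20.
have n0 (i : 'I_n) : False.
  have /eqP := h i; apply; rewrite (_ : Kadj k (cst 0) = cst 0).
    by rewrite Rintegral_cst// mul0r.
  apply/funext => t; rewrite /Kadj patchE; case: ifP => // _.
  by under eq_Rintegral do rewrite mulr0; rewrite Rintegral_cst// mul0r.
have I0 q : q \in L2 -> inner2 y0 q = 0 by move=> qL; rewrite inner2_datum// big1// => i; case: (n0 i).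
case: (none (cst 0)); split => [|q _]; last by rewrite norm20 norm2_ge0.
split=> [|q [qL _]]; last by rewrite !I0.
apply/(dual_feasibleP e01 ktk L0 B0 ktL ktB zL) => x y _ _.
have := Hof_lip L0 ktL ktB y x zL; rewrite norm20 mulr0 mul0r.
by rewrite ler_norml => /andP[_ h']; apply: (le_trans h').
Qed.

(** The dual objective is a positive combination of heights, each at most 1 for feasible functions;
    so heights all equal to 1 characterise maximality well enough for [q] to compete in norm. *)
Lemma min_norm_dual_solution_norm p q : min_norm_dual_solution e k y0 p -> q \in L2 -> osc2 e kt q ->
  (forall i, peak kt sg q i (a0 i) (b0 i) = 1) -> norm2 p <= norm2 q.
Proof.
move=> [_ hp] qL qo q1; apply: hp; split; first exact/(dual_feasibleP e01 ktk L0 B0 ktL ktB qL).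
move=> q' [q'L q'f]; have q'o : osc2 e kt q' by apply/(dual_feasibleP e01 ktk L0 B0 ktL ktB q'L).
rewrite !inner2_datum//; apply: ler_sum => i _.
by rewrite ler_wpM2l ?(ltW (hc0 i))// q1; exact: (peak_le hsg i q'o (ha0 i) (hb0 i)).
Qed.

End certificate_data.

Unset Implicit Arguments.
Set Strict Implicit.

Theorem theorem6p13 (R : realType) (ebar : R) (k : R -> R)
    (d : (R -> R) -> (R -> R) -> R) (n : nat)
    (c0 sigma a0 b0 : 'I_n -> R) (u0 y0 eta0 : R -> R)
    (hebar : 0 < ebar < 1)
    (hk : C2_sym k)
    (hd : metric_on_B ebar d)
    (hd_weak : metrizes_weak_star ebar d)
    (hc0 : forall i, 0 < c0 i)
    (hsigma : forall i, sigma i = 1 \/ sigma i = -1)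
    (ha0 : forall i, ebar <= a0 i <= 1 - ebar)
    (hb0 : forall i, ebar <= b0 i <= 1 - ebar)
    (hab0 : forall i, a0 i < b0 i)
    (hu0 : u0 = step_comb c0 sigma a0 b0)
    (hy0 : y0 = Kop k u0)
    (heta0 : eta0 = eta_min ebar k y0)
    (hsource : (Kadj k @` [set p | p \in Lfun (@mu01 R) 2%:E])
                 `&` subdiffG ebar u0 !=set0)
    (hlocal : forall s a b : R, s = 1 \/ s = -1 ->
       ebar <= a <= 1 - ebar -> ebar <= b <= 1 - ebar -> a < b ->
       (1 / 2 * s * (\int[@lebesgue_measure R]_(x in `[a, b]) eta0 x) = 1 <->
        exists i, [/\ s = sigma i, a = a0 i & b = b0 i]))
    (hC1 : C1_oo eta0)
    (ha0' : forall i, 0 < sigma i * derive1 eta0 (a0 i))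
    (hb0' : forall i, sigma i * derive1 eta0 (b0 i) < 0)
    (hfree : forall beta : 'I_n -> R,
       (fun t => \sum_(i < n) beta i * Kop k \1_`[a0 i, b0 i] t)
         = cst 0 %[ae @mu01 R] ->
       forall i, beta i = 0) :
  exists2 eps0 : R, 0 < eps0 & forall eps : R, 0 < eps < eps0 ->
    exists alpha lambda0 : R, [/\ 0 < alpha, 0 < lambda0 &
      forall (lambda : R) (w : R -> R),
        noise_set alpha lambda0 (lambda, w) -> 0 < lambda ->
        let is_solution := primal_solution ebar k lambda (y0 \+ w) in
        let eta := eta_reg ebar k lambda (y0 \+ w) in
        exists u : R -> R,
          [/\ is_solution u,
              forall v, is_solution v -> v = u %[ae @mu01 R]
            & let is_repr (c a b : 'I_n -> R) :=
                u = step_comb c sigma a b %[ae @mu01 R] /\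
                forall i,
                  [/\ Bball ebar d eps (atom (sigma i) (a0 i) (b0 i))
                        (atom (sigma i) (a i) (b i)),
                      1 / 2 * sigma i *
                        (\int[@lebesgue_measure R]_(x in `[a i, b i]) eta x)
                        = 1,
                      0 < c i
                    & `|c i - c0 i| <= eps] in
              exists c a b : 'I_n -> R,
                is_repr c a b /\
                forall c' a' b' : 'I_n -> R, is_repr c' a' b' ->
                  [/\ c' =1 c, a' =1 a & b' =1 b]]].
Proof.
have [kt [L [B [ktk L0 B0 ktL ktB]]]] := C2_sym_kernel hk.
have i01 (x : R) : ebar <= x <= 1 - ebar -> 0 < x < 1 by move: hebar => h1 h2; lra.
have y0E : y0 = Kop k (step_comb c0 sigma a0 b0) by rewrite hy0 hu0.
set p0 := xget (cst 0) (min_norm_dual_solution ebar k y0).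
have etaE : eta0 = Kadj k p0 by [].
have Hlocal i : 1 / 2 * sigma i * (\int[@lebesgue_measure R]_(x in `[a0 i, b0 i]) eta0 x) = 1.
  by apply/(hlocal _ _ _ (hsigma i) (ha0 i) (hb0 i) (hab0 i)); exists i.
have p0S : min_norm_dual_solution ebar k y0 p0.
  (* Height 1 on the given intervals excludes vanishing integrals of [eta0]. *)
  rewrite /p0 y0E; apply: (min_norm_dual_solutionP hebar ktk L0 B0 ktL ktB ha0 hb0 hab0) => i.
  rewrite -y0E -/p0 -etaE; apply/eqP => z; have := Hlocal i.
  by rewrite z mulr0 => /eqP; rewrite eq_sym oner_eq0.
have p0L : p0 \in Lfun (@mu01 R) 2%:E by case: p0S => [[[]]].
have p0o : osc2 ebar kt p0.
  by case: p0S => [[+ _] _] => /(dual_feasibleP hebar ktk L0 B0 ktL ktB p0L).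
have segE s (a b : R) : ebar <= a <= 1 - ebar -> ebar <= b <= 1 - ebar -> a <= b ->
    1 / 2 * s * (\int[@lebesgue_measure R]_(x in `[a, b]) eta0 x) = 1 / 2 * s * (Hof kt p0 b - Hof kt p0 a).
  move=> /i01/andP[a1 a2] /i01/andP[b1 b2] ab.
  by rewrite etaE (int_leb_Kadj ktk L0 ktL ktB p0L a1 ab b2).
have peak0 i : peak kt sigma p0 i (a0 i) (b0 i) = 1.
  by rewrite /peak -segE// ?Hlocal// ltW.
have p0min q : q \in Lfun (@mu01 R) 2%:E -> osc2 ebar kt q ->
    (forall i, peak kt sigma q i (a0 i) (b0 i) = 1) -> norm2 p0 <= norm2 q.
  move: p0S; rewrite y0E.
  exact: (min_norm_dual_solution_norm hebar ktk L0 B0 ktL ktB hc0 hsigma ha0 hb0 hab0).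
have peaks (s x y : R) : s = 1 \/ s = -1 -> ebar <= x <= 1 - ebar -> ebar <= y <= 1 - ebar -> x < y ->
    1 / 2 * s * (Hof kt p0 y - Hof kt p0 x) = 1 -> exists i, [/\ s = sigma i, x = a0 i & y = b0 i].
  move=> s1 xe ye xy h; apply/(hlocal s x y s1 xe ye xy).
  by rewrite segE// ltW.
have [df cf] := hC1.
(* The same number is used as slope and as window: both inequalities weaken as it shrinks, so one
   value fits all endpoints. *)
pose P i (d' : R) := (forall x y, `|x - a0 i| <= d' -> `|y - a0 i| <= d' -> x <= y ->
    d' * (y - x) <= sigma i * (eta_of kt p0 y - eta_of kt p0 x)) /\
  (forall x y, `|x - b0 i| <= d' -> `|y - b0 i| <= d' -> x <= y ->
    d' * (y - x) <= - sigma i * (eta_of kt p0 y - eta_of kt p0 x)).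
have [i|dl dl0 Hdl] := @fin_pos_bound R _ P.
  have [d1 d10 h1] := slope_near (i01 _ (ha0 i)) df (cf _ (i01 _ (ha0 i))) (ha0' i).
  have nb : 0 < - sigma i * derive1 eta0 (b0 i) by rewrite mulNr oppr_gt0.
  have [d2 d20 h2] := slope_near (i01 _ (hb0 i)) df (cf _ (i01 _ (hb0 i))) nb.
  exists (Num.min d1 d2); first by rewrite lt_min d10.
  move=> d' d'0; rewrite le_min => /andP[d'1 d'2]; split=> x y xw yw xy.
    have [x0 [y1]] := h1 d' d'0 d'1 x y xw yw xy.
    by rewrite etaE !(KadjE ktk)// ?x0 ?y1 ?(lt_le_trans x0 xy)// (le_lt_trans xy y1).
  have [x0 [y1]] := h2 d' d'0 d'2 x y xw yw xy.
  by rewrite etaE !(KadjE ktk)// ?x0 ?y1 ?(lt_le_trans x0 xy)// (le_lt_trans xy y1).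
have [bq [bqL bqE]] := biorthogonal_system hebar ktk L0 B0 ktL ktB ha0 hb0 hab0 hfree.
have mona i := (Hdl i dl dl0 (lexx dl)).1; have monb i := (Hdl i dl dl0 (lexx dl)).2.
have [eps0 eps00 Heps] := recovery hebar ktk L0 B0 ktL ktB hc0 hsigma ha0 hb0 hab0 p0L p0o peak0 p0min
  dl0 dl0 mona monb peaks bqL bqE hd hd_weak.
exists eps0 => // eps /Heps [al [lam0 [al0 lam00 Hst]]]; exists al, lam0; split => // lambda w.
move=> [/= /andP[_ laml] wL wal] lamp; have := Hst lambda w wL wal lamp laml.
by rewrite KstepE -y0E.
Qed.
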